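(* The Hilbert space is the only separable reflexive Banach space $X$ for which each closed subspace $Y$ of $X$ is equal to its envelope, i.e. satisfies $\mathrm{Env}(Y)=Y$. Moreover, it is enough to require this for $2$-dimensional subspaces: a separable reflexive Banach space $X$ in which $\mathrm{Env}(Y)=Y$ for every $2$-dimensional subspace $Y$ of $X$ is (isometrically) a Hilbert space.
   Context: $\mathrm{Isom}(X)$ is the group of surjective linear isometries of the Banach space $X$. For a subspace $Y$ of $X$, the (isometric) envelope $\mathrm{Env}(Y)$ is the set of $x\in X$ such that whenever a net $(T_i)_{i\in I}$ in $\mathrm{Isom}(X)$ satisfies $T_i y\to y$ for every $y\in Y$, then $T_i x\to x$ (norm convergence).
   Formalization: In the ''moreover'' part X is assumed not to be itself 2-dimensional: otherwise its only 2-dimensional subspace is X, Env(X)=X holds trivially, and the claim fails, e.g. for the 2-dimensional l_1 space. *)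

(* Defs.v *)
From HB Require Import structures.
From mathcomp Require Import all_boot all_order all_algebra.
From mathcomp Require Import sesquilinear.
From mathcomp Require Import all_classical all_reals all_analysis.

Set Implicit Arguments.
Unset Strict Implicit.
Unset Printing Implicit Defensive.

Import Order.TTheory GRing.Theory Num.Theory.
Import numFieldNormedType.Exports.

Local Open Scope classical_set_scope.
Local Open Scope ring_scope.

Definition separable_space (X : topologicalType) : Prop :=
  exists2 D : set X, countable D & dense D.

Definition dual (K : numFieldType) (X : normedModType K) : set (X -> K^o) :=
  [set f | linear f /\ continuous f].

(* The canonical embedding into the bidual is onto: every functional that is
   linear on the dual and bounded on the dual unit ball is evaluation at a
   point. Values of phi outside the dual are irrelevant. *)
Definition reflexive_space (K : numFieldType) (X : normedModType K) : Prop :=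
  forall phi : (X -> K^o) -> K,
    (forall (a : K) (f g : X -> K^o), dual f -> dual g ->
       phi (a *: f + g) = a * phi f + phi g) ->
    (exists C : K, forall f : X -> K^o, dual f ->
       (forall x, `|x| <= 1 -> `|f x| <= 1) -> `|phi f| <= C) ->
    exists x : X, forall f : X -> K^o, dual f -> phi f = f x.

(* theta is the involution of the scalar field: the identity for real scalars,
   conjugation for complex ones. The given norm itself, not just an equivalent
   one, comes from an inner product. *)
Definition hilbertian (K : numFieldType) (theta : K -> K)
    (X : normedModType K) : Prop :=
  exists dot : {dot X for theta}, forall x : X, dot x x = `|x| ^+ 2.

Definition linear_subspace (K : numFieldType) (X : lmodType K) (Y : set X) : Prop :=
  Y 0 /\ forall (a : K) (u v : X), Y u -> Y v -> Y (a *: u + v).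

Definition has_dim (K : numFieldType) (X : lmodType K) (n : nat)
    (Y : set X) : Prop :=
  exists e : 'I_n -> X,
    (forall c : 'I_n -> K, \sum_(i < n) c i *: e i = 0 -> forall i, c i = 0) /\
    Y = range (fun c : 'I_n -> K => \sum_(i < n) c i *: e i).

Definition Isom (K : numFieldType) (X : normedModType K) :
    set {linear X -> X} :=
  [set T | (forall x, `|T x| = `|x|) /\ (forall y, exists x, T x = y)].

Definition directed (I : Type) (le : I -> I -> Prop) : Prop :=
  [/\ (exists i : I, True),
      (forall i, le i i),
      (forall i j k, le i j -> le j k -> le i k) &
      (forall i j, exists k, le i k /\ le j k)].

Definition net_tails (I : Type) (le : I -> I -> Prop) : set_system I :=
  [set A | exists i0, forall i, le i0 i -> A i].

Definition Env (K : numFieldType) (X : normedModType K) (Y : set X) : set X :=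
  [set x | forall (I : Type) (le : I -> I -> Prop) (T : I -> {linear X -> X}),
     directed le -> (forall i, Isom (T i)) ->
     (forall y, Y y -> (fun i => T i y) @ net_tails le --> y) ->
     (fun i => T i x) @ net_tails le --> x].

(* Main.v *)
Require Import Defs.
From HB Require Import structures.
From mathcomp Require Import all_boot all_order all_algebra.
From mathcomp Require Import sesquilinear complex ring lra.
From mathcomp Require Import all_classical all_reals all_analysis.

Set Implicit Arguments.
Unset Strict Implicit.
Unset Printing Implicit Defensive.

Import Order.TTheory GRing.Theory Num.Theory.
Import numFieldNormedType.Exports.

Local Open Scope classical_set_scope.
Local Open Scope ring_scope.

(** In a Hilbert space a vector x outside a closed subspace Y is moved by the reflection in the
   hyperplane orthogonal to the component of x perpendicular to Y, while this reflection fixes Y;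
   so Y is its own envelope.

   Conversely, let X be separable and reflexive. Consider the isometries that nearly fix a finite
   set s. A vector is asymptotically fixed if it is fixed in the limit by them, that is, if it
   lies in the envelope of s; a functional is asymptotically invariant if it satisfies the dual
   condition. A fixed point theorem (fixed_point), which rests on the existence of slices of small
   diameter in weakly compact convex sets, has two consequences. An asymptotically invariant
   functional that vanishes on the asymptotically fixed vectors is zero
   (asymptotically_invariant_eq0), and every vector y has an asymptotically invariant support
   functional F y (asymptotically_invariant_norming). Therefore, if the envelope of a line or plane
   is the line or plane itself, the invariant functionals attached to it form a space of dimension
   at most 1 or 2. In particular F maps projective lines into projective lines.

   If X has three independent vectors, then F is injective on projective points (F_inj), and the
   fundamental theorem of projective geometry makes it semilinear: F x is a multiple of A x for a
   semilinear map A into the dual (projective_semilinear). The support inequality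
   |A x v| * |x| <= |A x x| * |v| bounds A, and this forces its field endomorphism to be the
   identity for real scalars and the conjugation for complex ones (semilinear_conj). An isometry
   T satisfies A (T x) (T y) = c * A x y, with c near 1 when T nearly fixes x. Hence
   y |-> conj (A y x) is asymptotically invariant and is a multiple of A x, which means that
   (v, x) |-> A x v is Hermitian up to a factor (form_conjugate). A positive Hermitian form B with
   |B(v, x)| * |x| <= B(x, x) * |v| determines the norm: along a path x + t y with x and y
   orthogonal the ratio |x|^2 / B(x, x) changes only to second order, so it is constant
   (norm_of_form).

   If X is a plane, the collineation argument is not available, but compactness is. Among the
   Hermitian forms B with B(x, x) <= |x|^2 exactly one has maximal determinant; by uniqueness the
   isometries preserve it. So B(., y) is invariant under the isometries fixing y, is proportional to
   F y, and norm_of_form applies again (hermitian_norm_dim2). Spaces spanned by one vector are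
   trivially Hilbert spaces.

   The real and the complex case are treated together, through the record scalars. *)

(** * A fixed point theorem for weakly compact convex sets *)

(** Zorn for minimal sets: complements of the members of P are passed to unions of
   chains, with the empty set added so that the empty chain has an upper bound. *)
Lemma Zorn_bigcap (T : Type) (P : set (set T)) :
  (exists A, P A) ->
  (forall C : set (set T), C `<=` P -> C !=set0 -> total_on C subset ->
     P (\bigcap_(A in C) A)) ->
  exists A, P A /\ forall B, P B -> B `<=` A -> A `<=` B.
Proof.
move=> [A0 PA0] chain.
have [|C [[C0|PC] Cmax]] := @Zorn_bigcup T [set A | A = set0 \/ P (~` A)].
- move=> C CP Ct.
  have [[A [CA A0']]|nC] := pselect (exists A, C A /\ A !=set0); last first.
    left; apply/seteqP; split=> // x [A CA Ax].
    by apply: nC; exists A; split=> //; exists x.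
  right; have -> : ~` (\bigcup_(X in C) X) =
      \bigcap_(B in [set B | C (~` B) /\ ~` B !=set0]) B.
    apply/seteqP; split=> x.
      move=> nx B [CB _]; apply: contrapT => Bx; apply: nx.
      by exists (~` B).
    move=> Hx [B CB Bx]; apply: (Hx (~` B)) => //=; rewrite setCK; split=> //.
    by exists x.
  apply: chain.
  + move=> B [CB [x Bx]]; have [B0|] := CP _ CB; last by rewrite setCK.
    by move: Bx; rewrite B0.
  + by exists (~` A); rewrite /= setCK.
  + move=> B1 B2 [C1 _] [C2 _]; have [] := Ct _ _ C1 C2 => /subsetC;
      rewrite !setCK; [by right | by left].
- exists A0; split=> // B PB BA x Ax; apply: contrapT => nBx.
  apply: (Cmax (~` B)); last by right; rewrite setCK.
  by rewrite C0; split=> // /(_ x nBx).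
- exists (~` C); split=> // B PB BC x nCx; apply: contrapT => nBx.
apply: (Cmax (~` B)); last by right; rewrite setCK.
split; first by move=> y Cy By; exact: (BC _ By).
by move=> /(_ x nBx).
Qed.

Lemma fmap_ultra (S T : Type) (f : S -> T) (U : set_system S) :
  UltraFilter U -> UltraFilter (f @ U).
Proof.
move=> UU; split; first exact: fmap_proper_filter.
move=> G GF UG; apply/seteqP; split=> // A GA.
have [//|UnA] := in_ultra_setVsetC (f @^-1` A) UU.
have /(filterI GA)/filter_ex [x []//] : G (~` A) by exact: UG.
Qed.

(** A vector space V in duality with W is given by the pairing b alone: convex sets and their
   limits are only ever tested against elements of W. The set W1 is the unit ball defining the
   norm of V, and wball is the ball of radius r. *)
Section FixedPoint.
Variables (R : realType) (V W : Type) (b : V -> W -> R) (W1 : set W) (r : R).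
Implicit Types (U : set_system V) (v : V) (w : W).

Definition wlim U v := forall w, (b^~ w) @ U --> b v w.

(** Closedness is tested on ultrafilters, which is what weak compactness provides limits for. *)
Definition wclosed (A : set V) :=
  forall U, UltraFilter U -> U A -> forall v, wlim U v -> A v.

Definition wball := [set v | forall w, W1 w -> b v w <= r].

Hypothesis wcompact : forall U, UltraFilter U -> U wball -> exists v, wlim U v.

Lemma wlim_le U v w a : ProperFilter U -> wlim U v ->
  U [set x | b x w <= a] -> b v w <= a.
Proof.
move=> FU Uv Ua; rewrite -[b v w](cvg_lim _ (Uv w))//.
by apply: limr_le => //; apply/cvg_ex; exists (b v w); exact: Uv.
Qed.

Lemma wlim_gt U v w a : ProperFilter U -> wlim U v ->
  a < b v w -> U [set x | a < b x w].
Proof. by move=> FU Uv av; exact: (cvgr_gt (b v w) (Uv w)). Qed.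

Lemma wclosed_half w a : wclosed [set v | b v w <= a].
Proof. by move=> U UU Ua v Uv; apply: wlim_le Uv Ua. Qed.

Lemma wclosed_halfge w a : wclosed [set v | a <= b v w].
Proof.
move=> U UU Ua v Uv /=; rewrite leNgt; apply/negP => va.
have : U [set x | b x w < a] by exact: (cvgr_lt (b v w) (Uv w)).
move=> /(filterI Ua) /filter_ex [x [/= ax xa]].
by have := le_lt_trans ax xa; rewrite ltxx.
Qed.

Lemma wclosed_bigcap (I : Type) (D : set I) (A : I -> set V) :
  (forall i, D i -> wclosed (A i)) -> wclosed (\bigcap_(i in D) A i).
Proof.
move=> cA U UU UA v Uv i Di; apply: (cA i Di U) => //.
by apply: filterS UA => x; exact.
Qed.

Lemma wclosedI A B : wclosed A -> wclosed B -> wclosed (A `&` B).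
Proof.
move=> cA cB U UU UA v Uv; split; [apply: (cA U)|apply: (cB U)] => //;
  by apply: filterS UA => x [].
Qed.

Lemma wclosed_wball : wclosed wball.
Proof.
move=> U UU Ub v Uv w Ww; apply: wlim_le Uv _.
by apply: filterS Ub => x; apply.
Qed.

Lemma wcompact_chain (C : set (set V)) :
  C !=set0 -> total_on C subset ->
  (forall A, C A -> A !=set0) -> (forall A, C A -> wclosed A) ->
  (forall A, C A -> A `<=` wball) -> (\bigcap_(A in C) A) !=set0.
Proof.
move=> [A0 CA0] Ct Cn Cc Cb.
have FF : ProperFilter (filter_from C id).
  apply: filter_from_proper; last by move=> A /Cn.
  apply: filter_from_filter; first by exists A0.
  move=> A B CA CB; have [AB|BA] := Ct _ _ CA CB.
    by exists A => // x Ax; split=> //; exact: AB.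
  by exists B => // x Bx; split=> //; exact: BA.
have [U [UU FU]] := ultraFilterLemma FF.
have UA A : C A -> U A by move=> CA; apply: FU; exists A.
have [|v Uv] := wcompact UU.
  by apply: filterS (UA _ CA0); exact: Cb.
by exists v => A CA; exact: (Cc A CA U UU (UA _ CA) v Uv).
Qed.

Variables (d : nat -> V) (w0 : W).
Hypothesis W1_opp : forall w, W1 w -> exists2 w', W1 w' & forall v, b v w' = - b v w.
Hypothesis W_comb : forall g h (t : R), exists w, forall v, b v w = b v g + t * b v h.
Hypothesis W_bounded : forall w, exists M, forall v, wball v -> b v w <= M.
Hypothesis d_dense : forall v (e : R), 0 < e ->
  exists n, forall w, W1 w -> b v w - b (d n) w <= e.

(** D lies in the closed convex hull of E: every half-space containing E contains D. *)
Definition generates (D E : set V) := forall w a,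
  (forall x, E x -> b x w <= a) -> forall x, D x -> b x w <= a.

(** A minimal closed set generating D, the substitute for the closure of the extreme points.
   A chain of generating sets has a generating intersection: by compactness a half-space that
   misses some x in D already misses a point of the intersection. *)
Lemma minimal_generator (D : set V) : wclosed D -> D `<=` wball -> D !=set0 ->
  exists E, [/\ E `<=` D, wclosed E, generates D E &
    forall E', E' `<=` E -> wclosed E' -> generates D E' -> E `<=` E'].
Proof.
move=> Dc Db [x0 Dx0].
have [||E [[ED Ec Eg] Emin]] := @Zorn_bigcap V
    [set E | [/\ E `<=` D, wclosed E & generates D E]].
- by exists D; split=> // w a; exact.
- move=> C CP [A0 CA0] Ct; split.
  + by move=> x /(_ _ CA0); have [+ _ _] := CP _ CA0; apply.
  + by apply: wclosed_bigcap => A /CP[].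
  move=> w a Ha x Dx; rewrite leNgt; apply/negP => ax.
  pose a' := (a + b x w) / 2.
  have [aa' a'x] : a < a' /\ a' < b x w by rewrite /a'; split; lra.
  pose C' := [set A | exists2 B, C B & A = B `&` [set v | a' <= b v w]].
  have [|||||y Hy] := @wcompact_chain C'.
  + by exists (A0 `&` [set v | a' <= b v w]); exists A0.
  + move=> _ _ [A1 C1 ->] [A2 C2 ->].
    by have [S|S] := Ct _ _ C1 C2; [left|right] => v [/S].
  + move=> _ [A CA ->]; apply: contrapT => nA.
    suff : b x w <= a' by rewrite leNgt a'x.
    have [_ _ gA] := CP _ CA; apply: (gA w a') => // y Ay.
    rewrite leNgt; apply/negP => a'y; apply: nA.
    by exists y; split=> //=; exact: ltW.
  + move=> _ [A CA ->]; apply: wclosedI; last exact: wclosed_halfge.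
    by have [] := CP _ CA.
  + by move=> _ [A CA ->] y [Ay _]; apply: Db; have [+ _ _] := CP _ CA; apply.
  have : b y w <= a.
    by apply: Ha => A CA; have [] := Hy (A `&` [set v | a' <= b v w]); first by exists A.
  have [_ /=] := Hy (A0 `&` [set v | a' <= b v w]) (ex_intro2 _ _ _ CA0 erefl).
  by lra.
by exists E; split=> // E' E'E E'c E'g; apply: Emin => //; split=> //;
  exact: subset_trans ED.
Qed.

Definition wopen_basic (l : seq (W * R)) :=
  [set v | forall p, List.In p l -> p.2 < b v p.1].

Lemma wclosedD_basic E l : wclosed E -> wclosed (E `\` wopen_basic l).
Proof.
move=> Ec U UU UE v Uv; split.
  by apply: Ec Uv; apply: filterS UE => x [].
move=> vl.
suff : U (wopen_basic l).
  by move=> /(filterI UE) /filter_ex [x [[_ nx] /nx]].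
elim: l vl {UE} => [|p l IH] vl; first by apply: filterS filterT => x _ p [].
have Up : U [set x | p.2 < b x p.1] by apply: wlim_gt Uv _; apply: vl; left.
have Ul : U (wopen_basic l) by apply: IH => q ql; apply: vl; right.
by apply: filterS (filterI Up Ul) => x [xp xl] q [<-|/xl].
Qed.

(** The Baire category argument for a weakly compact set: if no small norm ball around a
   point of the dense sequence d contained a relatively open part of E, one could leave the
   balls around d 0, d 1, ... one after the other, and the limit would be far from all d n. *)
Lemma baire_ball (E : set V) (e : R) : 0 < e ->
  wclosed E -> E `<=` wball -> E !=set0 ->
  exists l n, E `&` wopen_basic l !=set0 /\
    forall x, E x -> wopen_basic l x -> forall w, W1 w -> b x w - b (d n) w <= e.
Proof.
move=> e0 Ec Eb [x0 Ex0]; apply: contrapT => Hn.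
have step : forall nl : nat * seq (W * R), exists l' : seq (W * R),
    E `&` wopen_basic nl.2 !=set0 ->
    exists p, [/\ l' = p :: nl.2, E `&` wopen_basic (p :: nl.2) !=set0,
      W1 p.1 & b (d nl.1) p.1 + e < p.2].
  move=> [n l]; have [El|nE] := pselect (E `&` wopen_basic l !=set0); last first.
    by exists [::].
  have [x [w [Ex lx Ww xw]]] : exists x w,
      [/\ E x, wopen_basic l x, W1 w & e < b x w - b (d n) w].
    apply: contrapT => Hx; apply: Hn; exists l, n; split=> // x Ex lx w Ww.
    by rewrite leNgt; apply/negP => lt; apply: Hx; exists x, w.
  (* any level strictly between the two values keeps x inside and the ball outside *)
  pose c := (b (d n) w + e + b x w) / 2.
  exists ((w, c) :: l) => _; exists (w, c); split => //=; last by rewrite /c; lra.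
  exists x; split=> // p [<-|/lx//] /=; rewrite /c; lra.
have [f Hf] := choice step.
pose L := fix L n := if n is m.+1 then f (m, L m) else [::].
have Lne n : E `&` wopen_basic (L n) !=set0.
  elim: n => [|n IH]; first by exists x0; split=> // p [].
  by have [p [/= -> ? _ _]] := Hf (n, L n) IH.
have LS n : exists p, [/\ L n.+1 = p :: L n, W1 p.1 & b (d n) p.1 + e < p.2].
  by have [p [? _ ? ?]] := Hf (n, L n) (Lne n); exists p.
pose A n := E `&` [set v | forall p, List.In p (L n) -> p.2 <= b v p.1].
have Adec n : A n.+1 `<=` A n.
  move=> v [Ev Hv]; split=> // p pL; apply: Hv.
  by have [q [-> _ _]] := LS n; right.
have Amono m n : (m <= n)%N -> A n `<=` A m.
  elim: n => [|n IH]; first by rewrite leqn0 => /eqP ->.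
  rewrite leq_eqVlt => /orP[/eqP ->//|mn].
  by apply: subset_trans (IH mn); exact: Adec.
have [|||||y Hy] := @wcompact_chain [set A n | n in setT].
- by exists (A 0%N); exists 0%N.
- move=> _ _ [m _ <-] [n _ <-].
  by have [mn|/ltnW mn] := leqP m n; [right|left]; exact: Amono.
- move=> _ [n _ <-]; have [v [Ev Hv]] := Lne n; exists v; split=> // p pL.
  exact/ltW/Hv.
- move=> _ [n _ <-]; apply: wclosedI => //.
  have -> : [set v | forall p, List.In p (L n) -> p.2 <= b v p.1] =
     \bigcap_(p in [set p | List.In p (L n)]) [set v | p.2 <= b v p.1] by [].
  by apply: wclosed_bigcap => p _; exact: wclosed_halfge.
- by move=> _ [n _ <-] v [Ev _]; exact: Eb.
have [n Hd] := d_dense y e0.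
have [p [Lp pW pd]] := LS n.
have [_ /(_ p)] := Hy (A n.+1) (ex_intro2 _ _ n.+1 I erefl).
rewrite Lp => /(_ (or_introl erefl)) py.
by have := Hd _ pW; lra.
Qed.

(** Dentability: D has a slice of small diameter. A relatively open part of the minimal
   generating set E has small diameter, and the remainder of E does not generate D: some half-space
   h <= a contains it but not D. Points of D where h is nearly maximal are close to convex
   combinations of the small part; this is seen by tilting each w in W1 by a multiple of h. *)
Lemma small_slice (D : set V) (e : R) : 0 < e ->
  wclosed D -> D `<=` wball -> D !=set0 ->
  exists h s v0, [/\ (exists2 v, D v & s < b v h), D v0 &
    forall v, D v -> s < b v h -> forall w, W1 w -> b v w - b v0 w <= e].
Proof.
move=> e0 Dc Db Dn.
have [E [ED Ec Eg Emin]] := minimal_generator Dc Db Dn.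
have En : E !=set0.
  apply: contrapT => E0; have [x Dx] := Dn.
  have := Eg w0 (b x w0 - 1) _ x Dx; rewrite lerBrDr gerDl ler10.
  by move=> H; suff : false by []; apply: H => y Ey; case: E0; exists y.
have e4 : 0 < e / 4 by lra.
have [l [n [[y [Ey yl]] Hb]]] := baire_ball e4 Ec (subset_trans ED Db) En.
have ball2 x : E x -> wopen_basic l x -> forall w, W1 w -> b x w - b y w <= e / 2.
  move=> Ex xl w Ww; have := Hb x Ex xl w Ww.
  have [w' Ww' opp] := W1_opp Ww; have := Hb y Ey yl w' Ww'.
  by rewrite !opp; lra.
have [h [a [Ha [v1 Dv1 v1a]]]] : exists h a,
    (forall x, (E `\` wopen_basic l) x -> b x h <= a) /\ exists2 v, D v & a < b v h.
  apply: contrapT => Hn.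
  have : E `<=` E `\` wopen_basic l.
    apply: Emin; first by move=> x [].
      exact: wclosedD_basic.
    move=> h a Ha x Dx; rewrite leNgt; apply/negP => ax; apply: Hn.
    by exists h, a; split=> //; exists x.
  by move=> /(_ y Ey)[].
pose S := [set b v h | v in D].
have Sh : has_sup S.
  split; first by exists (b v1 h); exists v1.
  have [M HM] := W_bounded h; exists M => _ [v Dv <-]; exact/HM/Db.
have Ssup v : D v -> b v h <= sup S by move=> Dv; apply: sup_upper_bound => //; exists v.
have aS : a < sup S by apply: lt_le_trans v1a _; exact: Ssup.
have r0 w : W1 w -> 0 <= r.
  move=> Ww; have [w' Ww' opp] := W1_opp Ww.
  have := Db _ (ED _ Ey) w Ww; have := Db _ (ED _ Ey) w' Ww'; rewrite opp; lra.
(* the tilt: points of E in the remainder lose t * (sup S - a), twice the radius *)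
pose t := 2 * `|r| / (sup S - a).
have t0 : 0 <= t by rewrite /t divr_ge0 ?mulr_ge0//; lra.
have tE : t * a = t * sup S - 2 * `|r|.
  by rewrite /t; field; lra.
pose s := sup S - e / 2 / (t + 1).
have e2t : 0 < e / 2 / (t + 1) by rewrite divr_gt0//; lra.
exists h, s, y; split.
- have [_ [v Dv <-] sv] := sup_adherent e2t Sh.
  by exists v.
- exact: ED.
move=> v Dv sv w Ww.
have [w2 Hw2] := W_comb w h t.
have := Eg w2 (b y w + e / 2 + t * sup S) _ v Dv; rewrite Hw2.
have {}r0 := r0 _ Ww.
rewrite ger0_norm// in tE.
have lty : - r <= b y w.
  by have [w' Ww' opp] := W1_opp Ww; have := Db _ (ED _ Ey) w' Ww'; rewrite opp; lra.
have /[swap] /[apply] H : forall x, E x -> b x w2 <= b y w + e / 2 + t * sup S.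
  move=> x Ex; rewrite Hw2; have [xl|nxl] := pselect (wopen_basic l x).
    have := ball2 x Ex xl w Ww.
    have : t * b x h <= t * sup S by apply: ler_wpM2l => //; exact/Ssup/ED.
    lra.
  have : t * b x h <= t * a by apply: ler_wpM2l => //; exact: Ha.
  have := Db _ (ED _ Ex) w Ww.
  lra.
have : t * (sup S - b v h) <= t * (e / 2 / (t + 1)).
  by apply: ler_wpM2l => //; move: sv; rewrite /s; lra.
have : t * (e / 2 / (t + 1)) <= e / 2.
  have -> : t * (e / 2 / (t + 1)) = e / 2 - e / 2 / (t + 1) by field; lra.
  by lra.
lra.
Qed.

(** The maps act t are the isometries, F is the filter of those that are nearly the identity on
   some vectors, and G carries the group structure needed. *)
Variables (T : Type) (act : T -> V -> V) (G : set T) (F : set_system T).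
Hypothesis F_proper : ProperFilter F.
Hypothesis FG : F G.
Hypothesis G_comp : forall t1 t2, G t1 -> G t2 ->
  exists2 t, G t & forall v, act t v = act t1 (act t2 v).
Hypothesis G_id : exists2 t, G t & forall v, act t v = v.
Hypothesis G_adj : forall t, G t -> forall w, exists w', forall v, b (act t v) w = b v w'.
Hypothesis G_isom : forall t, G t -> forall u v (e : R),
  (forall w, W1 w -> b (act t u) w - b (act t v) w <= e) ->
  (forall w, W1 w -> b u w - b v w <= e).
Hypothesis G_wball : forall t, G t -> forall v, wball v -> wball (act t v).
Hypothesis W1_separates : forall u v, (forall w, W1 w -> b u w - b v w <= 0) ->
  forall w, b u w = b v w.
Hypothesis midpoint : forall u v, exists m, forall w, b m w = (b u w + b v w) / 2.

Definition midpoint_convex (K : set V) := forall u v m, K u -> K v ->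
  (forall w, b m w = (b u w + b v w) / 2) -> K m.

(** Stability under the limits, along ultrafilters finer than F, of the orbits of points. *)
Definition invariant (K : set V) := forall U : set_system T, UltraFilter U -> F `<=` U ->
  forall x v, K x -> (forall w, (fun t => b (act t x) w) @ U --> b v w) -> K v.

Lemma wlim_act (U : set_system T) x v : (forall w, (fun t => b (act t x) w) @ U --> b v w) ->
  wlim ((fun t => act t x) @ U) v.
Proof. by move=> H w; apply: H. Qed.

Lemma minimal_invariant (K : set V) : wclosed K -> midpoint_convex K ->
  invariant K -> K `<=` wball -> K !=set0 ->
  exists M, [/\ M `<=` K, wclosed M, midpoint_convex M, invariant M & M !=set0] /\
    forall M', wclosed M' -> midpoint_convex M' -> invariant M' -> M' !=set0 ->
      M' `<=` M -> M `<=` M'.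
Proof.
move=> Kc Km Ki Kb Kn.
have [||M [HM Mmin]] := @Zorn_bigcap V [set M |
    [/\ M `<=` K, wclosed M, midpoint_convex M, invariant M & M !=set0]].
- by exists K; split.
- move=> C CP [A0 CA0] Ct.
  have CP' A : C A -> [/\ A `<=` K, wclosed A, midpoint_convex A, invariant A
    & A !=set0] by exact: CP.
  split.
  + by move=> x /(_ _ CA0); have [+ _ _ _ _] := CP' _ CA0; apply.
  + by apply: wclosed_bigcap => A /CP'[].
  + move=> u v m Hu Hv Hm A CA; have [_ _ cA _ _] := CP' _ CA.
    by apply: cA Hm; [exact: Hu|exact: Hv].
  + move=> U UU FU x v Hx Hv A CA; have [_ _ _ iA _] := CP' _ CA.
    by apply: iA Hv => //; exact: Hx.
  + apply: wcompact_chain => //; first by exists A0.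
    * by move=> A /CP'[].
    * by move=> A /CP'[].
    * by move=> A /CP'[AK _ _ _ _]; exact: subset_trans Kb.
exists M; split=> // M' ? ? ? ? M'M; apply: Mmin => //; split=> //.
by apply: subset_trans M'M _; case: HM.
Qed.

(** Let M be a minimal closed convex invariant subset of K, and D the closed convex hull
   of its orbit under G. The points of M whose whole orbit avoids a given slice of D form a closed
   convex invariant subset; it is proper, so it is empty. Hence every point of M has a translate in
   each small slice. Applied to the midpoint of u and v this puts a translate of u or of v in the
   same small slice as that of the midpoint, so that u = v. Thus M is one point x, and limits of
   act t x along F can only be x, first weakly and then, through small slices, in norm. *)
Theorem fixed_point (K : set V) : wclosed K -> midpoint_convex K ->
  invariant K -> K `<=` wball -> K !=set0 ->
  exists2 x, K x & forall e : R, 0 < e ->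
    F [set t | forall w, W1 w -> b (act t x) w - b x w <= e].
Proof.
move=> Kc Km Ki Kb Kn.
have [M [[MK Mc Mm Mi Mn] Mmin]] := minimal_invariant Kc Km Ki Kb Kn.
have Mb : M `<=` wball := subset_trans MK Kb.
pose D := wball `&` [set v | forall w a,
  (forall t x, G t -> M x -> b (act t x) w <= a) -> b v w <= a].
have Dc : wclosed D.
  apply: wclosedI; first exact: wclosed_wball.
  have -> : [set v | forall w a, (forall t x, G t -> M x -> b (act t x) w <= a) ->
      b v w <= a] = \bigcap_(p in [set p : W * R |
        forall t x, G t -> M x -> b (act t x) p.1 <= p.2]) [set v | b v p.1 <= p.2].
    apply/seteqP; split=> v Hv; first by move=> [w a] /= /Hv.
    by move=> w a Ha; exact: (Hv (w, a)).
  by apply: wclosed_bigcap => p _; exact: wclosed_half.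
have MD t x : G t -> M x -> D (act t x).
  move=> Gt Mx; split; first by apply: G_wball => //; exact: Mb.
  by move=> w a; apply.
have [t1 Gt1 t1E] := G_id.
have MD1 x : M x -> D x by move=> Mx; rewrite -(t1E x); exact: MD.
have GD t x : G t -> D x -> D (act t x).
  move=> Gt [bx Hx]; split; first exact: G_wball.
  move=> w a Ha; have [w' Hw'] := G_adj Gt w; rewrite Hw'; apply: Hx.
  move=> t' y Gt' My; rewrite -Hw'.
  by have [t2 Gt2 t2E] := G_comp Gt Gt'; rewrite -t2E; exact: Ha.
have Dn : D !=set0 by have [x Mx] := Mn; exists x; exact: MD1.
have Db : D `<=` wball by move=> v [].
have key (e : R) : 0 < e -> exists h s v0,
    (forall x, M x -> exists2 t, G t & s < b (act t x) h) /\
    forall v, D v -> s < b v h -> forall w, W1 w ->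
      b v w - b v0 w <= e /\ b v0 w - b v w <= e.
  move=> e0; have [h [s [v0 [[v1 Dv1 sv1] Dv0 Hs]]]] := small_slice e0 Dc Db Dn.
  exists h, s, v0; split; last first.
    move=> v Dv sv w Ww; split; first exact: Hs.
    by have [w' Ww' opp] := W1_opp Ww; have := Hs v Dv sv w' Ww'; rewrite !opp; lra.
  move=> x Mx; apply: contrapT => Hx.
  pose D' := [set v | forall t, G t -> b (act t v) h <= s].
  suff : M `<=` M `&` D'.
    move=> MD'; have : b v1 h <= s.
      have [_] := Dv1; apply=> t y Gt My.
      by have [_] := MD' _ My; apply.
    by rewrite leNgt sv1.
  apply: Mmin => //.
  - apply: wclosedI => //.
    have -> : D' = \bigcap_(t in G) [set v | b (act t v) h <= s] by [].
    apply: wclosed_bigcap => t Gt; have [w' Hw'] := G_adj Gt h.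
    have -> : [set v | b (act t v) h <= s] = [set v | b v w' <= s].
      by apply/seteqP; split=> v /=; rewrite Hw'.
    exact: wclosed_half.
  - move=> u v m [Mu Du] [Mv Dv] Hm; split; first exact: Mm Hm.
    move=> t Gt; have [w' Hw'] := G_adj Gt h; rewrite Hw' Hm -!Hw'.
    by have := Du t Gt; have := Dv t Gt; lra.
  - move=> U UU FU y v [My Dy] Hv; split; first exact: Mi Hv.
    move=> t Gt; have [w' Hw'] := G_adj Gt h; rewrite Hw'.
    apply: (@wlim_le ((fun t => act t y) @ U)); first exact: wlim_act.
    change (U [set t' | b (act t' y) w' <= s]).
    apply: filterS (FU _ FG) => t' Gt' /=.
    by rewrite -Hw'; have [t2 Gt2 t2E] := G_comp Gt Gt'; rewrite -t2E; exact: Dy.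
  - exists x; split=> // t Gt; rewrite leNgt; apply/negP => ts.
    by apply: Hx; exists t.
(* one of the endpoints of a segment lies on the same side of the slice as the midpoint *)
have single u v : M u -> M v -> forall w, W1 w -> b u w - b v w <= 0.
  move=> Mu Mv w Ww; rewrite leNgt; apply/negP => uv.
  have e0 : 0 < (b u w - b v w) / 8 by lra.
  have [h [s [v0 [Hslice Hsmall]]]] := key _ e0.
  have [m Hm] := midpoint u v.
  have Mmm : M m := Mm _ _ _ Mu Mv Hm.
  have [t Gt sm] := Hslice _ Mmm.
  have close x : M x -> s < b (act t x) h ->
      b x w - b m w <= (b u w - b v w) / 4 /\ b m w - b x w <= (b u w - b v w) / 4.
    move=> Mx sx; split; apply: (G_isom Gt) => // w' Ww';
    have [] := Hsmall _ (MD t x Gt Mx) sx w' Ww';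
    have [] := Hsmall _ (MD t m Gt Mmm) sm w' Ww'; lra.
  have [w' Hw'] := G_adj Gt h.
  have [su|us] := ltP s (b (act t u) h).
    by have [_ ] := close _ Mu su; rewrite Hm; have [] := close _ Mu su; rewrite Hm; lra.
  have [sv|vs] := ltP s (b (act t v) h).
    by have [_ ] := close _ Mv sv; rewrite Hm; have [] := close _ Mv sv; rewrite Hm; lra.
  by move: sm us vs; rewrite !Hw' Hm; lra.
have [x Mx] := Mn; exists x; first exact: MK.
move=> e e0; have e2 : 0 < e / 2 by lra.
have [h [s [v0 [Hslice Hsmall]]]] := key _ e2.
have [t Gt sx] := Hslice _ Mx.
suff : F [set t' | G t' /\ s < b (act t (act t' x)) h].
  apply: filterS => t' [Gt' st'].
  apply: (G_isom Gt) => w Ww.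
  have [] := Hsmall _ (GD _ _ Gt (MD _ _ Gt' Mx)) st' w Ww.
  have [] := Hsmall _ (MD t x Gt Mx) sx w Ww; lra.
apply: filterI => //; apply: contrapT => nF.
pose A := [set t' | s < b (act t (act t' x)) h].
have {}nF : ~ F A by [].
have [U [UU FU UA]] : exists U : set_system T, [/\ UltraFilter U, F `<=` U & U (~` A)].
  have FF : ProperFilter (within (~` A) F).
    split; last exact: within_filter.
    rewrite /within /= => F0; apply: nF; apply: filterS F0 => t' nA.
    exact: contrapT.
  have [U [UU sU]] := ultraFilterLemma FF; exists U; split=> // [P FP|];
    apply: sU; rewrite /within /=.
    by apply: filterS FP.
  by apply: filterS filterT => t' _.
have [v Uv] : exists v, wlim ((fun t' => act t' x) @ U) v.
  apply: wcompact; first exact: fmap_ultra.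
  change (U [set t' | wball (act t' x)]).
  apply: filterS (FU _ FG) => t' Gt'.
  by apply: G_wball => //; exact: Mb.
have Mv : M v := Mi U UU FU x v Mx Uv.
have xv := W1_separates (single _ _ Mx Mv).
have [w' Hw'] := G_adj Gt h.
have : U A.
  have : U [set t' | s < b (act t' x) w'].
    have svw : s < b v w' by rewrite -xv -Hw'.
    exact: (wlim_gt _ Uv svw).
  by apply: filterS => t' /=; rewrite /A /= Hw'.
by move=> /(filterI UA) /filter_ex [t' []].
Qed.

End FixedPoint.

(** * The Hahn-Banach theorem *)

Section HahnBanach.
Variables (R : realType) (V : lmodType R).

Definition sublinear (q : V -> R) :=
  (forall x y, q (x + y) <= q x + q y) /\
  (forall (t : R) x, 0 <= t -> q (t *: x) <= t * q x).

Lemma sublinear0 q : sublinear q -> q 0 = 0.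
Proof.
move=> [qD qZ]; apply/eqP; rewrite eq_le; apply/andP; split.
  by have := qZ 0 0 (lexx 0); rewrite scale0r mul0r.
by have := qD 0 0; rewrite addr0 => ?; lra.
Qed.

Lemma sublinearN q x : sublinear q -> - q (- x) <= q x.
Proof. by move=> sq; have := sq.1 x (- x); rewrite subrr (sublinear0 sq); lra. Qed.

Lemma sublinearZ q t x : sublinear q -> 0 <= t -> q (t *: x) = t * q x.
Proof.
move=> sq t0; apply/eqP; rewrite eq_le; apply/andP; split; first exact: sq.2.
have [->|tn0] := eqVneq t 0; first by rewrite scale0r mul0r sublinear0.
have tp : 0 < t by rewrite lt0r tn0.
have := sq.2 t^-1 (t *: x); rewrite invr_ge0 => /(_ t0).
by rewrite scalerA mulVf// scale1r ler_pdivlMl.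
Qed.

(** The largest sublinear function below q whose value at - y is at most - q y. *)
Definition shift_inf (q : V -> R) y x := inf [set q (x + t *: y) - t * q y | t in [set t | 0 <= t]].

Lemma shift_inf_has_inf q y x : sublinear q ->
  has_inf [set q (x + t *: y) - t * q y | t in [set t | 0 <= t]].
Proof.
move=> sq; split; first by exists (q (x + 0 *: y) - 0 * q y); exists 0 => /=.
exists (- q (- x)) => _ [t /= t0 <-].
rewrite -(sublinearZ _ sq t0).
have := sq.1 (x + t *: y) (- x); rewrite addrAC subrr add0r; lra.
Qed.

Lemma shift_inf_le q y x t : sublinear q -> 0 <= t ->
  shift_inf q y x <= q (x + t *: y) - t * q y.
Proof.
move=> sq t0; apply: ge_inf; last by exists t.
by have [] := shift_inf_has_inf y x sq.
Qed.

Lemma shift_inf_adherent q y x e : sublinear q -> 0 < e ->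
  exists2 t, 0 <= t & q (x + t *: y) - t * q y < shift_inf q y x + e.
Proof.
move=> sq e0; have [_ [t t0 <-] ?] := inf_adherent e0 (shift_inf_has_inf y x sq).
by exists t.
Qed.

Lemma shift_inf_sublinear q y : sublinear q -> sublinear (shift_inf q y).
Proof.
move=> sq; split=> [x z|t x t0].
  apply/ler_addgt0Pr => e e0; have e2 : 0 < e / 2 by lra.
  have [t t0 Ht] := shift_inf_adherent y x sq e2.
  have [s s0 Hs] := shift_inf_adherent y z sq e2.
  have := @shift_inf_le q y (x + z) (t + s) sq (addr_ge0 t0 s0).
  rewrite scalerDl addrACA => /le_trans; apply.
  have := sq.1 (x + t *: y) (z + s *: y); lra.
have [->|tn0] := eqVneq t 0.
  rewrite scale0r mul0r; have := @shift_inf_le q y 0 0 sq (lexx 0).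
  by rewrite scale0r addr0 mul0r subr0 (sublinear0 sq).
have tp : 0 < t by rewrite lt0r tn0.
apply/ler_addgt0Pr => e e0.
have [s s0 Hs] := shift_inf_adherent y x sq (divr_gt0 e0 tp).
have := @shift_inf_le q y (t *: x) (t * s) sq (mulr_ge0 t0 s0).
rewrite -scalerA -scalerDr (sublinearZ _ sq t0) => /le_trans; apply.
have : t * (q (x + s *: y) - s * q y) <= t * (shift_inf q y x + e / t).
  by rewrite ler_wpM2l// ltW.
by rewrite mulrBr mulrDr mulrA (mulrC e) mulVKf// => ?; lra.
Qed.

Lemma minimal_sublinear (p : V -> R) : sublinear p ->
  exists q : V -> R, [/\ sublinear q, forall x, q x <= p x &
    forall q', sublinear q' -> (forall x, q' x <= q x) -> q' = q].
Proof.
move=> sp; pose T := {q : V -> R | sublinear q /\ forall x, q x <= p x}.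
have lower (q : T) x : - p (- x) <= sval q x.
  by case: q => q [sq qp] /=; have := sublinearN x sq; have := qp (- x); lra.
have [||||[q [sq qp]] qmin] := @Zorn T (fun q1 q2 : T => `[< forall x, sval q2 x <= sval q1 x >]).
- by move=> q; apply/asboolP.
- move=> q1 q2 q3 /asboolP H1 /asboolP H2; apply/asboolP => x.
  exact: le_trans (H1 x).
- move=> [q1 h1] [q2 h2] /asboolP /= H1 /asboolP /= H2.
  have E : q1 = q2 by apply/funext => x; apply/eqP; rewrite eq_le H1 H2.
  by move: h1 h2; rewrite E => h1 h2; congr exist; exact: Prop_irrelevance.
- move=> A At; have [[q0 Aq0]|nA] := pselect (exists q, A q); last first.
    exists (exist _ p (conj sp (fun x => lexx (p x)))) => q Aq.
    by case: nA; exists q.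
  pose S x := [set sval q x | q in A].
  have Sinf x : has_inf (S x).
    split; first by exists (sval q0 x); exists q0.
    by exists (- p (- x)) => _ [q Aq <-]; exact: lower.
  have Sle q x : A q -> inf (S x) <= sval q x.
    by move=> Aq; apply: ge_inf; [case: (Sinf x)|exists q].
  have sI : sublinear (fun x => inf (S x)).
    split=> [x y|t x t0].
      apply/ler_addgt0Pr => e e0; have e2 : 0 < e / 2 by lra.
      have [_ [q1 A1 <-] H1] := inf_adherent e2 (Sinf x).
      have [_ [q2 A2 <-] H2] := inf_adherent e2 (Sinf y).
      have [q [Aq le1 le2]] : exists q, [/\ A q, sval q x <= sval q1 x &
          sval q y <= sval q2 y].
        by have [/asboolP H|/asboolP H] := At _ _ A1 A2; [exists q2|exists q1].
      have := Sle q (x + y) Aq; have := (svalP q).1.1 x y; lra.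
    have [->|tn0] := eqVneq t 0.
      rewrite scale0r mul0r; apply: le_trans (Sle q0 0 Aq0) _.
      by rewrite (sublinear0 (svalP q0).1).
    have tp : 0 < t by rewrite lt0r tn0.
    apply/ler_addgt0Pr => e e0.
    have [_ [q Aq <-] H] := inf_adherent (divr_gt0 e0 tp) (Sinf x).
    apply: le_trans (Sle q _ Aq) _.
    rewrite (sublinearZ _ (svalP q).1 t0).
    have : t * sval q x <= t * (inf (S x) + e / t) by rewrite ler_wpM2l// ltW.
    by rewrite mulrDr (mulrC e) mulVKf// => ?; lra.
  have Ip x : inf (S x) <= p x.
    by apply: le_trans (Sle q0 x Aq0) _; exact: (svalP q0).2.
  exists (exist _ (fun x => inf (S x)) (conj sI Ip)) => q Aq.
  by apply/asboolP => x /=; exact: Sle.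
exists q; split=> // q' sq' q'q.
have q'p x : q' x <= p x by exact: le_trans (qp x).
have := qmin (exist _ q' (conj sq' q'p)).
by move=> /(_ (asboolT q'q)) [].
Qed.

(** A minimal sublinear function is linear, since replacing q by shift_inf q y
   changes nothing. Starting below shift_inf p x0 makes the value at x0 the largest possible. *)
Lemma sublinear_dominates_linear p x0 : sublinear p ->
  exists l : V -> R, [/\ forall x y, l (x + y) = l x + l y,
    forall t x, l (t *: x) = t * l x,
    forall x, l x <= p x & l x0 = p x0].
Proof.
move=> sp.
have shift_le q y x : sublinear q -> shift_inf q y x <= q x.
  by move=> sq; have := @shift_inf_le q y x 0 sq (lexx 0); rewrite scale0r addr0 mul0r subr0.
have shift_N q y : sublinear q -> shift_inf q y (- y) <= - q y.
  move=> sq; have := @shift_inf_le q y (- y) 1 sq ler01.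
  by rewrite scale1r addNr (sublinear0 sq) mul1r sub0r.
have [q [sq qp qmin]] := minimal_sublinear (shift_inf_sublinear x0 sp).
have qN y : q (- y) = - q y.
  apply/eqP; rewrite eq_le; apply/andP; split; last first.
    by have := sublinearN y sq; lra.
  rewrite -{1}(qmin _ (shift_inf_sublinear y sq) _); first exact: shift_N.
  by move=> x; exact: shift_le.
have qD x y : q (x + y) = q x + q y.
  apply/eqP; rewrite eq_le sq.1 /=.
  by have := sq.1 (x + y) (- y); rewrite addrK qN; lra.
exists q; split=> //.
- move=> t x; have [t0|/ltW t0] := leP 0 t; first exact: sublinearZ.
  have -> : t *: x = - (- t *: x) by rewrite scaleNr opprK.
  by rewrite qN sublinearZ ?mulNr ?opprK// oppr_ge0.
- by move=> x; apply: le_trans (qp x) _; exact: shift_le.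
- apply/eqP; rewrite eq_le; apply/andP; split.
    by apply: le_trans (qp x0) _; exact: shift_le.
  have := qp (- x0); have := shift_N p x0 sp; rewrite qN; lra.
Qed.

End HahnBanach.

(** * Real and complex scalars *)

(** The features of the real and the complex field used in the proof, so that both are
   treated at once: the real part, the embedding of the real numbers, and iota, the imaginary unit
   or 0. With iota = 0 the clauses about imaginary parts become trivial. *)
Record scalars (R : realType) (K : numFieldType) := Scalars {
  re : K -> R;
  emb : {rmorphism R -> K};
  iota : K;
  reB : forall x y, re (x - y) = re x - re y;
  re_embM : forall r z, re (emb r * z) = r * re z;
  re1 : re 1 = 1;
  re_iota : re iota = 0;
  iota2 : iota = 0 \/ iota * iota = -1;
  scalar_sqrt : iota = 0 \/ forall z : K, exists w, w * w = z;
  scalar_split : forall z, z = emb (re z) - iota * emb (re (iota * z));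
  scalar_norm : forall z : K, `|z| = emb (Num.sqrt (re z ^+ 2 + re (iota * z) ^+ 2)) }.

Section ScalarTheory.
Variables (R : realType) (K : numFieldType) (S : scalars R K).
Implicit Types (z : K) (r : R).

(** The norm of K as an element of R, where linear arithmetic applies. *)
Definition modulus z := Num.sqrt (re S z ^+ 2 + re S (iota S * z) ^+ 2).

Lemma normE z : `|z| = emb S (modulus z). Proof. exact: scalar_norm. Qed.

Lemma re0 : re S 0 = 0. Proof. by have := reB S 0 0; rewrite !subrr. Qed.

Lemma reN z : re S (- z) = - re S z.
Proof. by have := reB S 0 z; rewrite !sub0r re0 sub0r. Qed.

Lemma reD x y : re S (x + y) = re S x + re S y.
Proof. by rewrite -{1}(opprK y) reB reN opprK. Qed.

Lemma re_emb r : re S (emb S r) = r.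
Proof. by rewrite -(mulr1 (emb S r)) re_embM re1 mulr1. Qed.

Lemma re_Memb z r : re S (z * emb S r) = re S z * r.
Proof. by rewrite mulrC re_embM mulrC. Qed.

Lemma emb_inj : injective (emb S).
Proof. by move=> r s E; rewrite -(re_emb r) E re_emb. Qed.

Lemma modulus_ge0 z : 0 <= modulus z. Proof. exact: sqrtr_ge0. Qed.

Lemma modulusE z : modulus z = re S `|z|. Proof. by rewrite normE re_emb. Qed.

Lemma modulus0 : modulus 0 = 0. Proof. by rewrite modulusE normr0 re0. Qed.

Lemma modulus1 : modulus 1 = 1. Proof. by rewrite modulusE normr1 re1. Qed.

Lemma modulusM x y : modulus (x * y) = modulus x * modulus y.
Proof. by rewrite modulusE normrM !normE re_Memb re_emb. Qed.

Lemma modulusN z : modulus (- z) = modulus z.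
Proof. by rewrite !modulusE normrN. Qed.

Lemma modulus_eq0 z : modulus z = 0 -> z = 0.
Proof. by move=> E; apply/normr0_eq0; rewrite normE E rmorph0. Qed.

Lemma modulus_gt0 z : z != 0 -> 0 < modulus z.
Proof.
move=> z0; rewrite lt0r modulus_ge0 andbT; apply: contra_neq z0.
exact: modulus_eq0.
Qed.

Lemma modulusV z : modulus z^-1 = (modulus z)^-1.
Proof.
have [->|z0] := eqVneq z 0; first by rewrite invr0 modulus0 invr0.
have m0 := modulus_gt0 z0; apply: (mulfI (lt0r_neq0 m0)).
by rewrite -modulusM !mulfV ?modulus1// lt0r_neq0.
Qed.

Lemma modulus_re z : `|re S z| <= modulus z.
Proof. by rewrite /modulus -sqrtr_sqr ler_wsqrtr// lerDl sqr_ge0. Qed.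

Lemma re_modulus z : re S z <= modulus z.
Proof. exact: le_trans (ler_norm _) (modulus_re z). Qed.

Lemma modulus_emb r : modulus (emb S r) = `|r|.
Proof.
rewrite /modulus re_emb (mulrC (iota S)) re_embM re_iota mulr0.
by rewrite expr0n /= addr0 sqrtr_sqr.
Qed.

Lemma emb_le0 r : (0 <= emb S r) = (0 <= r).
Proof.
apply/idP/idP => r0.
  move/ger0_norm: (r0); rewrite normE modulus_emb => /emb_inj <-.
  exact: normr_ge0.
by rewrite -(ger0_norm r0) -modulus_emb -normE normr_ge0.
Qed.

Lemma emb_le r s : (emb S r <= emb S s) = (r <= s).
Proof. by rewrite -subr_ge0 -rmorphB emb_le0 subr_ge0. Qed.

Lemma emb_lt r s : (emb S r < emb S s) = (r < s).
Proof. by rewrite !lt_neqAle emb_le (inj_eq emb_inj). Qed.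

Lemma modulusD x y : modulus (x + y) <= modulus x + modulus y.
Proof. by rewrite -emb_le rmorphD -!normE ler_normD. Qed.

Lemma modulusB x y : modulus (x - y) <= modulus x + modulus y.
Proof. by rewrite -(modulusN y) modulusD. Qed.

Lemma modulus_dist x y : modulus x - modulus y <= modulus (x - y).
Proof. by have := modulusD (x - y) y; rewrite subrK; lra. Qed.

Lemma modulus_distC x y : modulus (x - y) = modulus (y - x).
Proof. by rewrite -modulusN opprB. Qed.

Lemma phase z : exists u, [/\ modulus u = 1 & u * z = emb S (modulus z)].
Proof.
have [->|z0] := eqVneq z 0.
  by exists 1; rewrite modulus1 mulr0 modulus0 rmorph0.
exists (emb S (modulus z) / z); rewrite divfK//; split=> //.
rewrite modulusM modulusV modulus_emb ger0_norm ?modulus_ge0//.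
by rewrite mulfV// lt0r_neq0// modulus_gt0.
Qed.

(** A scalar whose real part has the full modulus is a nonnegative real. *)
Lemma re_eq_modulus z : re S z = modulus z -> z = emb S (modulus z).
Proof.
move=> E; rewrite {1}(scalar_split S z).
have : re S (iota S * z) ^+ 2 = 0.
  have : modulus z ^+ 2 = re S z ^+ 2 + re S (iota S * z) ^+ 2.
    by rewrite sqr_sqrtr// addr_ge0// sqr_ge0.
  by rewrite E => ?; lra.
by move/eqP; rewrite sqrf_eq0 => /eqP ->; rewrite rmorph0 mulr0 subr0 E.
Qed.

Lemma re_iota_eq z z' : re S z = re S z' -> re S (iota S * z) = re S (iota S * z') -> z = z'.
Proof. by move=> E1 E2; rewrite (scalar_split S z) E1 E2 -scalar_split. Qed.

End ScalarTheory.

Section RestrictScalars.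
Variables (R : realType) (K : numFieldType) (S : scalars R K).

(** Restriction of scalars needs a copy of V: V has a structure over K already. *)
Definition restricted of scalars R K := fun V : lmodType K => V : Type.

Section Instance.
Variable V : lmodType K.
HB.instance Definition _ := GRing.Zmodule.on (restricted S V).

Definition rscale (r : R) (x : restricted S V) : restricted S V := emb S r *: (x : V).

Fact rscaleA a b v : rscale a (rscale b v) = rscale (a * b) v.
Proof. by rewrite /rscale scalerA rmorphM. Qed.
Fact rscale1 : left_id 1 rscale.
Proof. by move=> v; rewrite /rscale rmorph1 scale1r. Qed.
Fact rscaleDr : right_distributive rscale +%R.
Proof. by move=> a u v; rewrite /rscale scalerDr. Qed.
Fact rscaleDl v : {morph rscale^~ v : a b / a + b}.
Proof. by move=> a b; rewrite /rscale rmorphD scalerDl. Qed.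

HB.instance Definition _ := GRing.Zmodule_isLmodule.Build R (restricted S V)
  rscaleA rscale1 rscaleDr rscaleDl.

End Instance.

(** The complex case of the Hahn-Banach theorem: a real form l dominated by p is the
   real part of the linear form x |-> l x - iota * l (iota x). *)
Lemma seminorm_dominates_linear (V : lmodType K) (p : V -> R) (x0 : V) :
  (forall x y, p (x + y) <= p x + p y) ->
  (forall a x, p (a *: x) = modulus S a * p x) ->
  exists f : V -> K, [/\ forall a x y, f (a *: x + y) = a * f x + f y,
    forall x, modulus S (f x) <= p x & f x0 = emb S (p x0)].
Proof.
move=> pD pZ.
have [|l [lD lZ lp l0]] := @sublinear_dominates_linear R (restricted S V) p x0.
  split=> // t x t0; rewrite [p _](pZ (emb S t)) modulus_emb ger0_norm//.
pose i := iota S.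
have lZ' t (x : V) : l (emb S t *: x) = t * l x by exact: lZ.
have lD' (x y : V) : l (x + y) = l x + l y by exact: lD.
pose f (x : V) := emb S (l x) - i * emb S (l (i *: x)).
have fD x y : f (x + y) = f x + f y.
  by rewrite /f scalerDr !lD' !rmorphD mulrDr opprD addrACA.
have fZr t x : f (emb S t *: x) = emb S t * f x.
  have E : i *: (emb S t *: x) = emb S t *: (i *: x) by rewrite !scalerA mulrC.
  by rewrite /f E !lZ' !rmorphM; ring.
have l00 : l 0 = 0 by have := lZ' 0 0; rewrite scaler0 mul0r.
have fZi x : f (i *: x) = i * f x.
  rewrite /f scalerA mulrBr mulrA; have [E|E] := iota2 S; rewrite -/i in E.
    by rewrite E !mul0r scale0r l00 rmorph0 !subr0.
  have lN y : l (- y) = - l y by have := lD' y (- y); rewrite subrr l00 => ?; lra.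
  by rewrite E scaleN1r lN rmorphN; ring.
have re_f x : re S (f x) = l x.
  by rewrite /f reB re_emb re_Memb re_iota mul0r subr0.
have fZ a x : f (a *: x) = a * f x.
  rewrite (scalar_split S a) -/i scalerBl.
  have fN y : f (- y) = - f y.
    by rewrite -scaleN1r -(rmorphN1 (emb S)) fZr rmorphN1 mulN1r.
  by rewrite fD fN -scalerA fZr fZi fZr mulrBl mulrA.
have fp x : modulus S (f x) <= p x.
  have [u [u1 uE]] := phase S (f x).
  rewrite -(re_emb S (modulus S (f x))) -uE -fZ re_f.
  by apply: le_trans (lp _) _; rewrite [p _]pZ u1 mul1r.
exists f; split=> //; first by move=> a x y; rewrite fD fZ.
have mE : modulus S (f x0) = p x0.
  apply/eqP; rewrite eq_le fp /=.
  by rewrite -[p x0]l0 -re_f re_modulus.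
by rewrite -mE; apply: re_eq_modulus; rewrite re_f l0 mE.
Qed.

End RestrictScalars.

Section NormedSpace.
Variables (R : realType) (K : numFieldType) (S : scalars R K).
Variable X : normedModType K.
Implicit Types (x y : X) (a : K) (f : X -> K^o).

(** The norm of X as an element of R, for the same reason as modulus. *)
Definition nrm x := re S `|x|.

Lemma embs_nrm x : emb S (nrm x) = `|x|.
Proof.
have E : `|(`|x|)| = `|x| :> K by rewrite normr_id.
by rewrite /nrm -{2}E (normE S) modulusE E.
Qed.

Lemma nrm_ge0 x : 0 <= nrm x.
Proof. by rewrite -(emb_le0 S) embs_nrm normr_ge0. Qed.

Lemma nrmD x y : nrm (x + y) <= nrm x + nrm y.
Proof. by rewrite -(emb_le S) rmorphD !embs_nrm ler_normD. Qed.

Lemma nrmZ a x : nrm (a *: x) = modulus S a * nrm x.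
Proof.
by apply: (@emb_inj _ _ S); rewrite rmorphM !embs_nrm -normE normrZ.
Qed.

Lemma nrmN x : nrm (- x) = nrm x. Proof. by rewrite /nrm normrN. Qed.

Lemma nrm_distC x y : nrm (x - y) = nrm (y - x).
Proof. by rewrite -nrmN opprB. Qed.

Lemma nrm_dist x y : nrm x - nrm y <= nrm (x - y).
Proof. by have := nrmD (x - y) y; rewrite subrK; lra. Qed.

Lemma nrm0 : nrm 0 = 0. Proof. by rewrite /nrm normr0 re0. Qed.

Lemma nrm_eq0 x : nrm x = 0 -> x = 0.
Proof. by move=> E; apply/normr0_eq0; rewrite -embs_nrm E rmorph0. Qed.

Lemma nrm_gt0 x : x != 0 -> 0 < nrm x.
Proof. by move=> x0; rewrite lt0r nrm_ge0 andbT; apply: contra_neq x0; exact: nrm_eq0. Qed.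

Lemma nrm_cvgP (T : Type) (F : set_system T) (FF : Filter F) (u : T -> X) x :
  (u @ F --> x) <-> forall e : R, 0 < e -> F [set t | nrm (u t - x) < e].
Proof.
split.
  move=> /cvgrPdist_lt H e e0.
  have e0' : 0 < emb S e by rewrite -(rmorph0 (emb S)) emb_lt.
  apply: filterS (H _ e0') => t /=.
  by rewrite -embs_nrm emb_lt nrm_distC.
move=> H; apply/cvgrPdist_lt => e e0.
have eE : e = emb S (modulus S e) by rewrite -normE ger0_norm// ltW.
have m0 : 0 < modulus S e by rewrite -(emb_lt S) rmorph0 -eE.
apply: filterS (H _ m0) => t /=.
by rewrite -embs_nrm [X in _ -> _ < X]eE emb_lt nrm_distC.
Qed.

Definition blinear f C := (forall a x y, f (a *: x + y) = a * f x + f y) /\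
  forall x, modulus S (f x) <= C * nrm x.

Lemma dualP f : dual f <-> exists C, blinear f C.
Proof.
split.
  move=> [fl fc]; pose g : {linear X -> K^o} := HB.pack f (GRing.isLinear.Build _ _ _ _ f fl).
  have /linear_boundedP/pinfty_ex_gt0 [M M0 HM] := (linear_bounded_continuous g).2 fc.
  exists (modulus S M); split=> // x.
  have /= := HM x; rewrite -(emb_le S) rmorphM embs_nrm -normE.
  suff -> : emb S (modulus S M) = M by [].
  by rewrite -normE gtr0_norm.
move=> [C [fl fb]]; split; first exact: fl.
pose g : {linear X -> K^o} := HB.pack f (GRing.isLinear.Build _ _ _ _ f fl).
apply: (linear_bounded_continuous g).1; apply/linear_boundedP.
near=> M => x; apply: (@le_trans _ _ (emb S C * `|x|)).
  by rewrite -embs_nrm -rmorphM (normE S) emb_le.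
apply: ler_wpM2r => //; near: M; apply: nbhs_pinfty_ge.
by rewrite realE -(rmorph0 (emb S)) !emb_le le_total.
Unshelve. all: by end_near. Qed.

End NormedSpace.

(** * The dual space *)

Section DualSpace.
Variables (K : numFieldType) (X : normedModType K).

Definition dual_pred : {pred X -> K^o} := [pred f | `[< dual f >]].

Fact dual_pred_submod_closed : submod_closed dual_pred.
Proof.
split=> [|a f g]; rewrite /dual_pred !inE.
  split=> [b x y|]; first by rewrite /= scaler0 addr0.
  exact: cst_continuous.
move=> [fl fc] [gl gc]; split.
  move=> b x y.
  have E1 : f (b *: x + y) = b * f x + f y := fl b x y.
  have E2 : g (b *: x + y) = b * g x + g y := gl b x y.
  change (a * f (b *: x + y) + g (b *: x + y) =
    b * (a * f x + g x) + (a * f y + g y)).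
  by rewrite E1 E2; ring.
move=> x; apply: (@cvgD _ K^o); last exact: gc.
by apply: cvgZr; exact: fc.
Qed.

HB.instance Definition _ :=
  GRing.isSubmodClosed.Build K (X -> K^o) dual_pred dual_pred_submod_closed.

(** The dual as a module of its own, so that Hahn-Banach separation applies to it. *)
Record functional := Functional { fval :> X -> K^o; _ : fval \in dual_pred }.

HB.instance Definition _ := [isSub for fval].
HB.instance Definition _ := [Choice of functional by <:].
HB.instance Definition _ := [SubChoice_isSubLmodule of functional by <:].

Lemma functional_dual (f : functional) : dual f.
Proof. by case: f => f /= /asboolP. Qed.

Definition mk_functional f (df : dual f) : functional := Functional (asboolT df).

Lemma functionalP (f g : functional) : (forall x, f x = g x) -> f = g.
Proof. by move=> E; apply: val_inj; apply/funext. Qed.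

Lemma functionalZD (a : K) (f g : functional) x : (a *: f + g) x = a * f x + g x.
Proof. by []. Qed.

Lemma functionalD (f g : functional) x : (f + g) x = f x + g x.
Proof. by []. Qed.

Lemma functionalB (f g : functional) x : (f - g) x = f x - g x.
Proof. by []. Qed.

Lemma functionalN (f : functional) x : (- f) x = - f x.
Proof. by []. Qed.

Lemma functionalZ (a : K) (f : functional) x : (a *: f) x = a * f x.
Proof. by []. Qed.

Lemma functional0 x : (0 : functional) x = 0.
Proof. by []. Qed.

Variables (f : functional).

Lemma fun_linear a x y : f (a *: x + y) = a * f x + f y.
Proof. exact: (functional_dual f).1. Qed.

Lemma fun0 : f 0 = 0.
Proof. by have := fun_linear (-1) 0 0; rewrite scaler0 addr0 mulN1r addNr. Qed.

Lemma funZ a x : f (a *: x) = a * f x.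
Proof. by have := fun_linear a x 0; rewrite !addr0 fun0 addr0. Qed.

Lemma funD x y : f (x + y) = f x + f y.
Proof. by have := fun_linear 1 x y; rewrite scale1r mul1r. Qed.

Lemma funN x : f (- x) = - f x.
Proof. by rewrite -scaleN1r funZ mulN1r. Qed.

Lemma funB x y : f (x - y) = f x - f y.
Proof. by rewrite funD funN. Qed.

End DualSpace.

(** * Weak compactness *)

Section UltraLimits.
Variables (R : realType) (K : numFieldType) (S : scalars R K) (T : Type).
Variables (U : set_system T).
Hypothesis UU : UltraFilter U.

Lemma ultra_bounded_cvg (g : T -> R) (M : R) :
  U [set t | `|g t| <= M] -> exists l : R, g @ U --> l.
Proof.
move=> UM; have := @segment_compact R (- M) M.
rewrite compact_ultra => /(_ (g @ U) (fmap_ultra g UU)) [|l [_ /= gl]].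
  change (U [set t | g t \in `[- M, M]]).
  by apply: filterS UM => t /=; rewrite in_itv /= ler_norml.
by exists l.
Qed.

Lemma scalar_cvgP (h : T -> K) (z : K) :
  (h @ U --> (z : K^o)) <-> forall e : R, 0 < e -> U [set t | modulus S (h t - z) < e].
Proof.
have FU : Filter U by case: UU => -[].
have E := @nrm_cvgP R K S K^o T U FU h z; split.
  by move=> /E H e /H; apply: filterS => t; rewrite /= modulusE.
by move=> H; apply/E => e /H; apply: filterS => t; rewrite /= modulusE.
Qed.

Lemma ultra_bounded_cvg_scalar (h : T -> K) (M : R) :
  U [set t | modulus S (h t) <= M] -> exists z : K, h @ U --> (z : K^o).
Proof.
move=> UM.
have [|l1 c1] := @ultra_bounded_cvg (fun t => re S (h t)) M.
  by apply: filterS UM => t /=; apply: le_trans; exact: modulus_re.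
have [|l2 c2] := @ultra_bounded_cvg (fun t => re S (iota S * h t)) (modulus S (iota S) * M).
  apply: filterS UM => t /= tM; apply: le_trans (modulus_re _ _) _.
  by rewrite modulusM ler_wpM2l// modulus_ge0.
exists (emb S l1 - iota S * emb S l2).
apply/scalar_cvgP => e e0.
pose m := modulus S (iota S); have m0 : 0 <= m := modulus_ge0 _ _.
have e1 : 0 < e / 2 by lra.
have e2 : 0 < e / 2 / (m + 1) by rewrite divr_gt0//; lra.
have /cvgrPdist_lt/(_ _ e1) H1 := c1; have /cvgrPdist_lt/(_ _ e2) H2 := c2.
apply: filterS (filterI H1 H2) => t [/= d1 d2].
rewrite {1}(scalar_split S (h t)).
have -> : emb S (re S (h t)) - iota S * emb S (re S (iota S * h t)) -
   (emb S l1 - iota S * emb S l2) =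
   iota S * emb S (l2 - re S (iota S * h t)) - emb S (l1 - re S (h t)).
  by rewrite !rmorphB; ring.
apply: le_lt_trans (modulusB _ _ _) _.
rewrite modulusM !modulus_emb -/m.
have : m * `|l2 - re S (iota S * h t)| <= m * (e / 2 / (m + 1)).
  by rewrite ler_wpM2l// ltW.
have : m * (e / 2 / (m + 1)) <= e / 2.
  have -> : m * (e / 2 / (m + 1)) = e / 2 - e / 2 / (m + 1) by field; lra.
  by lra.
lra.
Qed.

Lemma re_cvg (h : T -> K) (z : K) : h @ U --> (z : K^o) ->
  (fun t => re S (h t)) @ U --> re S z.
Proof.
move=> /scalar_cvgP H; apply/cvgrPdist_lt => e /H; apply: filterS => t /=.
by apply: le_lt_trans; rewrite modulus_distC -reB modulus_re.
Qed.

Lemma modulus_lim_le (h : T -> K) (z : K) (M : R) : h @ U --> (z : K^o) ->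
  U [set t | modulus S (h t) <= M] -> modulus S z <= M.
Proof.
move=> /scalar_cvgP H UM; apply/ler_addgt0Pr => e /H /(filterI UM) /filter_ex [t [/=]].
by have := modulus_dist S z (h t); rewrite modulus_distC => ? ? ?; lra.
Qed.

End UltraLimits.

Section WeakCompactness.
Variables (R : realType) (K : numFieldType) (S : scalars R K) (X : normedModType K).
Local Notation functional := (functional X).
Local Notation nrm := (nrm S).
Implicit Types (x y : X) (f g : functional).

Lemma functional_bound f : exists2 C, 0 <= C & forall x, modulus S (f x) <= C * nrm x.
Proof.
have [C [_ HC]] := (dualP S f).1 (functional_dual f).
exists (Num.max C 0); first by rewrite le_max lexx orbT.
move=> x; apply: le_trans (HC x) _.
by rewrite ler_wpM2r ?nrm_ge0// le_max lexx.
Qed.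

Lemma bounded_functional (h : X -> K) C : (forall a x y, h (a *: x + y) = a * h x + h y) ->
  (forall x, modulus S (h x) <= C * nrm x) -> exists f : functional, forall x, f x = h x.
Proof.
move=> hl hb; have dh : dual (h : X -> K^o) by apply/(dualP S); exists C; split.
by exists (mk_functional dh).
Qed.

Lemma norming_functional x :
  exists f : functional, (forall y, modulus S (f y) <= nrm y) /\ f x = emb S (nrm x).
Proof.
have [h [hl hb hx]] := seminorm_dominates_linear x (nrmD S (X:=X)) (nrmZ S (X:=X)).
have [|f fE] := @bounded_functional h 1 hl; first by move=> y; rewrite mul1r.
by exists f; split=> [y|]; rewrite fE.
Qed.

Definition unit_functionals := [set f : functional | forall y, modulus S (f y) <= nrm y].

Definition pairing x f := re S (f x).

Lemma wball_nrm (r : R) x : 0 <= r -> wball pairing unit_functionals r x <-> nrm x <= r.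
Proof.
move=> r0; split=> [H|xr f Wf].
  have [f [fb fx]] := norming_functional x.
  by have := H f fb; rewrite /pairing fx re_emb.
by apply: le_trans (re_modulus _ _) _; apply: le_trans (Wf x) _.
Qed.

Lemma unit_functionals_dist x y (e : R) :
  (forall f, unit_functionals f -> pairing x f - pairing y f <= e) <-> nrm (x - y) <= e.
Proof.
split=> [H|xe f Wf].
  have [f [fb fx]] := norming_functional (x - y).
  by have := H f fb; rewrite /pairing -reB -funB fx re_emb.
rewrite /pairing -reB -funB; apply: le_trans (re_modulus _ _) _.
exact: le_trans (Wf _) _.
Qed.

(** Bounded functionals converge along an ultrafilter; the limits define a bounded linear
   form on the dual, which reflexivity represents by a vector. *)
Lemma reflexive_weak_compact (r : R) : 0 <= r -> reflexive_space X ->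
  forall U, UltraFilter U -> U (wball pairing unit_functionals r) ->
  exists v, wlim pairing U v.
Proof.
move=> r0 refl U UU Ub.
have Ub' : U [set x | nrm x <= r] by apply: filterS Ub => x /wball_nrm; exact.
have lim_ex (f : X -> K^o) : exists z : K, dual f -> f @ U --> (z : K^o).
  have [df|nd] := pselect (dual f); last by exists 0.
  have [C C0 HC] := functional_bound (mk_functional df).
  have [|z zE] := ultra_bounded_cvg_scalar (S:=S) UU (h:=f) (M:=C * r).
    apply: filterS Ub' => x /= xr; apply: le_trans (HC x) _.
    by rewrite ler_wpM2l.
  by exists z.
have [phi Hphi] := choice lim_ex.
have [||v Hv] := refl phi.
- move=> a f g df dg.
  have dfg : dual (a *: f + g).
    exact: (functional_dual (a *: mk_functional df + mk_functional dg)).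
  apply: (@cvg_unique K^o _ ((a *: f + g) @ U)) => //; first exact: Hphi.
  by apply: cvgD; [apply: cvgZl_tmp; exact: Hphi|exact: Hphi].
- exists (emb S r) => f df fb; rewrite (normE S) emb_le.
  apply: (modulus_lim_le (S:=S) UU (Hphi f df)).
  have [C C0 HC] := functional_bound (mk_functional df).
  apply: filterS Ub' => x /= xr.
  have [->|x0] := eqVneq x 0.
    have -> : f 0 = 0 by exact: (fun0 (mk_functional df)).
    by rewrite modulus0.
  have n0 := nrm_gt0 S x0.
  pose y := emb S (nrm x)^-1 *: x.
  have xy : x = emb S (nrm x) *: y.
    by rewrite /y scalerA -rmorphM mulfV ?lt0r_neq0// rmorph1 scale1r.
  have ny : nrm y = 1.
    by rewrite /y nrmZ modulus_emb gtr0_norm ?invr_gt0// mulVf// lt0r_neq0.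
  have : modulus S (f y) <= 1.
    rewrite -(emb_le S) rmorph1 -normE; apply: fb.
    by rewrite -(embs_nrm S) ny rmorph1.
  have -> : f x = emb S (nrm x) * f y.
    by rewrite {1}xy; exact: (funZ (mk_functional df)).
  rewrite modulusM modulus_emb gtr0_norm// => fy1.
  by apply: le_trans xr; rewrite -[leRHS]mulr1 ler_wpM2l// ltW.
exists v => f; have := Hphi f (functional_dual f).
by rewrite (Hv _ (functional_dual f)) => /(re_cvg (S:=S) UU).
Qed.

End WeakCompactness.

(** * Separability of the dual *)

Section Separability.
Variables (R : realType) (K : numFieldType) (S : scalars R K) (X : normedModType K).
Local Notation functional := (functional X).
Local Notation nrm := (nrm S).
Implicit Types (x y : X) (f g : functional).

Lemma dense_sequence : separable_space X ->
  exists d : nat -> X, forall x (e : R), 0 < e -> exists n, nrm (x - d n) <= e.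
Proof.
move=> [D /countable_injP[c cinj] Dd].
exists (fun n => xget 0 [set x | D x /\ c x = n]) => x e e0.
have [] := Dd (ball x (emb S e)).
- by exists x; apply: ballxx; rewrite -(rmorph0 (emb S)) emb_lt.
- by apply: ball_open; rewrite -(rmorph0 (emb S)) emb_lt.
move=> y [xy Dy]; exists (c y).
have -> : xget 0 [set x | D x /\ c x = c y] = y.
  case: xgetP => [z _ [Dz cz]|/(_ y)]; last by case.
  by apply: cinj => //; rewrite inE.
by move: xy; rewrite -ball_normE /= -(embs_nrm S) emb_lt => /ltW.
Qed.

Definition opnorm f := inf [set C : R | 0 <= C /\ forall x, modulus S (f x) <= C * nrm x].

Lemma opnorm_has_inf f :
  has_inf [set C : R | 0 <= C /\ forall x, modulus S (f x) <= C * nrm x].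
Proof.
by split; [have [C C0 HC] := functional_bound S f; exists C|exists 0 => C []].
Qed.

Lemma opnorm_ge0 f : 0 <= opnorm f.
Proof. by apply: lb_le_inf => [|C []//]; have [] := opnorm_has_inf f. Qed.

Lemma opnormP f x : modulus S (f x) <= opnorm f * nrm x.
Proof.
apply/ler_addgt0Pr => e e0.
have n1 : 0 < nrm x + 1 by have := nrm_ge0 S x; lra.
have [C [C0 HC] CE] := inf_adherent (divr_gt0 e0 n1) (opnorm_has_inf f).
apply: le_trans (HC x) _.
have : C * nrm x <= (opnorm f + e / (nrm x + 1)) * nrm x.
  by rewrite ler_wpM2r ?nrm_ge0// ltW.
have : e / (nrm x + 1) * nrm x <= e.
  have -> : e / (nrm x + 1) * nrm x = e - e / (nrm x + 1) by field; lra.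
  by have := divr_gt0 e0 n1; lra.
lra.
Qed.

Lemma opnorm_le f C : 0 <= C -> (forall x, modulus S (f x) <= C * nrm x) -> opnorm f <= C.
Proof. by move=> C0 HC; apply: ge_inf => //; have [] := opnorm_has_inf f. Qed.

Lemma opnormD f g : opnorm (f + g) <= opnorm f + opnorm g.
Proof.
apply: opnorm_le => [|x]; first by rewrite addr_ge0 ?opnorm_ge0.
rewrite functionalD; apply: le_trans (modulusD _ _ _) _.
by rewrite mulrDl lerD ?opnormP.
Qed.

Lemma opnormZ_le a f : opnorm (a *: f) <= modulus S a * opnorm f.
Proof.
apply: opnorm_le => [|x]; first by rewrite mulr_ge0 ?opnorm_ge0 ?modulus_ge0.
by rewrite functionalZ modulusM -mulrA ler_wpM2l ?modulus_ge0 ?opnormP.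
Qed.

Lemma opnorm0 : opnorm 0 = 0.
Proof.
apply/eqP; rewrite eq_le opnorm_ge0 andbT; apply: opnorm_le => // x.
by rewrite functional0 modulus0 mul0r.
Qed.

Local Opaque opnorm.

(** A countable dense set of coefficients makes the combinations of a sequence enumerable. *)
Definition rational_scalar (q : rat * rat) : K :=
  emb S (ratr q.1) - iota S * emb S (ratr q.2).

Lemma rational_scalar_dense (a : K) (e : R) : 0 < e ->
  exists q, modulus S (a - rational_scalar q) <= e.
Proof.
move=> e0; pose m := modulus S (iota S); have m0 : 0 <= m := modulus_ge0 _ _.
have approx (b d : R) : 0 < d -> exists q : rat, `|b - ratr q| <= d.
  move=> d0; have [q] := @rat_in_itvoo R (b - d) (b + d) ltac:(lra).
  rewrite in_itv /= => /andP[H1 H2]; exists q; rewrite ler_norml; lra.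
have e1 : 0 < e / 2 by lra.
have e2 : 0 < e / 2 / (m + 1) by rewrite divr_gt0//; lra.
have [q1 H1] := approx (re S a) _ e1.
have [q2 H2] := approx (re S (iota S * a)) _ e2.
exists (q1, q2); rewrite /rational_scalar /= {1}(scalar_split S a).
have -> : emb S (re S a) - iota S * emb S (re S (iota S * a)) -
   (emb S (ratr q1) - iota S * emb S (ratr q2)) =
   emb S (re S a - ratr q1) - iota S * emb S (re S (iota S * a) - ratr q2).
  by rewrite !rmorphB; ring.
apply: le_trans (modulusB _ _ _) _.
rewrite modulusM !modulus_emb -/m.
have : m * `|re S (iota S * a) - ratr q2| <= m * (e / 2 / (m + 1)) by rewrite ler_wpM2l.
have : m * (e / 2 / (m + 1)) <= e / 2.
  have -> : m * (e / 2 / (m + 1)) = e / 2 - e / 2 / (m + 1) by field; lra.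
  by lra.
lra.
Qed.

(** If X is reflexive and separable, so is its dual: the functionals norming the points
   of a dense sequence span a dense subspace M. Otherwise a bounded form on the dual vanishes on M
   and not at some f0; it is evaluation at some x, and then x is killed by functionals norming
   vectors close to x, so that x = 0. *)
Lemma separable_dual : separable_space X -> reflexive_space X ->
  exists D : nat -> functional, forall f (e : R), 0 < e ->
    exists n, opnorm (f - D n) <= e.
Proof.
move=> sepX refl; have [d dd] := dense_sequence sepX.
have [fn fnP] := choice (fun n => norming_functional S (d n)).
pose comb (l : seq (nat * (rat * rat))) : functional :=
  \sum_(p <- l) rational_scalar p.2 *: fn p.1.
pose M := [set m | forall e : R, 0 < e -> exists l, opnorm (m - comb l) <= e].
have MD m1 m2 : M m1 -> M m2 -> M (m1 + m2).
  move=> M1 M2 e e0; have e2 : 0 < e / 2 by lra.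
  have [l1 H1] := M1 _ e2; have [l2 H2] := M2 _ e2; exists (l1 ++ l2).
  have -> : m1 + m2 - comb (l1 ++ l2) = (m1 - comb l1) + (m2 - comb l2).
    by rewrite /comb big_cat /= opprD addrACA.
  by apply: le_trans (opnormD _ _) _; lra.
have Mclosed m : (forall e : R, 0 < e -> exists2 m', M m' & opnorm (m - m') <= e) -> M m.
  move=> Hm e e0; have e2 : 0 < e / 2 by lra.
  have [m' Mm' H1] := Hm _ e2; have [l H2] := Mm' _ e2; exists l.
  have -> : m - comb l = (m - m') + (m' - comb l) by rewrite addrA subrK.
  by apply: le_trans (opnormD _ _) _; lra.
have Mf a n : M (a *: fn n).
  move=> e e0; pose c := opnorm (fn n); have c0 : 0 <= c := opnorm_ge0 _.
  have e1 : 0 < e / (c + 1) by rewrite divr_gt0//; lra.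
  have [q Hq] := rational_scalar_dense a e1; exists [:: (n, q)].
  rewrite /comb big_seq1 /= -scalerBl; apply: le_trans (opnormZ_le _ _) _; rewrite -/c.
  have : modulus S (a - rational_scalar q) * c <= e / (c + 1) * c by rewrite ler_wpM2r.
  have -> : e / (c + 1) * c = e - e / (c + 1) by field; lra.
  lra.
have M0 : M 0.
  by move=> e e0; exists [::]; rewrite /comb big_nil subr0 opnorm0 ltW.
have Mcomb a l : M (a *: comb l).
  rewrite /comb scaler_sumr; elim: l => [|p l IH]; first by rewrite big_nil.
  have -> : \sum_(i <- p :: l) a *: (rational_scalar i.2 *: fn i.1) =
      (a * rational_scalar p.2) *: fn p.1 +
      \sum_(i <- l) a *: (rational_scalar i.2 *: fn i.1).
    by rewrite big_cons -scalerA.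
  exact: (MD _ _ (Mf _ _) IH).
have MZ a m : M m -> M (a *: m).
  move=> Mm; apply: Mclosed => e e0.
  pose c := modulus S a; have c0 : 0 <= c := modulus_ge0 _ _.
  have e1 : 0 < e / (c + 1) by rewrite divr_gt0//; lra.
  have [l Hl] := Mm _ e1; exists (a *: comb l); first exact: Mcomb.
  rewrite -scalerBr; apply: le_trans (opnormZ_le _ _) _; rewrite -/c.
  have : c * opnorm (m - comb l) <= c * (e / (c + 1)) by rewrite ler_wpM2l.
  have -> : c * (e / (c + 1)) = e - e / (c + 1) by field; lra.
  lra.
pose A f := [set opnorm (f - m) | m in M].
(* the distance to M is a seminorm on the dual *)
pose p f := inf (A f).
have Ai f : has_inf (A f).
  by split; [exists (opnorm (f - 0)); exists 0|exists 0 => _ [m _ <-]; exact: opnorm_ge0].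
have ple f m : M m -> p f <= opnorm (f - m).
  by move=> Mm; apply: ge_inf; [case: (Ai f)|exists m].
have p0 f : 0 <= p f.
  by apply: lb_le_inf => [|_ [m _ <-]]; [case: (Ai f)|exact: opnorm_ge0].
have padh f (e : R) : 0 < e -> exists2 m, M m & opnorm (f - m) < p f + e.
  by move=> e0; have [_ [m Mm <-] H] := inf_adherent e0 (Ai f); exists m.
clearbody p.
have pD f g : p (f + g) <= p f + p g.
  apply/ler_addgt0Pr => e e0; have e2 : 0 < e / 2 by lra.
  have [m1 M1 H1] := padh f _ e2; have [m2 M2 H2] := padh g _ e2.
  apply: le_trans (ple _ _ (MD _ _ M1 M2)) _; rewrite opprD addrACA.
  by apply: le_trans (opnormD _ _) _; lra.
have pZle a f : p (a *: f) <= modulus S a * p f.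
  apply/ler_addgt0Pr => e e0.
  pose c := modulus S a; have c0 : 0 <= c := modulus_ge0 _ _.
  have e1 : 0 < e / (c + 1) by rewrite divr_gt0//; lra.
  have [m Mm H] := padh f _ e1.
  apply: le_trans (ple _ _ (MZ a _ Mm)) _; rewrite -scalerBr.
  apply: le_trans (opnormZ_le _ _) _; rewrite -/c.
  have : c * opnorm (f - m) <= c * (p f + e / (c + 1)) by rewrite ler_wpM2l// ltW.
  have -> : c * (p f + e / (c + 1)) = c * p f + (e - e / (c + 1)) by field; lra.
  lra.
have pZ a f : p (a *: f) = modulus S a * p f.
  have [->|a0] := eqVneq a 0.
    rewrite scale0r modulus0 mul0r; apply/eqP; rewrite eq_le p0 andbT.
    by have := ple 0 0 M0; rewrite subr0 opnorm0.
  have m0 := modulus_gt0 S a0.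
  apply/eqP; rewrite eq_le pZle /=.
  have := pZle a^-1 (a *: f); rewrite scalerA mulVf// scale1r modulusV.
  by rewrite ler_pdivlMl.
have pop f : p f <= opnorm f by have := ple f 0 M0; rewrite subr0.
have p_eq0 f0 : p f0 = 0.
  have [h [hl hp hf0]] := seminorm_dominates_linear f0 pD pZ.
  have hfn n : h (fn n) = 0.
    apply: (modulus_eq0 (S := S)); apply/eqP; rewrite eq_le modulus_ge0 andbT.
    apply: le_trans (hp _) _; have := ple (fn n) (fn n).
    rewrite subrr opnorm0; apply.
    have -> : fn n = 1 *: fn n by rewrite scale1r.
    exact: Mf.
  pose phi (f : X -> K^o) := if pselect (dual f) is left df then h (mk_functional df) else 0.
  have phiE f : phi f = h f.
    rewrite /phi; case: pselect => [df|]; last by move=> nd; case: (nd (functional_dual f)).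
    by congr h; exact: functionalP.
  have [||x Hx] := refl phi.
  - move=> a f g df dg.
    rewrite (phiE (a *: mk_functional df + mk_functional dg)) hl.
    by rewrite (phiE (mk_functional df)) (phiE (mk_functional dg)).
  - exists 1 => f df fb; rewrite (phiE (mk_functional df)) (normE S) -(rmorph1 (emb S)) emb_le.
    apply: le_trans (hp _) _; apply: le_trans (pop _) _; apply: opnorm_le => // x.
    rewrite mul1r; have [->|x0] := eqVneq x 0; first by rewrite fun0 modulus0 nrm0.
    have n0 := nrm_gt0 S x0.
    have := fb (emb S (nrm x)^-1 *: x).
    have -> : f (emb S (nrm x)^-1 *: x) = emb S (nrm x)^-1 * f x.
      exact: (funZ (mk_functional df)).
    rewrite -(embs_nrm S) nrmZ (normE S (_ * _)) modulusM modulus_emb gtr0_norm ?invr_gt0//.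
    rewrite mulVf ?lt0r_neq0// rmorph1 lexx => /(_ isT).
    by rewrite -(rmorph1 (emb S)) emb_le ler_pdivrMl// mulr1.
  have fnx n : fn n x = 0 by rewrite -(Hx _ (functional_dual (fn n))) phiE hfn.
  have x0 : x = 0.
    apply: (nrm_eq0 (S := S)); apply/eqP; rewrite eq_le nrm_ge0 andbT.
    apply/ler_addgt0Pr => e e0; have e2 : 0 < e / 2 by lra.
    have [n Hn] := dd x _ e2; have [fb fd] := fnP n.
    have := fb (d n - x); rewrite funB fnx subr0 fd modulus_emb ger0_norm ?nrm_ge0//.
    have := nrm_dist S x (d n); rewrite (nrm_distC S (d n)); lra.
  have := Hx _ (functional_dual f0); rewrite phiE hf0 x0 fun0 => E.
  by rewrite -(re_emb S (p f0)) E re0.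
exists (fun n => if unpickle n is Some l then comb l else 0) => f e e0.
have [m Mm] := padh f _ (ltac:(lra) : 0 < e / 2); rewrite p_eq0 add0r => H1.
have [l Hl] := Mm _ (ltac:(lra) : 0 < e / 2).
exists (pickle l); rewrite pickleK.
have -> : f - comb l = (f - m) + (m - comb l) by rewrite addrA subrK.
by apply: le_trans (opnormD _ _) _; lra.
Qed.

End Separability.

(** * Asymptotically fixed vectors and invariant functionals *)

Section Isometries.
Variables (R : realType) (K : numFieldType) (S : scalars R K) (X : normedModType K).
Local Notation functional := (functional X).
Local Notation nrm := (nrm S).
Local Notation unitf := (@unit_functionals R K S X).
Local Notation prg := (@pairing R K S X).
Implicit Types (x y : X) (f g : functional) (T : {linear X -> X}) (s : seq X).

Lemma Isom_nrm T x : Isom T -> nrm (T x) = nrm x.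
Proof. by move=> [iT _]; apply: (emb_inj (S := S)); rewrite !embs_nrm iT. Qed.

Lemma nrm_Isom T : (forall x, nrm (T x) = nrm x) -> (forall y, exists x, T x = y) -> Isom T.
Proof. by move=> iT sT; split=> // x; rewrite -!(embs_nrm S) iT. Qed.

Lemma Isom_id : Isom (idfun : {linear X -> X}).
Proof. by split=> // y; exists y. Qed.

Lemma Isom_comp T1 T2 : Isom T1 -> Isom T2 -> Isom (T1 \o T2 : {linear X -> X}).
Proof.
move=> [i1 s1] [i2 s2]; split=> [x|y] /=; first by rewrite i1 i2.
by have [x <-] := s1 y; have [z <-] := s2 x; exists z.
Qed.

Lemma Isom_inverse T : Isom T ->
  exists T' : {linear X -> X}, [/\ Isom T', cancel T T' & cancel T' T].
Proof.
move=> [iT sT]; have [h hE] := choice sT.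
have Tinj : injective T.
  move=> x y E; apply/eqP; rewrite -subr_eq0 -normr_eq0 -iT linearB E subrr.
  by rewrite normr0.
have hl : linear h by move=> a x y; apply: Tinj; rewrite linearP !hE.
pose T' : {linear X -> X} := HB.pack h (GRing.isLinear.Build _ _ _ _ h hl).
have T'E x : T' x = h x by [].
have hT x : h (T x) = x by apply: Tinj; rewrite hE.
exists T'; split=> //.
by split=> [x|y]; [rewrite T'E -[in RHS](hE x) iT|exists (T y); rewrite T'E].
Qed.

Definition almost_fixing s (d : R) :=
  [set T : {linear X -> X} | Isom T /\ forall y, y \in s -> nrm (T y - y) <= d].

Definition fixing_filter s := filter_from [set d : R | 0 < d] (almost_fixing s).

Global Instance fixing_filter_proper s : ProperFilter (fixing_filter s).
Proof.
apply: filter_from_proper; last first.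
  move=> d /= d0; exists idfun; split; first exact: Isom_id.
  by move=> y _; rewrite subrr nrm0 ltW.
apply: filter_from_filter; first by exists 1 => /=.
move=> d1 d2 /= d10 d20; exists (Num.min d1 d2); first by rewrite /= lt_min d10.
move=> T [iT HT]; split; split=> // y ys; apply: le_trans (HT y ys) _;
  by rewrite ge_min lexx ?orbT.
Qed.

Lemma fixing_filter_Isom s : fixing_filter s (@Isom K X).
Proof. by exists 1 => //= T []. Qed.

Lemma fixing_filter_near s y (e : R) : y \in s -> 0 < e ->
  fixing_filter s [set T | nrm (T y - y) <= e].
Proof. by move=> ys e0; exists e => //= T [_]; apply. Qed.

(** The filter version of the envelope of s: x is fixed in the limit by isometries
   that fix s in the limit. *)
Definition asymptotically_fixed s x := forall e : R, 0 < e ->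
  fixing_filter s [set T | nrm (T x - x) <= e].

(** The same condition for the action on the dual, pointwise. *)
Definition asymptotically_invariant s f := forall x (e : R), 0 < e ->
  fixing_filter s [set T | modulus S (f (T x) - f x) <= e].

Lemma asymptotically_fixed_Env s (Y : set X) x : (forall y, y \in s -> Y y) ->
  asymptotically_fixed s x -> Env Y x.
Proof.
move=> sY fx I le T dir iT TY.
have netF : Filter (net_tails le).
  have [[i0 _] ler letr led] := dir; split.
  - by exists i0.
  - move=> A B [i Hi] [j Hj]; have [k [ik jk]] := led i j.
    by exists k => l kl; split; [apply: Hi; exact: letr kl|apply: Hj; exact: letr kl].
  - by move=> A B AB [i Hi]; exists i => j /Hi /AB.
apply/(nrm_cvgP S) => e e0; have e2 : 0 < e / 2 by lra.
have [d /= d0 Hd] := fx _ e2.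
suff : net_tails le [set i | almost_fixing s d (T i)].
  by apply: filterS => i /Hd /= ?; lra.
have : net_tails le [set i | forall y, y \in s -> nrm (T i y - y) <= d].
  elim: s sY {fx Hd} => [|y s IH] sY; first by apply: filterS filterT.
  have H1 := IH (fun z zs => sY z (mem_behead (s := y :: s) zs)).
  have /(nrm_cvgP S)/(_ _ d0) H2 := TY y (sY y (mem_head _ _)).
  apply: filterS (filterI H1 H2) => i [/= h1 h2] z; rewrite inE => /orP[/eqP->|/h1//].
  exact: ltW.
by apply: filterS => i /= Hi; split.
Qed.

Hypotheses (sepX : separable_space X) (reflX : reflexive_space X).

(** If f does not vanish at x, the fixed point theorem applies to the vectors of norm at most
   nrm x on which the real part of f is at least the modulus of f x; it yields an asymptotically
   fixed vector there. *)
Lemma asymptotically_invariant_eq0 s f : asymptotically_invariant s f ->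
  (forall x, asymptotically_fixed s x -> f x = 0) -> f = 0.
Proof.
move=> finv ffix; apply: functionalP => x; rewrite functional0.
apply/eqP; apply: contrapT => /negP fx0.
have [u [u1 uE]] := phase S (f x).
have m0 := modulus_gt0 S fx0.
pose z := u *: x; have fz : re S (f z) = modulus S (f x) by rewrite funZ uE re_emb.
have nz : nrm z = nrm x by rewrite nrmZ u1 mul1r.
have r0 := nrm_ge0 S x.
have [d Hd] := dense_sequence S sepX.
have ballE v : wball prg unitf (nrm x) v <-> nrm v <= nrm x by exact: wball_nrm.
pose K0 := wball prg unitf (nrm x) `&`
  [set v | modulus S (f x) <= pairing S v f].
have [||||||||||||||||v [bv fv] Hv] := @fixed_point R X functional prg
    unitf (nrm x) (reflexive_weak_compact r0 reflX) d 0 _ _ _ _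
    {linear X -> X} (fun T v => T v) (@Isom K X) (fixing_filter s)
    (fixing_filter_proper s)
    (fixing_filter_Isom s) _ _ _ _ _ _ _ K0.
- move=> w Ww; exists (- w) => [y|y]; last by rewrite /pairing functionalN reN.
  by rewrite functionalN modulusN; exact: Ww.
- by move=> g h t; exists (g + emb S t *: h) => v; rewrite /pairing reD re_embM.
- move=> w; have [C C0 HC] := functional_bound S w; exists (C * nrm x) => v.
  move=> /ballE vr; apply: le_trans (re_modulus _ _) _.
  by apply: le_trans (HC v) _; rewrite ler_wpM2l.
- by move=> v e /(Hd v)[n Hn]; exists n; apply/unit_functionals_dist.
- move=> T1 T2 i1 i2; exists (T1 \o T2 : {linear X -> X}) => //.
  exact: Isom_comp.
- by exists idfun => //; exact: Isom_id.
- move=> T iT w; have [C C0 HC] := functional_bound S w.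
  have [||w' Hw'] := @bounded_functional R K S X (fun v => w (T v)) C.
  + by move=> a u' v; rewrite linearP fun_linear.
  + by move=> v; rewrite -(Isom_nrm v iT).
  by exists w' => v; rewrite /pairing Hw'.
- move=> T iT v w e /unit_functionals_dist H; apply/unit_functionals_dist.
  by rewrite -(Isom_nrm _ iT) linearB.
- move=> T iT v /ballE vr; apply/ballE.
  by rewrite Isom_nrm.
- move=> v w /unit_functionals_dist H.
  have /eqP : nrm (v - w) = 0 by apply/eqP; rewrite eq_le H nrm_ge0.
  by move=> /eqP/nrm_eq0/eqP; rewrite subr_eq0 => /eqP ->.
- move=> v w; exists (emb S 2^-1 *: (v + w)) => g.
  by rewrite /pairing funZ funD re_embM reD mulrC.
- by apply: wclosedI; [exact: wclosed_wball|exact: wclosed_halfge].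
- move=> v w m [bv fv] [bw fw] Hm; split; last by rewrite /= Hm /pairing; move: fv fw => /=; rewrite /pairing; lra.
  move=> g Wg; have := bv g Wg; have := bw g Wg; rewrite Hm; lra.
- move=> U UU FU v w [bv fv] Hw; split.
    apply: (@wclosed_wball _ _ _ _ _ _ ((fun T => T v) @ U)) => //.
      exact: fmap_ultra.
    change (U [set T : {linear X -> X} | wball prg unitf (nrm x) (T v)]).
    apply: filterS (FU _ (fixing_filter_Isom s)) => T iT /=.
    by apply/ballE; rewrite (Isom_nrm _ iT); exact/ballE.
  suff E : pairing S v f = pairing S w f by rewrite /= -E.
  have UF : ProperFilter U := ultra_proper.
  apply: (@cvg_unique R^o _ ((fun T : {linear X -> X} => pairing S (T v) f) @ U)) => //; last exact: Hw.
  apply/cvgrPdist_le => e e0; apply: filterS (FU _ (finv v e e0)) => T /=.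
  by apply: le_trans; rewrite modulus_distC /pairing -reB modulus_re.
- by move=> v [].
- exists z; split; first by apply/ballE; rewrite nz.
  by rewrite /= /pairing fz.
have : f v = 0.
  by apply: ffix => e e0; apply: filterS (Hv e e0) => T /unit_functionals_dist.
by move: fv; rewrite /= /pairing => /[swap] ->; rewrite re0 leNgt m0.
Qed.

Lemma wball_functional f (r : R) : 0 <= r -> wball (fun f x => re S (f x)) [set x : X | nrm x <= 1] r f <->
  forall x, modulus S (f x) <= r * nrm x.
Proof.
move=> r0; split=> [H x|H x /= x1].
  have [->|x0] := eqVneq x 0; first by rewrite fun0 modulus0 nrm0 mulr0.
  have n0 := nrm_gt0 S x0; have [u [u1 uE]] := phase S (f x).
  have := H ((emb S (nrm x)^-1 * u) *: x).
  rewrite /= nrmZ modulusM modulus_emb u1 mulr1 gtr0_norm ?invr_gt0//.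
  rewrite mulVf ?lt0r_neq0// lexx => /(_ isT).
  by rewrite funZ -mulrA uE -rmorphM re_emb ler_pdivrMl// mulrC.
apply: le_trans (re_modulus _ _) _; apply: le_trans (H x) _.
by rewrite -[leRHS]mulr1 ler_wpM2l.
Qed.

(** The fixed point theorem in the dual space, applied to the set of functionals of norm at most 1
   that attain the norm at y. Separability of the dual makes it available there. *)
Lemma asymptotically_invariant_norming y : exists f,
  [/\ asymptotically_invariant [:: y] f, unitf f & f y = emb S (nrm y)].
Proof.
have [D HD] := separable_dual S sepX reflX.
pose b f x := re S (f x).
pose W1 := [set x : X | nrm x <= 1].
have act_ex (Tf : {linear X -> X} * functional) : exists g : functional,
    Isom Tf.1 -> forall x, g x = Tf.2 (Tf.1 x).
  have [iT|nT] := pselect (Isom Tf.1); last by exists 0.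
  have [C C0 HC] := functional_bound S Tf.2.
  have [||g Hg] := @bounded_functional R K S X (fun v => Tf.2 (Tf.1 v)) C.
  - by move=> a u v; rewrite linearP fun_linear.
  - by move=> v; rewrite -(Isom_nrm v iT).
  by exists g.
have [act0 act0E] := choice act_ex; pose act T f := act0 (T, f).
have actE T f x : Isom T -> act T f x = f (T x) by move=> iT; exact: (act0E (T, f)).
have ballE f : wball b W1 1 f <-> forall x, modulus S (f x) <= nrm x.
  by split=> [/(wball_functional f ler01) H x|H];
    [rewrite -[leRHS]mul1r|apply/(wball_functional f ler01) => x; rewrite mul1r].
pose K0 := wball b W1 1 `&` [set f | nrm y <= b f y].
have [||||||||||||||||| f [bf fy] Hf] := @fixed_point R functional X b W1 1 _ D 0 _ _ _ _
    {linear X -> X} act (@Isom K X) (fixing_filter [:: y])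
    (fixing_filter_proper [:: y]) (fixing_filter_Isom [:: y]) _ _ _ _ _ _ _ K0.
- move=> U UU Ub.
  have Ub' x : U [set f : functional | modulus S (f x) <= nrm x].
    by apply: filterS Ub => f /ballE; exact.
  have [h hE] := choice (fun x => ultra_bounded_cvg_scalar (S := S) UU (h := fun f : functional => f x) (Ub' x)).
  have [||g gE] := @bounded_functional R K S X h 1.
  + move=> a u v.
    suff c2 : (fun f : functional => f (a *: u + v)) @ U --> (a * h u + h v : K^o).
      exact: (@cvg_unique K^o _ _ _ _ _ (hE _) c2).
    have -> : (fun f : functional => f (a *: u + v)) = (fun f => a *: (f u : K^o) + f v).
      by apply/funext => f; rewrite fun_linear.
    by apply: cvgD; [apply: cvgZl_tmp; exact: hE|exact: hE].
  + by move=> u; rewrite mul1r; exact: (modulus_lim_le (S := S) UU (hE u) (Ub' u)).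
  by exists g => x; rewrite /b gE; exact: (re_cvg (S := S) UU (hE x)).
- move=> w Ww; exists (- w); first by rewrite /W1 /= nrmN.
  by move=> f; rewrite /b funN reN.
- by move=> g h t; exists (g + emb S t *: h) => f; rewrite /b funD funZ reD re_embM.
- move=> w; exists (nrm w) => f /ballE H.
  by apply: le_trans (re_modulus _ _) (H w).
- move=> f e /(HD f)[n Hn]; exists n => w Ww.
  rewrite /b -reB -functionalB; apply: le_trans (re_modulus _ _) _.
  apply: le_trans (opnormP S (f - D n) w) _; apply: le_trans Hn.
  by rewrite -[leRHS]mulr1 ler_wpM2l ?opnorm_ge0.
- move=> T1 T2 i1 i2; exists (T2 \o T1 : {linear X -> X}); first exact: Isom_comp.
  move=> f; apply: functionalP => x; rewrite !actE//; exact: Isom_comp.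
- exists idfun => [|f]; first exact: Isom_id.
  by apply: functionalP => x; rewrite actE//; exact: Isom_id.
- by move=> T iT w; exists (T w) => f; rewrite /b actE.
- move=> T iT f g e H w Ww; have [x xw] := iT.2 w.
  have := H x; rewrite /b !actE// xw; apply.
  by rewrite /W1 /= -(Isom_nrm x iT) xw.
- by move=> T iT f /ballE H; apply/ballE => x; rewrite actE// -(Isom_nrm x iT).
- move=> f g H.
  have H' : forall x, modulus S ((f - g) x) <= 0 * nrm x.
    by apply/wball_functional => // w Ww; rewrite functionalB reB; exact: H.
  move=> w; have := H' w; rewrite mul0r functionalB => H0.
  rewrite /b; congr re; apply/eqP; rewrite -subr_eq0; apply/eqP.
  by apply: (modulus_eq0 (S := S)); apply/eqP; rewrite eq_le H0 modulus_ge0.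
- move=> f g; exists (emb S 2^-1 *: (f + g)) => x.
  by rewrite /b functionalZ functionalD re_embM reD mulrC.
- by apply: wclosedI; [exact: wclosed_wball|exact: wclosed_halfge].
- move=> f g m [bf fy] [bg gy] Hm; split; last by rewrite /= Hm; move: fy gy => /=; lra.
  move=> x Wx; have := bf x Wx; have := bg x Wx; rewrite Hm; lra.
- move=> U UU FU f g [bf fy] Hg; split.
    apply: (@wclosed_wball _ _ _ _ _ _ ((fun T => act T f) @ U)) => //.
      exact: fmap_ultra.
    change (U [set T : {linear X -> X} | wball b W1 1 (act T f)]).
    apply: filterS (FU _ (fixing_filter_Isom [:: y])) => T iT /=.
    by apply/ballE => x; rewrite actE// -(Isom_nrm x iT); move/ballE: bf; apply.
  suff E : b f y = b g y by rewrite /= -E.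
  have UF : ProperFilter U := ultra_proper.
  apply: (@cvg_unique R^o _ ((fun T : {linear X -> X} => b (act T f) y) @ U)) => //; last exact: Hg.
  apply/cvgrPdist_le => e e0.
  have H1 := FU _ (fixing_filter_near (mem_head y [::]) e0).
  apply: filterS (filterI H1 (FU _ (fixing_filter_Isom _))) => T [/= Te iT].
  rewrite /b actE// distrC -reB -funB; apply: le_trans (modulus_re _ _) _.
  by apply: le_trans Te; move/ballE: bf; apply.
- by move=> f [].
- have [f [fb fy]] := norming_functional S y; exists f; split; first exact/ballE.
  by rewrite /= /b fy re_emb.
have fb : unitf f by exact/ballE.
exists f; split=> // [x e e0|].
  have n1 : 0 < nrm x + 1 by have := nrm_ge0 S x; lra.
  have e1 : 0 < e / (nrm x + 1) by rewrite divr_gt0.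
  apply: filterS (filterI (Hf _ e1) (fixing_filter_Isom _)) => T [/= H iT].
  have H' : forall z, modulus S ((act T f - f) z) <= e / (nrm x + 1) * nrm z.
    by apply/(wball_functional _ (ltW e1)) => w Ww; rewrite functionalB reB; exact: H.
  have := H' x; rewrite functionalB actE//.
  have -> : e / (nrm x + 1) * nrm x = e - e / (nrm x + 1) by field; lra.
  lra.
have E : modulus S (f y) = nrm y.
  apply/eqP; rewrite eq_le fb /=; apply: le_trans (re_modulus _ _); exact: fy.
by rewrite -E; apply: re_eq_modulus; apply/eqP; rewrite eq_le re_modulus E.
Qed.

End Isometries.

(** * Support functionals of collinear and coplanar vectors *)

Section LinearAlgebra.
Variables (K : fieldType) (V : lmodType K).
Implicit Types (x y z : V) (a b c : K).

Definition indep2 x y := forall a b, a *: x + b *: y = 0 -> a = 0 /\ b = 0.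

Definition indep3 x y z := forall a b c, a *: x + b *: y + c *: z = 0 ->
  [/\ a = 0, b = 0 & c = 0].

Lemma indep2_neq0 x y : indep2 x y -> x != 0 /\ y != 0.
Proof.
move=> H; split; apply/eqP => E.
  by have [] := H 1 0; rewrite ?E ?scaler0 ?scale0r ?addr0// => /eqP; rewrite oner_eq0.
by have [] := H 0 1; rewrite ?E ?scaler0 ?scale0r ?addr0// => _ /eqP; rewrite oner_eq0.
Qed.

Lemma indep2C x y : indep2 x y -> indep2 y x.
Proof. by move=> H a b; rewrite addrC => /H[]. Qed.

Lemma indep2P x y : x != 0 -> (forall a, y != a *: x) -> indep2 x y.
Proof.
move=> x0 H a b E; have b0 : b = 0.
  apply/eqP; apply: contrapT => /negP b0; have := H (- (b^-1 * a)); case/negP; apply/eqP.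
  have := congr1 (fun v => b^-1 *: v) E; rewrite scalerDr !scalerA mulVf// scale1r scaler0.
  by move=> /eqP; rewrite addrC addr_eq0 scaleNr => /eqP.
move: E; rewrite b0 scale0r addr0 => /eqP; rewrite scaler_eq0 (negbTE x0) orbF.
by move=> /eqP ->.
Qed.

Lemma indep3P x y z : indep2 x y -> (forall a b, z != a *: x + b *: y) -> indep3 x y z.
Proof.
move=> xy H a b c E; have c0 : c = 0.
  apply/eqP; apply: contrapT => /negP c0.
  have := H (- (c^-1 * a)) (- (c^-1 * b)); case/negP; apply/eqP.
  have := congr1 (fun v => c^-1 *: v) E; rewrite !scalerDr !scalerA mulVf// scale1r scaler0.
  by move=> /eqP; rewrite addrC addr_eq0 opprD !scaleNr => /eqP.
by move: E; rewrite c0 scale0r addr0 => /xy [].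
Qed.

Lemma indep3_12 x y z : indep3 x y z -> indep2 x y.
Proof. by move=> H a b E; have [|-> ->] := H a b 0; rewrite ?scale0r ?addr0. Qed.

Lemma indep3_rot x y z : indep3 x y z -> indep3 y z x.
Proof. by move=> H a b c; rewrite addrC addrA => /H[]. Qed.

Lemma indep3_13 x y z : indep3 x y z -> indep2 x z.
Proof. by move=> /indep3_rot/indep3_rot/indep3_12/indep2C. Qed.

Lemma indep3_23 x y z : indep3 x y z -> indep2 y z.
Proof. by move=> /indep3_rot/indep3_12. Qed.

Lemma solve2 (a b c d e f : K) : a * d - b * c != 0 ->
  exists u v, u * a + v * b = e /\ u * c + v * d = f.
Proof.
move=> D; exists ((e * d - b * f) / (a * d - b * c)), ((a * f - e * c) / (a * d - b * c)).
by split; field.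
Qed.

End LinearAlgebra.

Section Collineation.
Variables (R : realType) (K : numFieldType) (S : scalars R K) (X : normedModType K).
Local Notation functional := (functional X).
Local Notation nrm := (nrm S).
Local Notation unitf := (@unit_functionals R K S X).
Implicit Types (x y z : X) (f g : functional) (a b c : K).

Lemma indep2_fun f x y : f x != 0 -> f y = 0 -> y != 0 -> indep2 x y.
Proof.
move=> fx fy y0 a b E; have a0 : a = 0.
  have := congr1 f E; rewrite fun0 fun_linear funZ fy mulr0 addr0 => /eqP.
  by rewrite mulf_eq0 (negbTE fx) orbF => /eqP.
move: E; rewrite a0 scale0r add0r => /eqP; rewrite scaler_eq0 (negbTE y0) orbF.
by move=> /eqP ->.
Qed.

(** F y is a support functional at y. The hypothesis F_plane says that the functionals attached to
   the vectors of a plane are determined by their values on that plane; so they span a space of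
   dimension at most 2, and F preserves collinearity of points of the projective space. *)
Variable F : X -> functional.
Hypothesis F_unit : forall y, unitf (F y).
Hypothesis F_norm : forall y, F y y = emb S (nrm y).
Hypothesis F_line : forall y a, y != 0 -> exists c, F (a *: y) = c *: F y.
Hypothesis F_plane : forall y z a1 b1 a2 b2 a3 b3 c1 c2 c3 f, indep2 y z ->
  f = c1 *: F (a1 *: y + b1 *: z) + c2 *: F (a2 *: y + b2 *: z) +
      c3 *: F (a3 *: y + b3 *: z) ->
  f y = 0 -> f z = 0 -> f = 0.
Hypothesis dim3 : forall y z, exists x, forall a b, x != a *: y + b *: z.

Lemma F_neq0 y : y != 0 -> F y y != 0.
Proof.
move=> y0; rewrite F_norm -(rmorph0 (emb S)) (inj_eq (emb_inj (S := S))).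
by rewrite lt0r_neq0// nrm_gt0.
Qed.

(** F maps the plane spanned by y and z to the span of F y and F z as soon as the
   latter are not proportional, which is detected by their values at y and z. *)
Lemma F_span_det y z a b : indep2 y z ->
  F y y * F z z - F z y * F y z != 0 -> exists u v, F (a *: y + b *: z) = u *: F y + v *: F z.
Proof.
move=> yz D.
have [u [v [E1 E2]]] := solve2 (F (a *: y + b *: z) y) (F (a *: y + b *: z) z) D.
exists u, v.
have := @F_plane y z a b 1 0 0 1 1 (- u) (- v) _ yz erefl.
rewrite !scale0r addr0 add0r !scale1r => H.
have : F (a *: y + b *: z) + - u *: F y + - v *: F z = 0.
  apply: H; rewrite !functionalD !functionalZ; first by rewrite -E1; ring.
  by rewrite -E2; ring.
by rewrite !scaleNr -addrA -opprD => /eqP; rewrite subr_eq0 => /eqP.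
Qed.

Lemma F_span_det0 y z : indep2 y z -> F y y * F z z - F z y * F y z = 0 ->
  exists c, F z = c *: F y.
Proof.
move=> yz D; have [y0 z0] := indep2_neq0 yz.
have := @F_plane y z 1 0 0 1 0 0 (F z y) (- F y y) 0 _ yz erefl.
rewrite !scale0r !addr0 add0r !scale1r => H.
have : F z y *: F y + - F y y *: F z = 0.
  apply: H; rewrite !functionalD !functionalZ; first by ring.
  by rewrite -[RHS]oppr0 -D; ring.
rewrite scaleNr => /eqP; rewrite subr_eq0 => /eqP E.
exists ((F y y)^-1 * F z y); rewrite -scalerA E scalerA mulVf ?scale1r//.
exact: F_neq0.
Qed.

Lemma F_span y z a b : indep2 y z -> (forall c, F z <> c *: F y) ->
  exists u v, F (a *: y + b *: z) = u *: F y + v *: F z.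
Proof.
move=> yz H; have [D|D] := eqVneq (F y y * F z z - F z y * F y z) 0.
  by have [c /H] := F_span_det0 yz D.
exact: F_span_det.
Qed.

(** The vector p = w + l y also equals w' + l z with w' = w + l (y - z), so F p lies
   in the span of F y, F w and in that of F z, F w', where F z is a multiple of
   F y; F p is not a multiple of F y since p is longer than its y-component. *)
Lemma F_perp_step y z w (l c : K) : y != 0 -> F z = c *: F y -> F y z = F y y ->
  F y w = 0 -> w + l *: (y - z) != 0 -> 2 * modulus S l * nrm y < nrm w ->
  exists k a, F w = k *: F (w + l *: (y - z)) + a *: F y.
Proof.
move=> y0 Fz Fyz Fyw w'0 lw.
have ny := nrm_gt0 S y0; have Fy0 := F_neq0 y0; have m0 := modulus_ge0 S l.
have nw : 0 < nrm w by apply: le_lt_trans lw; rewrite !mulr_ge0// ltW.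
have w0 : w != 0 by apply/eqP => E; move: nw; rewrite E nrm0 ltxx.
pose w' := w + l *: (y - z).
have Fyw' : F y w' = 0 by rewrite /w' funD funZ funB Fyz subrr mulr0 addr0.
have span u v p (d : K) : F u = d *: F y -> F y u != 0 -> F y v = 0 -> v != 0 ->
    p = v + l *: u -> exists a b, F p = a *: F y + b *: F v.
  move=> Fu gu0 Fyv v0 ->.
  have uv : indep2 u v by exact: indep2_fun gu0 Fyv v0.
  have u0 : u != 0 by apply/eqP => E; move: gu0; rewrite E fun0 eqxx.
  have [|a [b E]] := @F_span_det u v l 1 uv.
    have Fuv : F u v = 0 by rewrite Fu functionalZ Fyv mulr0.
    by rewrite Fuv mulr0 subr0 mulf_neq0// F_neq0.
  by exists (a * d), b; rewrite addrC -{1}(scale1r v) E Fu scalerA.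
have [a [b E1]] := span y w (w + l *: y) 1 (esym (scale1r _)) Fy0 Fyw w0 erefl.
pose p := w + l *: y.
have np : modulus S l * nrm y < nrm p.
  have := nrm_dist S w (- (l *: y)); rewrite opprK nrmN nrmZ -/p.
  by move: lw; rewrite -mulrA mulr_natl mulr2n; lra.
have b0 : b != 0.
  apply/eqP => b0; move: E1; rewrite b0 scale0r addr0 => E1.
  have a1 : modulus S a <= 1.
    have := F_unit (w + l *: y) y; rewrite E1 functionalZ modulusM F_norm modulus_emb.
    by rewrite gtr0_norm// ger_pMl.
  have := F_norm (w + l *: y); rewrite E1 functionalZ funD Fyw add0r funZ F_norm => /(congr1 (modulus S)).
  rewrite !modulusM !modulus_emb (gtr0_norm ny) (ger0_norm (nrm_ge0 S _)) -/p => E.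
  have : modulus S a * (modulus S l * nrm y) <= 1 * (modulus S l * nrm y).
    by rewrite ler_wpM2r// mulr_ge0// ltW.
  by rewrite E mul1r leNgt np.
have [||a' [b' E2]] := span z w' (w + l *: y) c Fz _ Fyw' w'0 _.
- by rewrite Fyz.
- by rewrite /w' -addrA -scalerDr subrK.
have E3 : b *: F w = (a' - a) *: F y + b' *: F w'.
  have := E2; rewrite E1 scalerBl => E; rewrite -(addrC (b' *: _)) addrA (addrC (b' *: _)) -E.
  by rewrite addrAC subrr add0r.
exists (b^-1 * b'), (b^-1 * (a' - a)).
by rewrite -(scale1r (F w)) -(mulVf b0) -scalerA E3 scalerDr !scalerA addrC.
Qed.

(** Repeated small steps: all the functionals F (w + t (y - z)) agree with F w on the
   kernel of F y up to a factor. *)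
Lemma F_perp_chain y z w (t c : K) : y != 0 -> F z = c *: F y -> F y z = F y y ->
  F y w = 0 -> w != 0 -> (forall s, nrm w <= 2 * nrm (w + s *: (y - z))) ->
  exists k, forall x, F y x = 0 -> F w x = k * F (w + t *: (y - z)) x.
Proof.
move=> y0 Fz Fyz Fyw w0 lower.
have ny := nrm_gt0 S y0; have nw := nrm_gt0 S w0.
have m0 := modulus_ge0 S t.
(* the number of steps, so that each one satisfies the bound of F_perp_step *)
pose N := Num.truncn (4 * modulus S t * nrm y / nrm w).
have tN : 4 * modulus S t * nrm y < nrm w * N.+1%:R.
  by rewrite (mulrC (nrm w)) -ltr_pdivrMr//; exact: truncnS_gt.
pose h := emb S N.+1%:R^-1 * t.
have hE : h *+ N.+1 = t.
  by rewrite -mulr_natl /h mulrA -(rmorph_nat (emb S)) -rmorphM mulfV ?rmorph1 ?mul1r.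
have steps n : exists k, forall x, F y x = 0 -> F w x = k * F (w + (h *+ n) *: (y - z)) x.
  elim: n => [|n [k IH]].
    by exists 1 => x _; rewrite mulr0n scale0r addr0 mul1r.
  pose wn := w + (h *+ n) *: (y - z).
  have Fywn : F y wn = 0 by rewrite funD Fyw funZ funB Fyz subrr mulr0 addr0.
  have wE : w + (h *+ n.+1) *: (y - z) = wn + h *: (y - z).
    by rewrite mulrSr scalerDl addrA.
  have wn1 : wn + h *: (y - z) != 0.
    apply/eqP => E; have := lower (h *+ n.+1); rewrite wE E nrm0 mulr0.
    by rewrite leNgt nw.
  have [|k' [a E]] := F_perp_step y0 Fz Fyz Fywn wn1.
    have := lower (h *+ n); rewrite -/wn.
    have -> : modulus S h = N.+1%:R^-1 * modulus S t.
      by rewrite modulusM modulus_emb ger0_norm// invr_ge0 ler0n.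
    have N0 : 0 < N.+1%:R :> R by rewrite ltr0n.
    have : 4 * (N.+1%:R^-1 * modulus S t) * nrm y < nrm w.
      have -> : 4 * (N.+1%:R^-1 * modulus S t) * nrm y = N.+1%:R^-1 * (4 * modulus S t * nrm y).
        by ring.
      by rewrite ltr_pdivrMl// (mulrC _ (nrm w)).
    move: (N.+1%:R^-1 * modulus S t) => q; lra.
  exists (k * k') => x Fyx; rewrite (IH x Fyx) -/wn E functionalD !functionalZ Fyx.
  by rewrite mulr0 addr0 mulrA wE.
by have [k] := steps N.+1; rewrite hE => Hk; exists k.
Qed.

(** If F z were a multiple of F y, then, after rescaling z, every functional F (w + t v), with
   v = y - z and w in the kernel of F y, would be proportional to F w there. As
   F (w + t v) does not vanish at w + t v for any t, F w would vanish at v; then so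
   would F (w + t v) for all t, which is impossible for large t. *)
Lemma F_inj y z : indep2 y z -> forall c, F z <> c *: F y.
Proof.
move=> yz c Fz; have [y0 z0] := indep2_neq0 yz.
have Fy0 := F_neq0 y0.
have Fyz0 : F y z != 0.
  by apply/eqP => E; have := F_neq0 z0; rewrite Fz functionalZ E mulr0 eqxx.
pose s := F y y / F y z; have s0 : s != 0 by rewrite mulf_neq0 ?invr_eq0.
pose z' := s *: z.
have Fyz' : F y z' = F y y by rewrite funZ divfK.
have [c1 Fz1] := F_line s z0.
have Fz' : F z' = (c1 * c) *: F y by rewrite Fz1 Fz scalerA.
pose v := y - z'.
have Fyv : F y v = 0 by rewrite funB Fyz' subrr.
have v0 : v != 0.
  apply/eqP => E; have [|E1 _] := yz 1 (- s); first by rewrite scale1r scaleNr.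
  by move/eqP: E1; rewrite oner_eq0.
have Fv0 := F_neq0 v0.
have [x Hx] := dim3 y z.
pose w0 := x - (F y x / F y y) *: y.
have Fyw0 : F y w0 = 0 by rewrite funB funZ divfK// subrr.
pose w := w0 - (F v w0 / F v v) *: v.
have Fyw : F y w = 0 by rewrite funB Fyw0 funZ Fyv mulr0 subr0.
have Fvw : F v w = 0 by rewrite funB funZ divfK// subrr.
have wn0 : w != 0.
  apply/eqP => /eqP; rewrite subr_eq0 subr_eq => /eqP E.
  have := Hx (F v w0 / F v v + F y x / F y y) (- (F v w0 / F v v) * s).
  case/negP; apply/eqP; rewrite {1}E.
  move: (F v w0 / F v v) (F y x / F y y) => a b.
  by rewrite /v /z' scalerBr scalerDl scalerA mulNr scaleNr addrAC.
have nw := nrm_gt0 S wn0; have nv := nrm_gt0 S v0.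
have lower t : nrm w <= 2 * nrm (w + t *: v).
  have H1 := nrm_dist S w (- (t *: v)); rewrite opprK nrmN nrmZ in H1.
  have := F_unit v (w + t *: v); rewrite funD Fvw add0r funZ F_norm modulusM modulus_emb.
  by rewrite gtr0_norm//; lra.
have chain t := F_perp_chain t y0 Fz' Fyz' Fyw wn0 lower.
have Fw0 := F_neq0 wn0.
have Fwv : F w v = 0.
  apply/eqP; apply: contrapT => /negP Fwv.
  pose t := - (F w w / F w v); have [k Hk] := chain t.
  have k0 : k != 0 by apply/eqP => k0; move: Fw0; rewrite (Hk _ Fyw) k0 mul0r eqxx.
  have Fyp : F y (w + t *: v) = 0 by rewrite funD funZ Fyv Fyw mulr0 addr0.
  have := Hk _ Fyp; rewrite {1}funD funZ mulNr divfK// subrr => /esym/eqP.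
  rewrite mulf_eq0 (negbTE k0) /= => /eqP Fp.
  have p0 : w + t *: v != 0.
    by apply/eqP => E; have := lower t; rewrite E nrm0 mulr0 leNgt nw.
  by have := F_neq0 p0; rewrite Fp eqxx.
pose t := emb S (3 * nrm w / nrm v); have [k Hk] := chain t.
have k0 : k != 0 by apply/eqP => k0; move: Fw0; rewrite (Hk _ Fyw) k0 mul0r eqxx.
have Ftv : F (w + t *: v) v = 0.
  have := Hk _ Fyv; rewrite Fwv => /esym/eqP.
  by rewrite mulf_eq0 (negbTE k0) /= => /eqP.
have := F_unit (w + t *: v) w.
have -> : F (w + t *: v) w = emb S (nrm (w + t *: v)).
  by rewrite -F_norm funD funZ Ftv mulr0 addr0.
rewrite modulus_emb ger0_norm ?nrm_ge0//.
have := nrm_dist S (t *: v) (- w); rewrite opprK nrmN nrmZ (addrC (t *: v)) modulus_emb.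
rewrite ger0_norm ?divr_ge0 ?mulr_ge0 ?nrm_ge0// divfK ?lt0r_neq0//.
lra.
Qed.

(** Were F z in the span of F x and F y, there would be p in the plane of x and y such that
   all three functionals vanish at z - p. Since p is in the span of x and y, F p lies in the span
   of F x and F y, and F (z - p) in that of F z and F p; then F (z - p) would vanish at z - p. *)
Lemma F_notin_span x y z : indep3 x y z -> forall a b, F z <> a *: F x + b *: F y.
Proof.
move=> xyz a b E.
have xy := indep3_12 xyz; have [x0 y0] := indep2_neq0 xy.
have D : F x x * F y y - F x y * F y x != 0.
  apply/eqP => D; have [|c] := @F_span_det0 x y xy; last exact: F_inj.
  by rewrite -[RHS]D; ring.
have [u [v [Eu Ev]]] := solve2 (F x z) (F y z) D.
pose p := u *: x + v *: y.
have Fxp : F x (z - p) = 0 by rewrite funB funD !funZ Eu subrr.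
have Fyp : F y (z - p) = 0 by rewrite funB funD !funZ Ev subrr.
have Fzp : F z (z - p) = 0.
  by rewrite E functionalD !functionalZ Fxp Fyp !mulr0 addr0.
have z0 : z != 0 by have [] := indep2_neq0 (indep3_23 xyz).
have zp c : z - p != c *: p.
  apply/eqP => Ez; have zE : z = (1 + c) *: p by rewrite scalerDl scale1r -Ez addrC subrK.
  have [|_ _ /eqP] := xyz (- (1 + c) * u) (- (1 + c) * v) 1.
    by rewrite -!scalerA -scalerDr -/p scale1r [X in _ + X]zE scaleNr addNr.
  by rewrite oner_eq0.
have e0 : z - p != 0 by have := zp 0; rewrite scale0r.
have [p0|pn0] := eqVneq p 0.
  by have := F_neq0 z0; have := Fzp; rewrite p0 subr0 => ->; rewrite eqxx.
have zp2 : indep2 z p.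
  apply: indep2C; apply: indep2P => // c; apply/eqP => Ez.
  by have := zp (c - 1); rewrite scalerBl scale1r -Ez eqxx.
have [k [l El]] := F_span 1 (- 1) zp2 (F_inj zp2).
have [k' [l' El']] := F_span u v xy (F_inj xy).
rewrite scale1r scaleN1r -/p in El; rewrite -/p in El'.
have := F_neq0 e0; rewrite El functionalD !functionalZ Fzp El' functionalD !functionalZ.
by rewrite Fxp Fyp => /eqP; apply; ring.
Qed.

Lemma F_indep x y z : indep3 x y z -> indep3 (F x) (F y) (F z).
Proof.
move=> xyz a b c E.
have xy := indep3_12 xyz; have [x0 y0] := indep2_neq0 xy.
have c0 : c = 0.
  apply/eqP; apply: contrapT => /negP c0.
  apply: (F_notin_span xyz (a := - (c^-1 * a)) (b := - (c^-1 * b))).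
  have := congr1 (fun v => c^-1 *: v) E; rewrite !scalerDr !scalerA mulVf// scale1r scaler0.
  by move=> /eqP; rewrite addrC addr_eq0 opprD !scaleNr => /eqP.
move: E; rewrite c0 scale0r addr0 => E.
have b0 : b = 0.
  apply/eqP; apply: contrapT => /negP b0.
  apply: (F_inj xy (c := - (b^-1 * a))).
  have := congr1 (fun v => b^-1 *: v) E; rewrite !scalerDr !scalerA mulVf// scale1r scaler0.
  by move=> /eqP; rewrite addrC addr_eq0 scaleNr => /eqP.
split=> //; move: E; rewrite b0 scale0r addr0 => /(congr1 (fun f : functional => f x)).
rewrite functionalZ functional0 => /eqP; rewrite mulf_eq0 (negbTE (F_neq0 x0)) orbF.
by move=> /eqP.
Qed.

End Collineation.

(** * The fundamental theorem of projective geometry *)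

Section LinearAlgebra2.
Variables (K : fieldType) (V : lmodType K).
Implicit Types (x y z : V) (a b c : K).

Lemma indep3_eq x y z a b c a' b' c' : indep3 x y z ->
  a *: x + b *: y + c *: z = a' *: x + b' *: y + c' *: z -> [/\ a = a', b = b' & c = c'].
Proof.
move=> H /eqP; rewrite -subr_eq0 => /eqP E.
have [|/eqP Ea /eqP Eb /eqP Ec] := H (a - a') (b - b') (c - c').
  by rewrite !scalerBl (addrACA (a *: x)) -opprD addrACA -opprD.
by move: Ea Eb Ec; rewrite !subr_eq0 => /eqP -> /eqP -> /eqP ->.
Qed.

Lemma indep2_eq x y a b a' b' : indep2 x y ->
  a *: x + b *: y = a' *: x + b' *: y -> a = a' /\ b = b'.
Proof.
move=> H /eqP; rewrite -subr_eq0 => /eqP E.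
have [|/eqP Ea /eqP Eb] := H (a - a') (b - b').
  by rewrite !scalerBl addrACA -opprD.
by move: Ea Eb; rewrite !subr_eq0 => /eqP -> /eqP ->.
Qed.

Lemma indep2_shift x y a b : a != 0 -> indep2 x y -> indep2 (a *: x + b *: y) y.
Proof.
move=> a0 H c d; rewrite scalerDr !scalerA -addrA -scalerDl => /H[/eqP].
rewrite mulf_eq0 (negbTE a0) orbF => /eqP -> /eqP; rewrite mul0r add0r => /eqP ->.
by [].
Qed.

Lemma indep3_scale x y z a b c : a != 0 -> b != 0 -> c != 0 ->
  indep3 x y z -> indep3 (a *: x) (b *: y) (c *: z).
Proof.
move=> a0 b0 c0 H d e f; rewrite !scalerA => /H[/eqP + /eqP + /eqP].
by rewrite !mulf_eq0 (negbTE a0) (negbTE b0) (negbTE c0) !orbF => /eqP -> /eqP -> /eqP ->.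
Qed.

Lemma indep2_scale x y a b : a != 0 -> b != 0 -> indep2 x y -> indep2 (a *: x) (b *: y).
Proof.
move=> a0 b0 H d e; rewrite !scalerA => /H[/eqP + /eqP].
by rewrite !mulf_eq0 (negbTE a0) (negbTE b0) !orbF => /eqP -> /eqP ->.
Qed.

End LinearAlgebra2.

Section FundamentalTheorem.
Variables (K : fieldType) (V W : lmodType K) (F : V -> W).
Implicit Types (x y z : V) (a b c t : K).
Hypothesis F_neq0 : forall y, y != 0 -> F y != 0.
Hypothesis F_line : forall y a, y != 0 -> exists c, F (a *: y) = c *: F y.
Hypothesis F_span : forall y z a b, indep2 y z ->
  exists u v, F (a *: y + b *: z) = u *: F y + v *: F z.
Hypothesis F_indep2 : forall y z, indep2 y z -> indep2 (F y) (F z).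
Hypothesis F_indep3 : forall x y z, indep3 x y z -> indep3 (F x) (F y) (F z).
Hypothesis dim3 : forall y z, exists x, forall a b, x != a *: y + b *: z.
Variables (x0 : V) (h : V -> K).
Hypothesis hlin : forall a x y, h (a *: x + y) = a * h x + h y.
Hypothesis hx0 : h x0 = 1.

Let h0 : h 0 = 0.
Proof. by have := hlin (-1) 0 0; rewrite scaler0 addr0 mulN1r addNr. Qed.

Let hZ a x : h (a *: x) = a * h x.
Proof. by have := hlin a x 0; rewrite !addr0 h0 addr0. Qed.

Let hD x y : h (x + y) = h x + h y.
Proof. by have := hlin 1 x y; rewrite scale1r mul1r. Qed.

Let x0_neq0 : x0 != 0.
Proof. by apply/eqP => E; have := hx0; rewrite E h0 => /esym/eqP; rewrite oner_eq0. Qed.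

Lemma ker_indep2 x : h x = 0 -> x != 0 -> indep2 x0 x.
Proof.
move=> hx xn0 a b E; have a0 : a = 0.
  by have := congr1 h E; rewrite hlin hZ hx hx0 h0 mulr0 addr0 mulr1.
move: E; rewrite a0 scale0r add0r => /eqP; rewrite scaler_eq0 (negbTE xn0) orbF.
by move=> /eqP ->.
Qed.

Lemma ker_indep3 x y : h x = 0 -> h y = 0 -> indep2 x y -> indep3 x0 x y.
Proof.
move=> hx hy xy a b c E; have a0 : a = 0.
  by have := congr1 h E; rewrite -addrA hlin hD !hZ hx hy hx0 h0 !mulr0 !addr0 mulr1.
by move: E; rewrite a0 scale0r add0r => /xy [].
Qed.

Lemma ker_third x : exists z, h z = 0 /\ (forall a, z != a *: x).
Proof.
have [v Hv] := dim3 x0 x; exists (v - h v *: x0); split.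
  by rewrite -scaleNr addrC hlin hx0 mulr1 addNr.
move=> a; apply/eqP => E; have := Hv (h v) a; rewrite -E.
by rewrite addrC subrK eqxx.
Qed.

(** F determines a point A x on the line of F x once F x0 is normalized: F (x0 + x) is proportional
   to F x0 + A x. *)
Lemma lift_ex x : exists al : W, indep2 x0 x ->
  (exists2 c, c != 0 & al = c *: F x) /\
  exists2 d, d != 0 & F (x0 + x) = d *: (F x0 + al).
Proof.
have [H|nH] := pselect (indep2 x0 x); last by exists 0.
have [u [v E]] := F_span 1 1 H; rewrite !scale1r in E.
have xn0 : x != 0 by case: (indep2_neq0 H).
have u0 : u != 0.
  apply/eqP => u0; move: E; rewrite u0 scale0r add0r => E.
  have /F_indep2 H' : indep2 (x0 + x) x.
    by have := indep2_shift (b := 1) (oner_neq0 K) H; rewrite !scale1r.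
  have [|/eqP] := H' 1 (- v); first by rewrite E scale1r scaleNr subrr.
  by rewrite oner_eq0.
have v0 : v != 0.
  apply/eqP => v0; move: E; rewrite v0 scale0r addr0 => E.
  have /F_indep2 H' : indep2 (x + x0) x0.
    by have := indep2_shift (b := 1) (oner_neq0 K) (indep2C H); rewrite !scale1r.
  have [|/eqP] := H' 1 (- u); first by rewrite (addrC x) E scale1r scaleNr subrr.
  by rewrite oner_eq0.
exists ((u^-1 * v) *: F x) => _; split.
  by exists (u^-1 * v) => //; rewrite mulf_neq0 ?invr_eq0.
by exists u => //; rewrite E scalerDr scalerA mulVKf.
Qed.

(** The line of F (x0 + x + y) is the intersection of the plane through F (x0 + x) and
   F y with the one through F (x0 + y) and F x. *)
Lemma lift_additive (A : V -> W) : (forall x, indep2 x0 x ->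
    (exists2 c, c != 0 & A x = c *: F x) /\
    exists2 d, d != 0 & F (x0 + x) = d *: (F x0 + A x)) ->
  forall x y, indep3 x0 x y -> A (x + y) = A x + A y.
Proof.
move=> HA x y H.
have Hx := indep3_12 H; have Hy := indep3_13 H; have Hxy := indep3_23 H.
have [[c c0 Ax] [d d0 Ex]] := HA x Hx.
have [[c' c'0 Ay] [d' d'0 Ey]] := HA y Hy.
have H3 : indep3 (F x0) (A x) (A y).
  rewrite Ax Ay -[F x0]scale1r; apply: indep3_scale => //; first exact: oner_neq0.
  exact: F_indep3.
have Fy : F y = c'^-1 *: A y by rewrite Ay scalerA mulVf// scale1r.
have Fx : F x = c^-1 *: A x by rewrite Ax scalerA mulVf// scale1r.
have Hxy1 : indep2 (x0 + x) y.
  move=> a b E; have [] := H a a b; last by [].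
  by rewrite -scalerDr.
have Hxy2 : indep2 (x0 + y) x.
  move=> a b E; have [] := H a b a; last by [].
  by rewrite addrAC -scalerDr.
have Hs : indep2 x0 (x + y).
  by move=> a b; rewrite scalerDr addrA => /H[-> -> _].
have [u [v E1]] := F_span 1 1 Hxy1.
have [u' [v' E2]] := F_span 1 1 Hxy2.
have [[c2 _ As] [d2 d20 Es]] := HA _ Hs.
have [s [t Est]] := F_span 1 1 Hxy.
rewrite !scale1r in E1 E2 Est.
have [P1 P2 P3] : [/\ u * d = u' * d', u * d = v' * c^-1 & v * c'^-1 = u' * d'].
  apply: (indep3_eq H3).
  have := E1; rewrite (addrAC x0 x y) E2 Ex Ey Fx Fy !scalerA !scalerDr => E.
  by rewrite -E addrAC.
have Exy : F (x0 + (x + y)) = (u * d) *: (F x0 + A x + A y).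
  by rewrite addrA E1 Ex Fy !scalerA P3 -P1 -scalerDr.
have Ad : u * d = d2.
  have [] : [/\ u * d = d2, u * d = d2 * c2 * s * c^-1 & u * d = d2 * c2 * t * c'^-1].
    apply: (indep3_eq H3); rewrite -!scalerDr -Exy Es scalerDr As Est Fx Fy.
    by rewrite !scalerDr !scalerA addrA.
  by [].
apply: (addrI (F x0)); apply: (scalerI d20).
by rewrite -Es Exy Ad addrA.
Qed.

(** The fundamental theorem of projective geometry. On the kernel of h the lift A of F is additive,
   by lift_additive and, for dependent vectors, by a third direction. Its scaling factor does not
   depend on the vector, as one sees on x + y; this gives the endomorphism s. Then A is extended to
   the whole space by A x0 = F x0. *)
Theorem projective_semilinear : exists (A : V -> W) (s : K -> K),
  [/\ forall x y, A (x + y) = A x + A y,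
      forall t x, A (t *: x) = s t *: A x,
      forall x, x != 0 -> exists c, F x = c *: A x &
      [/\ forall t u, s (t + u) = s t + s u, forall t u, s (t * u) = s t * s u & s 1 = 1]].
Proof.
have [A0 HA0] := choice lift_ex.
have add0 := lift_additive HA0.
pose A x := if x == 0 then 0 else A0 x.
have AE x : x != 0 -> A x = A0 x by rewrite /A => /negbTE ->.
have A00 : A 0 = 0 by rewrite /A eqxx.
have addI x y : h x = 0 -> h y = 0 -> indep2 x y -> A (x + y) = A x + A y.
  move=> hx hy xy; have [xn0 yn0] := indep2_neq0 xy.
  have xyn0 : x + y != 0.
    by apply/eqP => E; have [|/eqP] := xy 1 1; rewrite ?scale1r ?oner_eq0.
  by rewrite !AE// add0//; exact: ker_indep3.
have add x y : h x = 0 -> h y = 0 -> A (x + y) = A x + A y.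
  move=> hx hy; have [->|xn0] := eqVneq x 0; first by rewrite A00 !add0r.
  have [->|yn0] := eqVneq y 0; first by rewrite A00 !addr0.
  have [H|nH] := pselect (indep2 x y); first exact: addI.
  have [a ya] : exists a, y = a *: x.
    apply: contrapT => Ha; apply: nH; apply: indep2P => // a; apply/eqP => E.
    by apply: Ha; exists a.
  have [z [hz Hz]] := ker_third x.
  have xz : indep2 x z by exact: indep2P.
  have yz : indep2 y z.
    by apply: indep2P => // b; rewrite ya scalerA; exact: Hz.
  have a0 : a != 0 by apply: contra_neq yn0 => a0; rewrite ya a0 scale0r.
  have x_yz : indep2 x (y + z).
    apply: indep2P => // b; apply/eqP => E; have := Hz (b - a).
    by rewrite scalerBl -E -ya addrAC subrr add0r eqxx.
  have hyz : h (y + z) = 0 by rewrite hD hy hz addr0.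
  have E1 : A (x + (y + z)) = A x + (A y + A z) by rewrite addI// (addI _ _ hy hz).
  have E2 : A (x + y + z) = A (x + y) + A z.
    have [->|xy0] := eqVneq (x + y) 0; first by rewrite A00 !add0r.
    apply: addI => //; first by rewrite hD hx hy addr0.
    apply: indep2P => // b; apply/eqP => E; have := Hz (b * (1 + a)).
    by rewrite -scalerA scalerDl scale1r -ya -E eqxx.
  by apply: (addIr (A z)); rewrite -E2 -addrA E1 addrA.
have Aprop x : h x = 0 -> x != 0 -> exists2 c, c != 0 & A x = c *: F x.
  by move=> hx xn0; rewrite AE//; have [] := HA0 x (ker_indep2 hx xn0).
have Aindep x y : h x = 0 -> h y = 0 -> indep2 x y -> indep2 (A x) (A y).
  move=> hx hy xy; have [xn0 yn0] := indep2_neq0 xy.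
  have [c c0 ->] := Aprop x hx xn0; have [d d0 ->] := Aprop y hy yn0.
  by apply: indep2_scale => //; exact: F_indep2.
have scale_ex t x : h x = 0 -> x != 0 -> exists s, A (t *: x) = s *: A x.
  move=> hx xn0; have [->|t0] := eqVneq t 0.
    by exists 0; rewrite !scale0r A00.
  have txn0 : t *: x != 0 by rewrite scaler_eq0 negb_or t0.
  have htx : h (t *: x) = 0 by rewrite hZ hx mulr0.
  have [c c0 Ec] := Aprop x hx xn0; have [d d0 Ed] := Aprop _ htx txn0.
  have [k Ek] := F_line t xn0.
  by exists (d * k * c^-1); rewrite Ed Ek Ec !scalerA divfK.
have scale_indep t s x y : h x = 0 -> h y = 0 -> indep2 x y ->
    A (t *: x) = s *: A x -> A (t *: y) = s *: A y.
  move=> hx hy xy Es; have [xn0 yn0] := indep2_neq0 xy.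
  have xyn0 : x + y != 0.
    by apply/eqP => E; have [|/eqP] := xy 1 1; rewrite ?scale1r ?oner_eq0.
  have hxy : h (x + y) = 0 by rewrite hD hx hy addr0.
  have [s1 E1] := scale_ex t _ hxy xyn0; have [s2 E2] := scale_ex t y hy yn0.
  have := E1; rewrite scalerDr (add (t *: x)) ?hZ ?hx ?hy ?mulr0// add// Es E2 scalerDr.
  by move=> /(indep2_eq (Aindep _ _ hx hy xy))[-> ->].
have [e [he Hn]] := ker_third 0.
have e0 : e != 0 by have := Hn 0; rewrite scale0r.
have [s Hs] := choice (fun t => scale_ex t e he e0).
have As t x : h x = 0 -> A (t *: x) = s t *: A x.
  move=> hx; have [->|xn0] := eqVneq x 0; first by rewrite scaler0 A00 scaler0.
  have [H|nH] := pselect (indep2 e x); first exact: scale_indep he hx H (Hs t).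
  have [a xa] : exists a, x = a *: e.
    apply: contrapT => Ha; apply: nH; apply: indep2P => // a; apply/eqP => E.
    by apply: Ha; exists a.
  have [z [hz Hz]] := ker_third e.
  have ez : indep2 e z by exact: indep2P.
  have zx : indep2 z x.
    by apply: indep2C; apply: indep2P => // b; rewrite xa scalerA; exact: Hz.
  have Ez := scale_indep _ _ _ _ he hz ez (Hs t).
  exact: scale_indep hz hx zx Ez.
have Ae0 : A e != 0.
  have [c c0 ->] := Aprop e he e0.
  by rewrite scaler_eq0 negb_or c0 F_neq0.
have cancelAe a b : a *: A e = b *: A e -> a = b.
  move=> /eqP; rewrite -subr_eq0 -scalerBl scaler_eq0 (negbTE Ae0) orbF subr_eq0.
  by move/eqP.
have sD t u : s (t + u) = s t + s u.
  apply: cancelAe; rewrite -As// scalerDl add ?hZ ?he ?mulr0//.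
  by rewrite !As// scalerDl.
have sM t u : s (t * u) = s t * s u.
  by apply: cancelAe; rewrite -As// -scalerA As ?hZ ?he ?mulr0// As// scalerA.
have s1 : s 1 = 1.
  by apply: cancelAe; rewrite -As// !scale1r.
have s0 : s 0 = 0.
  by apply: cancelAe; rewrite -As// !scale0r A00.
pose pr x := x - h x *: x0.
have hpr x : h (pr x) = 0 by rewrite /pr -scaleNr addrC hlin hx0 mulr1 addNr.
have prD x y : pr (x + y) = pr x + pr y by rewrite /pr hD scalerDl opprD addrACA.
have prZ t x : pr (t *: x) = t *: pr x by rewrite /pr hZ -scalerA -scalerBr.
exists (fun x => s (h x) *: F x0 + A (pr x)), s; split=> //.
- by move=> x y; rewrite hD sD scalerDl prD add// addrACA.
- by move=> t x; rewrite hZ sM prZ As// scalerDr scalerA.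
- move=> x xn0; have xE : x = h x *: x0 + pr x by rewrite /pr addrC subrK.
  have [hx|hxn0] := eqVneq (h x) 0.
    rewrite hx s0 scale0r add0r; have -> : pr x = x by rewrite /pr hx scale0r subr0.
    have [c c0 ->] := Aprop x hx xn0.
    by exists c^-1; rewrite scalerA mulVf// scale1r.
  have shx : s (h x) != 0.
    apply/eqP => E; have : s (h x * (h x)^-1) = 0 by rewrite sM E mul0r.
    by rewrite mulfV// s1 => /eqP; rewrite oner_eq0.
  have [px0|pxn0] := eqVneq (pr x) 0.
    rewrite px0 A00 addr0; have [c Ec] := F_line (h x) x0_neq0.
    exists (c / s (h x)); rewrite scalerA divfK// -Ec.
    by rewrite {1}xE px0 addr0.
  pose y := (h x)^-1 *: pr x.
  have hy : h y = 0 by rewrite hZ hpr mulr0.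
  have yn0 : y != 0 by rewrite scaler_eq0 negb_or invr_eq0 hxn0.
  have py : pr x = h x *: y by rewrite /y scalerA mulfV// scale1r.
  have xE2 : x = h x *: (x0 + y) by rewrite scalerDr -py -xE.
  have xy0 : x0 + y != 0 by apply: contra_neq xn0 => E; rewrite xE2 E scaler0.
  have [_ [d d0 Ed]] := HA0 y (ker_indep2 hy yn0).
  have [c Ec] := F_line (h x) xy0.
  exists (c * d / s (h x)); rewrite py As// AE//.
  by rewrite -scalerDr scalerA divfK// {1}xE2 Ec Ed scalerA.
Qed.

End FundamentalTheorem.

(** * Conjugation and bounded endomorphisms of the scalars *)

Section Conjugation.
Variables (R : realType) (K : numFieldType) (S : scalars R K).
Implicit Types (x y z : K) (r : R).
Local Notation re := (re S).
Local Notation emb := (emb S).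
Local Notation iota := (iota S).

(** For the complex numbers this is minus the imaginary part, and 0 for the reals. *)
Definition im z := re (iota * z).

Lemma scalarE z : z = emb (re z) - iota * emb (im z).
Proof. exact: scalar_split. Qed.

Lemma im_emb r : im (emb r) = 0.
Proof. by rewrite /im re_Memb re_iota mul0r. Qed.

Lemma imD x y : im (x + y) = im x + im y.
Proof. by rewrite /im mulrDr reD. Qed.

Lemma im_iota z : im (iota * z) = - re z * (iota != 0)%:R.
Proof.
rewrite /im mulrA; have [E|E] := iota2 S; first by rewrite E !mul0r re0 eqxx mulr0.
have -> : iota != 0.
  by apply/eqP => E0; move/eqP: E; rewrite E0 mul0r eq_sym oppr_eq0 oner_eq0.
by rewrite E mulN1r reN mulr1.
Qed.

Lemma im_eq0 z : iota = 0 -> im z = 0.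
Proof. by move=> E; rewrite /im E mul0r re0. Qed.

Lemma reM x y : re (x * y) = re x * re y - im x * im y.
Proof.
rewrite {1}(scalarE x) mulrBl reB re_embM; congr (_ - _).
by rewrite mulrAC mulrC re_embM.
Qed.

Lemma imM x y : im (x * y) = re x * im y + im x * re y.
Proof.
have [E|E] := eqVneq iota 0; first by rewrite !im_eq0// mulr0 mul0r addr0.
rewrite /im mulrA reM im_iota E mulr1 -/(im x) -/(im y); ring.
Qed.

Lemma scalar_eq x y : re x = re y -> im x = im y -> x = y.
Proof. exact: re_iota_eq. Qed.

Definition conj z := emb (re z) + iota * emb (im z).

Lemma re_conj z : re (conj z) = re z.
Proof. by rewrite /conj reD re_emb re_Memb re_iota mul0r addr0. Qed.

Lemma im_conj z : im (conj z) = - im z.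
Proof.
rewrite /conj imD im_emb im_iota re_emb add0r.
have [E|_] := eqVneq iota 0; last by rewrite mulr1.
by rewrite im_eq0// mulr0 oppr0.
Qed.

Lemma conjD x y : conj (x + y) = conj x + conj y.
Proof. by rewrite /conj reD imD !rmorphD; ring. Qed.

Lemma conjM x y : conj (x * y) = conj x * conj y.
Proof.
apply: scalar_eq; rewrite ?reM ?imM ?re_conj ?im_conj ?reM ?imM; ring.
Qed.

Lemma conj_emb r : conj (emb r) = emb r.
Proof. by rewrite /conj re_emb im_emb rmorph0 mulr0 addr0. Qed.

Lemma conj0 : conj 0 = 0.
Proof. by rewrite -(rmorph0 emb) conj_emb. Qed.

Lemma conj1 : conj 1 = 1.
Proof. by rewrite -(rmorph1 emb) conj_emb. Qed.

Lemma conjN z : conj (- z) = - conj z.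
Proof. by have := conjD z (- z); rewrite subrr conj0 => /esym/eqP; rewrite addr_eq0 => /eqP ->; rewrite opprK. Qed.

Lemma conjB x y : conj (x - y) = conj x - conj y.
Proof. by rewrite conjD conjN. Qed.

Lemma conjK : involutive conj.
Proof. by move=> z; apply: scalar_eq; rewrite ?re_conj ?im_conj ?opprK ?re_conj ?im_conj ?opprK. Qed.

Lemma modulus2 z : modulus S z ^+ 2 = re z ^+ 2 + im z ^+ 2.
Proof. by rewrite sqr_sqrtr// addr_ge0// sqr_ge0. Qed.

Lemma modulus_conj z : modulus S (conj z) = modulus S z.
Proof. by rewrite /modulus re_conj -/(im _) im_conj sqrrN. Qed.

Lemma mul_conj z : z * conj z = emb (modulus S z ^+ 2).
Proof.
by apply: scalar_eq; rewrite ?reM ?imM ?re_emb ?im_emb re_conj im_conj ?modulus2; ring.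
Qed.

Lemma conj_eq0 z : conj z = 0 -> z = 0.
Proof. by move=> E; rewrite -(conjK z) E conj0. Qed.

Lemma conj_fixed z : conj z = z -> z = emb (re z).
Proof.
move=> E; apply: scalar_eq; rewrite ?re_emb ?im_emb//.
by have := im_conj z; rewrite E => ?; lra.
Qed.

Lemma additive_natmul (h : K -> K) : (forall x y, h (x + y) = h x + h y) ->
  forall n x, h (x *+ n) = h x *+ n.
Proof.
move=> hD; have h0 : h 0 = 0 by apply: (addrI (h 0)); rewrite -hD !addr0.
by elim=> [|n IH] x; rewrite ?mulr0n// !mulrS hD IH.
Qed.

(** A ring endomorphism that is bounded near 0 fixes the real scalars: h r = s r - r is
   additive, vanishes at the integers, and is bounded on [0, 1], hence on the line. *)
Lemma bounded_endomorphism_emb (s : K -> K) (d C : R) : 0 < d ->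
  (forall x y, s (x + y) = s x + s y) -> s 1 = 1 ->
  (forall x, modulus S x <= d -> modulus S (s x) <= C) ->
  forall r, s (emb r) = emb r.
Proof.
move=> d0 sD s1 sb.
pose h x := s x - x.
have hD x y : h (x + y) = h x + h y by rewrite /h sD opprD addrACA.
have hM := additive_natmul hD.
have h1 : h 1 = 0 by rewrite /h s1 subrr.
have hN x : h (- x) = - h x.
  have h0 : h 0 = 0 by apply: (addrI (h 0)); rewrite -hD !addr0.
  by have := hD x (- x); rewrite subrr h0 => /esym/eqP; rewrite addrC addr_eq0 => /eqP.
have natE z n : z *+ n = emb n%:R * z by rewrite rmorph_nat mulr_natl.
have mMn z n : modulus S (z *+ n) = n%:R * modulus S z.
  by rewrite natE modulusM modulus_emb ger0_norm.
pose m := (Num.truncn d^-1).+1.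
have m0 : 0 < m%:R :> R by rewrite ltr0n.
have md : m%:R^-1 <= d.
  by rewrite -[leRHS]invrK lef_pV2 ?posrE ?invr_gt0// ltW// truncnS_gt.
pose M := m%:R * (C + d).
have bound01 f : 0 <= f -> f <= 1 -> modulus S (h (emb f)) <= M.
  move=> f0 f1; have -> : emb f = emb (f / m%:R) *+ m.
    by rewrite natE -rmorphM mulrCA mulfV ?mulr1// lt0r_neq0.
  rewrite hM mMn ler_wpM2l ?ler0n//.
  have fd : modulus S (emb (f / m%:R)) <= d.
    rewrite modulus_emb ger0_norm ?divr_ge0 ?ler0n//.
    by apply: le_trans md; rewrite -[leRHS]mul1r ler_wpM2r// invr_ge0 ler0n.
  by rewrite /h; apply: le_trans (modulusB _ _ _) _; rewrite lerD// sb.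
have pos r : 0 <= r -> h (emb r) = 0.
  move=> r0; apply: (modulus_eq0 (S := S)); apply/eqP; rewrite eq_le modulus_ge0 andbT.
  rewrite leNgt; apply/negP => hr.
  pose n := (Num.truncn (M / modulus S (h (emb r)))).+1.
  have nM : M < n%:R * modulus S (h (emb r)).
    by rewrite -ltr_pdivrMr// truncnS_gt.
  pose k := Num.truncn (n%:R * r); have nr0 : 0 <= n%:R * r by rewrite mulr_ge0.
  have /andP[k1 k2] := truncn_itv nr0; rewrite -/k in k1 k2.
  have : modulus S (h (emb r *+ n)) <= M.
    have -> : emb r *+ n = 1 *+ k + emb (n%:R * r - k%:R).
      by rewrite !natE mulr1 -rmorphM -rmorphD addrC subrK.
    rewrite hD hM h1 mul0rn add0r; apply: bound01; first by rewrite subr_ge0.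
    by move: k2; rewrite -natr1; move: (k%:R) (n%:R * r) => u v; lra.
  by rewrite hM mMn leNgt nM.
move=> r; suff : h (emb r) = 0 by move=> /eqP; rewrite subr_eq0 => /eqP.
have [r0|/ltW r0] := leP 0 r; first exact: pos.
by rewrite -[r]opprK rmorphN hN pos ?oppr0// oppr_ge0.
Qed.

(** The endomorphism fixes the reals and maps iota to a square root of iota * iota. *)
Lemma bounded_endomorphism (s : K -> K) (d C : R) : 0 < d ->
  (forall x y, s (x + y) = s x + s y) -> (forall x y, s (x * y) = s x * s y) -> s 1 = 1 ->
  (forall x, modulus S x <= d -> modulus S (s x) <= C) ->
  (forall x, s x = x) \/ (forall x, s x = conj x).
Proof.
move=> d0 sD sM s1 sb.
have s_emb := bounded_endomorphism_emb d0 sD s1 sb.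
have sN x : s (- x) = - s x.
  have s0 : s 0 = 0 by apply: (addrI (s 0)); rewrite -sD !addr0.
  by have := sD x (- x); rewrite subrr s0 => /esym/eqP; rewrite addrC addr_eq0 => /eqP.
have sE x : s x = emb (re x) - s iota * emb (im x).
  by rewrite {1}(scalarE x) sD sN sM !s_emb.
have [E|E] := iota2 S.
  left => x; rewrite sE {3}(scalarE x) im_eq0// rmorph0 !mulr0.
  by [].
have : (s iota - iota) * (s iota + iota) = 0.
  have -> : (s iota - iota) * (s iota + iota) = s (iota * iota) - iota * iota.
    by rewrite sM; ring.
  by rewrite E sN s1 subrr.
move/eqP; rewrite mulf_eq0 subr_eq0 addr_eq0 => /orP[/eqP Es|/eqP Es].
  by left => x; rewrite sE Es -scalarE.
by right => x; rewrite sE Es mulNr opprK.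
Qed.

End Conjugation.

(** * Norms whose support functionals come from a Hermitian form *)

Section NormOfForm.
Variables (R : realType) (K : numFieldType) (S : scalars R K) (X : normedModType K).
Local Notation nrm := (nrm S).
Implicit Types (x y z u v : X) (s t : R).
Variable B : X -> X -> K.
Hypothesis B_lin : forall a x y z, B (a *: x + y) z = a * B x z + B y z.
Hypothesis B_herm : forall x y, B x y = conj S (B y x).
Hypothesis B_pos : forall x, x != 0 -> 0 < re S (B x x).
Hypothesis B_support : forall v x, modulus S (B v x) * nrm x <= re S (B x x) * nrm v.

Definition quad x := re S (B x x).

Lemma B0l z : B 0 z = 0.
Proof. by have := B_lin (-1) 0 0 z; rewrite scaler0 addr0 mulN1r addNr. Qed.

Lemma BDl x y z : B (x + y) z = B x z + B y z.
Proof. by have := B_lin 1 x y z; rewrite scale1r mul1r. Qed.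

Lemma BZl a x z : B (a *: x) z = a * B x z.
Proof. by have := B_lin a x 0 z; rewrite !addr0 B0l addr0. Qed.

Lemma BDr x y z : B x (y + z) = B x y + B x z.
Proof. by rewrite B_herm BDl conjD -!B_herm. Qed.

Lemma BZr a x y : B x (a *: y) = conj S a * B x y.
Proof. by rewrite B_herm BZl conjM -B_herm. Qed.

Lemma B_quad x : B x x = emb S (quad x).
Proof. by apply: conj_fixed; rewrite -B_herm. Qed.

Lemma quadZ a x : quad (a *: x) = modulus S a ^+ 2 * quad x.
Proof. by rewrite /quad BZl BZr mulrA mul_conj re_embM. Qed.

Definition ratio x := nrm x ^+ 2 / quad x.

Lemma ratioZ a x : a != 0 -> ratio (a *: x) = ratio x.
Proof.
move=> a0; rewrite /ratio quadZ nrmZ exprMn.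
have m0 : modulus S a ^+ 2 != 0 by rewrite expf_neq0// lt0r_neq0// modulus_gt0.
by rewrite -mulf_div mulfV// mul1r.
Qed.

Lemma ratio_ge0 x : x != 0 -> 0 <= ratio x.
Proof. by move=> x0; rewrite divr_ge0 ?sqr_ge0// ltW// B_pos. Qed.

(** The support inequality at u tested on v bounds nrm v from below in terms of nrm u. *)
Lemma ratio_step u v : u != 0 -> v != 0 ->
  ratio u * (modulus S (B v u) ^+ 2 / (quad u * quad v)) <= ratio v.
Proof.
move=> u0 v0; have qu : 0 < quad u := B_pos u0; have qv : 0 < quad v := B_pos v0.
have H : (modulus S (B v u) * nrm u) ^+ 2 <= (quad u * nrm v) ^+ 2.
  by rewrite ler_sqr ?nnegrE ?B_support// mulr_ge0 ?modulus_ge0 ?nrm_ge0// ltW.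
rewrite /ratio -(ler_pM2r (mulr_gt0 (exprn_gt0 2 qu) qv)).
have -> : nrm u ^+ 2 / quad u * (modulus S (B v u) ^+ 2 / (quad u * quad v)) *
    (quad u ^+ 2 * quad v) = (modulus S (B v u) * nrm u) ^+ 2 by field; lra.
by have -> : nrm v ^+ 2 / quad v * (quad u ^+ 2 * quad v) = (quad u * nrm v) ^+ 2 by field; lra.
Qed.

Section OrthogonalPath.
Variables (x y : X).
Hypotheses (x0 : x != 0) (yx : B y x = 0).
Let z t := x + emb S t *: y.

Let xy : B x y = 0. Proof. by rewrite B_herm yx conj0. Qed.

Let qx : 0 < quad x. Proof. exact: B_pos. Qed.

Let qy : 0 <= quad y.
Proof.
have [->|y0] := eqVneq y 0; first by rewrite /quad B0l re0.
exact/ltW/B_pos.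
Qed.

Let B_path s t : B (z s) (z t) = emb S (quad x + s * t * quad y).
Proof.
rewrite /z !BDl !BDr !BZl !BZr conj_emb xy yx !B_quad !mulr0 addr0 add0r.
by rewrite rmorphD !rmorphM mulrA.
Qed.

Let quad_path t : quad (z t) = quad x + t ^+ 2 * quad y.
Proof. by rewrite /quad B_path re_emb. Qed.

Let quad_path_ge t : quad x <= quad (z t).
Proof. by rewrite quad_path lerDl mulr_ge0// sqr_ge0. Qed.

Let path_neq0 t : z t != 0.
Proof.
apply/eqP => E; have := quad_path_ge t; rewrite E {2}/quad B0l re0.
by rewrite leNgt qx.
Qed.

(** One step along the path costs only a second order factor, because z s and z t are nearly
   parallel for B. *)
Lemma ratio_path_step s t :
  ratio (z s) * (1 - (t - s) ^+ 2 * (quad y / quad x)) <= ratio (z t).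
Proof.
apply: le_trans (ratio_step (path_neq0 s) (path_neq0 t)).
apply: ler_wpM2l; first exact: ratio_ge0.
rewrite B_path modulus_emb real_normK ?num_real// !quad_path.
have q1 : quad x <= quad x + s ^+ 2 * quad y by rewrite -quad_path.
have q2 : quad x <= quad x + t ^+ 2 * quad y by rewrite -quad_path.
set p := quad x + s ^+ 2 * quad y in q1 *; set q := quad x + t ^+ 2 * quad y in q2 *.
have p0 : 0 < p by exact: lt_le_trans q1.
have q0 : 0 < q by exact: lt_le_trans q2.
have -> : (quad x + t * s * quad y) ^+ 2 = p * q - (t - s) ^+ 2 * (quad x * quad y).
  by rewrite /p /q; ring.
rewrite mulrBl mulfV ?lt0r_neq0 ?mulr_gt0// lerB//.
rewrite -mulrA ler_wpM2l ?sqr_ge0//.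
have H : quad x * quad x <= p * q by rewrite ler_pM// ltW.
rewrite ler_pdivrMr ?mulr_gt0//.
have -> : quad x * quad y = quad y / quad x * (quad x * quad x).
  by field; exact: lt0r_neq0.
by rewrite ler_wpM2l// divr_ge0// ltW.
Qed.

(** Cutting [s, t] into N steps costs a factor (1 - c / N ^ 2) ^ N, which tends to 1. *)
Lemma ratio_path s t : ratio (z s) <= ratio (z t).
Proof.
pose c := (t - s) ^+ 2 * (quad y / quad x).
have c0 : 0 <= c by rewrite mulr_ge0 ?sqr_ge0// divr_ge0// ltW.
have main N : c < N.+1%:R -> ratio (z s) * (1 - c / N.+1%:R) <= ratio (z t).
  move=> cN; have N0 : 0 < N.+1%:R :> R by rewrite ltr0n.
  have N1 : 1 <= N.+1%:R :> R by rewrite ler1n.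
  pose w k := s + (t - s) / N.+1%:R * k%:R.
  pose e := c / N.+1%:R / N.+1%:R.
  have e0 : 0 <= e by rewrite !divr_ge0// ltW.
  have e1 : e <= 1.
    rewrite /e ler_pdivrMr// mul1r ler_pdivrMr//.
    by apply: le_trans (ltW cN) _; rewrite -[leLHS]mulr1 ler_wpM2l// ltW.
  have steps k : ratio (z s) * (1 - e * k%:R) <= ratio (z (w k)).
    elim: k => [|k IH]; first by rewrite /w !mulr0 subr0 mulr1 addr0.
    apply: le_trans (ratio_path_step (w k) (w k.+1)).
    have -> : (w k.+1 - w k) ^+ 2 * (quad y / quad x) = e.
      have -> : w k.+1 - w k = (t - s) / N.+1%:R by rewrite /w -natr1; ring.
      by rewrite /e /c; field; rewrite !lt0r_neq0.
    have : ratio (z s) * (1 - e * k%:R) * (1 - e) <= ratio (z (w k)) * (1 - e).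
      by rewrite ler_wpM2r// subr_ge0.
    apply: le_trans; rewrite -mulrA ler_wpM2l ?ratio_ge0// -natr1.
    have : 0 <= e * e * k%:R by apply: mulr_ge0; [exact: mulr_ge0|exact: ler0n].
    have -> : (1 - e * k%:R) * (1 - e) = 1 - e * (k%:R + 1) + e * e * k%:R by ring.
    by rewrite lerDl.
  have := steps N.+1; have -> : w N.+1 = t by rewrite /w divfK ?lt0r_neq0// addrC subrK.
  by rewrite /e divfK// lt0r_neq0.
rewrite leNgt; apply/negP => lt.
have d0 : 0 < ratio (z s) - ratio (z t) by lra.
pose N := Num.truncn (c + ratio (z s) * c / (ratio (z s) - ratio (z t))).
have rz := ratio_ge0 (path_neq0 s).
have rc0 : 0 <= ratio (z s) * c / (ratio (z s) - ratio (z t)).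
  by apply: divr_ge0; [exact: mulr_ge0|exact: ltW].
have NS : c + ratio (z s) * c / (ratio (z s) - ratio (z t)) < N.+1%:R by exact: truncnS_gt.
have N0 : 0 < N.+1%:R :> R by rewrite ltr0n.
have cN : c < N.+1%:R by apply: le_lt_trans NS; rewrite lerDl.
have rN : ratio (z s) * c / (ratio (z s) - ratio (z t)) < N.+1%:R.
  by apply: le_lt_trans NS; rewrite lerDr.
have := main N cN; rewrite mulrBr mulr1 mulrA lerBlDr -lerBlDl.
move: rN; rewrite ltr_pdivrMr// => rN.
by rewrite leNgt ltr_pdivrMr// (mulrC (_ - _)) rN.
Qed.

Lemma ratio_orthogonal : ratio (x + y) = ratio x.
Proof.
have z0 : z 0 = x by rewrite /z rmorph0 scale0r addr0.
have z1 : z 1 = x + y by rewrite /z rmorph1 scale1r.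
have := ratio_path 0 1; have := ratio_path 1 0; rewrite z0 z1 => H1 H2.
by apply/eqP; rewrite eq_le H1 H2.
Qed.

End OrthogonalPath.

(** The ratio nrm x ^ 2 / B(x, x) is constant: the support inequality bounds its variation
   along x + t y, with y orthogonal to x, by terms of second order in the step. *)
Theorem norm_of_form : exists k, forall x, nrm x ^+ 2 = k * re S (B x x).
Proof.
have [[x0 x0n]|X0] := pselect (exists x : X, x != 0); last first.
  exists 0 => x; have -> : x = 0.
    by apply/eqP; apply: contrapT => /negP xn; apply: X0; exists x.
  by rewrite nrm0 expr0n mul0r.
exists (ratio x0) => x.
have [->|xn] := eqVneq x 0; first by rewrite nrm0 expr0n B0l re0 mulr0.
have qx0 := B_pos x0n.
suff <- : ratio x = ratio x0 by rewrite /ratio divfK// lt0r_neq0// B_pos.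
pose a := B x x0 / B x0 x0; pose y := x - a *: x0.
have Bx0 : B x0 x0 != 0.
  by apply/eqP => E; move: qx0; rewrite E re0 ltxx.
have yx0 : B y x0 = 0 by rewrite /y addrC -scaleNr B_lin mulNr /a divfK// addNr.
have xE : x = a *: x0 + y by rewrite /y addrC subrK.
have [a0|an] := eqVneq a 0.
  have xy : x = y by rewrite xE a0 scale0r add0r.
  rewrite -xy in yx0.
  have E1 := ratio_orthogonal x0n yx0.
  have x0x : B x0 x = 0 by rewrite B_herm yx0 conj0.
  by have E2 := ratio_orthogonal xn x0x; rewrite -E2 addrC E1.
have ax0n : a *: x0 != 0 by rewrite scaler_eq0 negb_or an.
rewrite xE ratio_orthogonal//; first exact: ratioZ.
by rewrite BZr yx0 mulr0.
Qed.

End NormOfForm.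

(** * Invariant functionals of lines and planes *)

Section FixingFilters.
Variables (R : realType) (K : numFieldType) (S : scalars R K) (X : normedModType K).
Local Notation functional := (functional X).
Local Notation nrm := (nrm S).
Local Notation fixing := (@fixing_filter R K S X).
Local Notation fixed := (@asymptotically_fixed R K S X).
Local Notation inv := (@asymptotically_invariant R K S X).
Implicit Types (x y z u : X) (f g : functional) (s : seq X).

Lemma fixed_mem s y : y \in s -> fixed s y.
Proof. by move=> ys e e0; exact: fixing_filter_near. Qed.

Lemma fixed_lin s a x y : fixed s x -> fixed s y -> fixed s (a *: x + y).
Proof.
move=> fx fy e e0; pose m := modulus S a; have m0 : 0 <= m := modulus_ge0 _ _.
have e1 : 0 < e / 2 / (m + 1) by rewrite divr_gt0//; lra.
have e2 : 0 < e / 2 by lra.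
apply: filterS (filterI (fx _ e1) (fy _ e2)) => T [/= H1 H2].
have -> : T (a *: x + y) - (a *: x + y) = a *: (T x - x) + (T y - y).
  by rewrite linearP scalerBr opprD addrACA.
apply: le_trans (nrmD _ _ _) _; rewrite nrmZ -/m.
have : m * nrm (T x - x) <= m * (e / 2 / (m + 1)) by rewrite ler_wpM2l.
have : m * (e / 2 / (m + 1)) <= e / 2.
  have -> : m * (e / 2 / (m + 1)) = e / 2 - e / 2 / (m + 1) by field; lra.
  by lra.
lra.
Qed.

Lemma fixed0 s : fixed s 0.
Proof.
by move=> e e0; apply: filterS filterT => T _; rewrite /= linear0 subr0 nrm0 ltW.
Qed.

Lemma fixed_comb2 s a b x y : fixed s x -> fixed s y -> fixed s (a *: x + b *: y).
Proof.
move=> fx fy; apply: fixed_lin => //; rewrite -[b *: y]addr0.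
by apply: fixed_lin => //; exact: fixed0.
Qed.

(** Isometries almost fixing s almost fix every vector that is asymptotically fixed by s. *)
Lemma fixing_sub s s' : (forall u, u \in s' -> fixed s u) -> fixing s' `<=` fixing s.
Proof.
move=> H A [d /= d0 HA].
suff : fixing s [set T | forall u, u \in s' -> nrm (T u - u) <= d].
  move=> H1; apply: filterS (filterI H1 (fixing_filter_Isom S s)) => T [/= h iT].
  by apply: HA; split.
elim: s' H {HA} => [|u s' IH] H; first by apply: filterS filterT => T _ u; rewrite in_nil.
have H1 := IH (fun v vs => H v (mem_behead (s := u :: s') vs)).
have H2 := H u (mem_head _ _) _ d0.
apply: filterS (filterI H1 H2) => T [/= h1 h2] v; rewrite inE => /orP[/eqP->|/h1//].
exact: h2.
Qed.

Lemma inv_sub s s' f : (forall u, u \in s' -> fixed s u) -> inv s' f -> inv s f.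
Proof. by move=> H fi x e e0; exact: (fixing_sub H (fi x e e0)). Qed.

Lemma fixed_sub s s' x : (forall u, u \in s' -> fixed s u) -> fixed s' x -> fixed s x.
Proof. by move=> H fi e e0; exact: (fixing_sub H (fi e e0)). Qed.

Lemma inv_lin s a f g : inv s f -> inv s g -> inv s (a *: f + g).
Proof.
move=> fx fy x e e0; pose m := modulus S a; have m0 : 0 <= m := modulus_ge0 _ _.
have e1 : 0 < e / 2 / (m + 1) by rewrite divr_gt0//; lra.
have e2 : 0 < e / 2 by lra.
apply: filterS (filterI (fx x _ e1) (fy x _ e2)) => T [/= H1 H2].
have -> : (a *: f + g) (T x) - (a *: f + g) x = a * (f (T x) - f x) + (g (T x) - g x).
  by rewrite !functionalZD; ring.
apply: le_trans (modulusD _ _ _) _; rewrite modulusM -/m.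
have : m * modulus S (f (T x) - f x) <= m * (e / 2 / (m + 1)) by rewrite ler_wpM2l.
have : m * (e / 2 / (m + 1)) <= e / 2.
  have -> : m * (e / 2 / (m + 1)) = e / 2 - e / 2 / (m + 1) by field; lra.
  by lra.
lra.
Qed.

Lemma inv0 s : inv s 0.
Proof.
move=> x e e0; apply: filterS filterT => T _.
by change (modulus S (0 - 0) <= e); rewrite subr0 modulus0 ltW.
Qed.

Lemma invZ s a f : inv s f -> inv s (a *: f).
Proof. by move=> fi; rewrite -[a *: f]addr0; apply: inv_lin => //; exact: inv0. Qed.

End FixingFilters.

Section InvariantFunctionals.
Variables (R : realType) (K : numFieldType) (S : scalars R K) (X : normedModType K).
Local Notation functional := (functional X).
Local Notation nrm := (nrm S).
Local Notation fixed := (@asymptotically_fixed R K S X).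
Local Notation inv := (@asymptotically_invariant R K S X).
Local Notation unitf := (@unit_functionals R K S X).
Implicit Types (x y z u : X) (f g : functional) (s : seq X).
Hypotheses (sepX : separable_space X) (reflX : reflexive_space X).
Hypothesis fixed_line : forall y x, y != 0 -> fixed [:: y] x -> exists a, x = a *: y.

Lemma support_map : exists F : X -> functional, [/\ forall y, inv [:: y] (F y),
  forall y, unitf (F y) & forall y, F y y = emb S (nrm y)].
Proof.
have [F HF] := choice (asymptotically_invariant_norming S sepX reflX).
by exists F; split=> y; have [] := HF y.
Qed.

Variable F : X -> functional.
Hypothesis F_inv : forall y, inv [:: y] (F y).
Hypothesis F_norm : forall y, F y y = emb S (nrm y).

(** f and a multiple of F y agree on the line of y, which contains all fixed vectors. *)
Lemma inv_line y f : y != 0 -> inv [:: y] f -> exists c, f = c *: F y.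
Proof.
move=> y0 fi; exists (f y / F y y).
have Fy0 : F y y != 0.
  by rewrite F_norm -(rmorph0 (emb S)) (inj_eq (emb_inj (S := S))) lt0r_neq0// nrm_gt0.
apply/eqP; rewrite -subr_eq0; apply/eqP.
apply: (asymptotically_invariant_eq0 sepX reflX (s := [:: y])).
  by rewrite addrC -scaleNr; exact: inv_lin.
move=> x /(fixed_line y0)[a ->]; rewrite funZ functionalB functionalZ divfK// subrr.
by rewrite mulr0.
Qed.

Lemma inv_line_scale y a : y != 0 -> exists c, F (a *: y) = c *: F y.
Proof.
move=> y0; apply: inv_line => //; apply: inv_sub (F_inv _) => u.
rewrite inE => /eqP ->; rewrite -[_ *: _]addr0; apply: fixed_lin; last exact: fixed0.
exact/fixed_mem/mem_head.
Qed.

Lemma inv_plane y z : (forall x, fixed [:: y; z] x -> exists a b, x = a *: y + b *: z) ->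
  forall a1 b1 a2 b2 a3 b3 c1 c2 c3 f,
  f = c1 *: F (a1 *: y + b1 *: z) + c2 *: F (a2 *: y + b2 *: z) +
      c3 *: F (a3 *: y + b3 *: z) ->
  f y = 0 -> f z = 0 -> f = 0.
Proof.
move=> H a1 b1 a2 b2 a3 b3 c1 c2 c3 f fE fy fz.
have Fi a b : inv [:: y; z] (F (a *: y + b *: z)).
  apply: inv_sub (F_inv _) => u; rewrite inE => /eqP ->.
  by apply: fixed_comb2; apply: fixed_mem; rewrite !inE eqxx ?orbT.
apply: (asymptotically_invariant_eq0 sepX reflX (s := [:: y; z])).
  by rewrite fE -addrA; apply: inv_lin => //; apply: inv_lin => //; exact: invZ.
by move=> x /H[a [b ->]]; rewrite fun_linear funZ fy fz !mulr0 addr0.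
Qed.

Lemma inv_conjugate T y f : Isom T -> inv [:: T y] f ->
  forall g, (forall x, g x = f (T x)) -> inv [:: y] g.
Proof.
move=> iT fi g gE x e e0; have [T' [iT' TK T'K]] := Isom_inverse iT.
have [d /= d0 Hd] := fi (T x) e e0.
exists d => //= U [iU HU]; rewrite !gE -[U x]/((U : X -> X) x).
have := Hd (T \o U \o T' : {linear X -> X}); rewrite /= TK; apply; split.
  by apply: Isom_comp => //; exact: Isom_comp.
move=> u; rewrite inE => /eqP ->; rewrite /= TK -linearB (Isom_nrm S _ iT).
exact/HU/mem_head.
Qed.

End InvariantFunctionals.

(** * Bounds for semilinear support forms *)

(** Here b x v is the value at v of a multiple A x of a support functional at x, the map A being
   semilinear with respect to s. *)
Section SupportForm.
Variables (R : realType) (K : numFieldType) (S : scalars R K) (X : normedModType K).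
Local Notation nrm := (nrm S).
Local Notation mod := (modulus S).
Implicit Types (x y z u v w : X) (t : K).
Variables (s : K -> K) (b : X -> X -> K).
Hypothesis bDl : forall x y v, b (x + y) v = b x v + b y v.
Hypothesis bZl : forall t x v, b (t *: x) v = s t * b x v.
Hypothesis bDr : forall x v w, b x (v + w) = b x v + b x w.
Hypothesis bZr : forall t x v, b x (t *: v) = t * b x v.
Hypothesis b_neq0 : forall x, x != 0 -> b x x != 0.
Hypothesis b_support : forall x v, mod (b x v) * nrm x <= mod (b x x) * nrm v.

Lemma form_perp x v : x != 0 -> b x (v - (b x v / b x x) *: x) = 0.
Proof. by move=> /b_neq0 bx; rewrite -scaleNr bDr bZr mulNr divfK// subrr. Qed.

Lemma form_perp_exists x v : indep2 x v -> exists u, u != 0 /\ b x u = 0.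
Proof.
move=> xv; have [x0 _] := indep2_neq0 xv; exists (v - (b x v / b x x) *: x).
split; last exact: form_perp.
apply/eqP => E; have [|_ /eqP] := xv (- (b x v / b x x)) 1.
  by rewrite scale1r scaleNr addrC.
by rewrite oner_eq0.
Qed.

(** The support inequality at u + t x, tested on x, forces the coefficient s t of
   b (u + t x) x to stay bounded while t is small. *)
Lemma semilinear_bounded x v : indep2 x v ->
  exists d C, 0 < d /\ forall t, mod t <= d -> mod (s t) <= C.
Proof.
move=> xv; have [x0 _] := indep2_neq0 xv.
have [u [u0 xu]] := form_perp_exists xv.
have nx := nrm_gt0 S x0; have nu := nrm_gt0 S u0.
have bx : 0 < mod (b x x) by apply: modulus_gt0; exact: b_neq0.
pose M := mod (b u x) * (3/2 * nrm u) + mod (b u u) * nrm x.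
exists (nrm u / (4 * nrm x)), (M * 2 / (mod (b x x) * nrm u)); split.
  by rewrite divr_gt0// mulr_gt0.
move=> t; rewrite ler_pdivlMr ?mulr_gt0// => td.
rewrite ler_pdivlMr ?mulr_gt0//.
have := b_support (u + t *: x) x.
rewrite bDl bZl (bDr (u + _)) !bZr !bDl !bZl xu mulr0 addr0 => H.
have h1 := modulus_dist S (s t * b x x) (- b u x).
have h2 : nrm u - mod t * nrm x <= nrm (u + t *: x).
  by have := nrm_dist S u (- (t *: x)); rewrite opprK nrmN nrmZ.
have h3 : nrm (u + t *: x) <= nrm u + mod t * nrm x.
  by rewrite -nrmZ; exact: nrmD.
have h4 : mod (b u u + t * (b u x + s t * b x x)) <=
   mod (b u u) + mod t * mod (b u x) + mod t * (mod (s t) * mod (b x x)).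
  rewrite -!modulusM mulrDr addrA.
  by apply: le_trans (modulusD _ _ _) _; rewrite lerD2r modulusD.
rewrite opprK modulusN modulusM [s t * _ + _]addrC in h1.
have sb := modulus_ge0 S (b u x); have ts := mulr_ge0 (modulus_ge0 S (s t)) (ltW bx).
move: H h1 h2 h3 h4 td ts sb.
set p := mod (b u x); set q := mod (s t) * _; set N := nrm (u + _); set m1 := mod (_ + _).
set m2 := mod (_ + _ * _); move=> H h1 h2 h3 h4 td ts sb.
rewrite mulrA -/q /M -/p.
have N0 : 0 <= N by exact: nrm_ge0.
have e1 : (q - p) * N <= m1 * N by rewrite ler_wpM2r.
have e2 : m2 * nrm x <= (mod (b u u) + mod t * p + mod t * q) * nrm x.
  by rewrite ler_wpM2r// ltW.
have e3 : q * (nrm u - mod t * nrm x) <= q * N by rewrite ler_wpM2l.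
have e4 : p * N <= p * (nrm u + mod t * nrm x) by rewrite ler_wpM2l.
have e5 : q * (mod t * nrm x * 4) <= q * nrm u by rewrite ler_wpM2l//; lra.
have e6 : p * (mod t * nrm x * 4) <= p * nrm u by rewrite ler_wpM2l//; lra.
move: H e1 e2 e3 e4 e5 e6; set mt := mod t; set nX := nrm x; set nU := nrm u.
set mm := mod (b u u); rewrite !mulrDl ?mulrDr; lra.
Qed.

Hypothesis sD : forall t a, s (t + a) = s t + s a.
Hypotheses (sM : forall t a, s (t * a) = s t * s a) (s1 : s 1 = 1).

Let b_comb x v t : b (x + t *: v) (x + t *: v) =
  b x x + t * b x v + s t * b v x + s t * t * b v v.
Proof. by rewrite bDl !bDr !bZr !bZl; ring. Qed.

(** Over the complex field a bilinear form on a plane has isotropic vectors, so the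
   semilinearity is not plain linearity. *)
Lemma semilinear_conj x v : indep2 x v -> forall t, s t = conj S t.
Proof.
move=> xv; have [d [C [d0 HC]]] := semilinear_bounded xv.
have [sid|//] := bounded_endomorphism d0 sD sM s1 HC.
have [x0 v0] := indep2_neq0 xv.
have [i0 t|sq] := scalar_sqrt S.
  by rewrite sid /conj i0 mul0r addr0 [LHS](scalarE S) i0 mul0r subr0.
exfalso; have bv := b_neq0 v0.
have [w ww] := sq ((b x v + b v x) ^+ 2 - 4 * b x x * b v v).
pose t := (w - (b x v + b v x)) / (2 * b v v).
have tE : b (x + t *: v) (x + t *: v) = 0.
  rewrite b_comb sid.
  have -> : b x x + t * b x v + t * b v x + t * t * b v v =
    (w * w - ((b x v + b v x) ^+ 2 - 4 * b x x * b v v)) / (4 * b v v).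
    by rewrite /t; field.
  by rewrite ww subrr mul0r.
have /b_neq0 : x + t *: v != 0.
  apply/eqP => E; have [|/eqP E1 _] := xv 1 t; first by rewrite scale1r.
  by rewrite oner_eq0 in E1.
by rewrite tE eqxx.
Qed.

Hypothesis s_conj : forall t, s t = conj S t.

Let b0l v : b 0 v = 0. Proof. by rewrite -(scale0r 0) bZl s_conj conj0 mul0r. Qed.

Let mod_s t : mod (s t) = mod t. Proof. by rewrite s_conj modulus_conj. Qed.

Let b_scale t x : mod (b (t *: x) (t *: x)) = mod t ^+ 2 * mod (b x x).
Proof. by rewrite bZl bZr !modulusM mod_s mulrA. Qed.

(** The support inequality at x + u, tested on x, and the one at u, tested on x: when x is
   short compared to u, b x x cannot exceed b u u. *)
Lemma form_small_perp x u : u != 0 -> b x u = 0 -> 4 * nrm x = nrm u ->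
  mod (b x x) <= mod (b u u).
Proof.
move=> u0 xu E; have nu := nrm_gt0 S u0.
have := b_support (x + u) x; rewrite (bDr (x + u)) !bDl xu add0r => H.
have h2 : nrm u - nrm x <= nrm (x + u).
  by have := nrm_dist S u (- x); rewrite opprK nrmN (addrC x).
have h1 := modulus_dist S (b x x) (- b u x); rewrite opprK modulusN in h1.
have h3 : mod (b u x) * 4 <= mod (b u u).
  have := b_support u x; rewrite -E mulrA (ler_pM2r _)//; lra.
have h4 := modulusD S (b x x + b u x) (b u u).
move: H h1 h2 h3 h4; have := modulus_ge0 S (b x x + b u x).
set a := mod (_ + _); set N := nrm (_ + _); set m := mod (_ + _ + _).
set q := mod (b x x); set p := mod (b u x); set r := mod (b u u) => a0 H h1 h2 h3 h4.
have e1 : a * (3 * nrm x) <= a * N by rewrite ler_wpM2l//; lra.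
have e2 : m * nrm x <= (a + r) * nrm x by rewrite ler_wpM2r//; lra.
have : 2 * a * nrm x <= r * nrm x by lra.
rewrite ler_pM2r; lra.
Qed.

Lemma form_perp_bound x u : u != 0 -> b x u = 0 ->
  mod (b x x) * nrm u ^+ 2 <= 16 * mod (b u u) * nrm x ^+ 2.
Proof.
move=> u0 xu; have nu := nrm_gt0 S u0.
have [->|x0] := eqVneq x 0; first by rewrite b0l modulus0 nrm0 expr0n mulr0 mul0r.
have nx := nrm_gt0 S x0; pose r := nrm u / (4 * nrm x).
have r0 : 0 <= r by rewrite divr_ge0// ltW// mulr_gt0.
have := @form_small_perp (emb S r *: x) u u0.
rewrite bZl xu mulr0 nrmZ modulus_emb ger0_norm// b_scale modulus_emb ger0_norm//.
have E : 4 * (r * nrm x) = nrm u by rewrite /r; field; rewrite gt_eqF.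
move=> /(_ erefl E) H; rewrite -E.
have -> : mod (b x x) * (4 * (r * nrm x)) ^+ 2 = 16 * nrm x ^+ 2 * (r ^+ 2 * mod (b x x)) by ring.
by rewrite [leRHS]mulrAC ler_wpM2l// mulr_ge0// sqr_ge0.
Qed.

(** Every x is b-orthogonal to some u = u1 + t u2 or t u1 + u2 with t of modulus at most 1,
   u1 and u2 being fixed; such u have bounded quadratic values and are bounded away from 0. *)
Lemma form_diag_bounded x0 v0 : indep2 x0 v0 ->
  exists2 C, 0 <= C & forall x, mod (b x x) <= C * nrm x ^+ 2.
Proof.
move=> xv; have [u1n _] := indep2_neq0 xv; have [u2 [u2n u12]] := form_perp_exists xv.
move: x0 u1n u12 {xv} => u1 u1n u12.
have n1 := nrm_gt0 S u1n; have n2 := nrm_gt0 S u2n.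
pose m := Num.min (nrm u1) (nrm u2 / 2).
have m0 : 0 < m by rewrite lt_min n1 divr_gt0.
pose M := mod (b u1 u1) + mod (b u1 u2) + mod (b u2 u1) + mod (b u2 u2).
have M0 : 0 <= M by rewrite /M !addr_ge0// modulus_ge0.
have far u (t1 t2 : K) : u = t1 *: u1 + t2 *: u2 -> mod t1 * nrm u1 <= nrm u.
  move=> uE; have := b_support u1 u.
  rewrite {1}uE bDr !bZr u12 mulr0 addr0 modulusM mulrAC mulrC ler_pM2l//.
  by apply: modulus_gt0; exact: b_neq0.
have small y z t : mod t <= 1 -> mod (b (y + t *: z) (y + t *: z)) <=
    mod (b y y) + mod (b y z) + mod (b z y) + mod (b z z).
  move=> t1; rewrite b_comb; apply: le_trans (modulusD _ _ _) _; apply: lerD; last first.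
    by rewrite !modulusM mod_s ler_piMl// ?modulus_ge0// mulr_ile1// modulus_ge0.
  apply: le_trans (modulusD _ _ _) _; apply: lerD; last first.
    by rewrite modulusM mod_s ler_piMl// modulus_ge0.
  apply: le_trans (modulusD _ _ _) _; apply: lerD; first exact: lexx.
  by rewrite modulusM ler_piMl// modulus_ge0.
exists (16 * M / m ^+ 2); first by rewrite divr_ge0 ?sqr_ge0// mulr_ge0.
move=> x; have [u [xu um uM]] : exists u, [/\ b x u = 0, m <= nrm u & mod (b u u) <= M].
  have [le|lt] := leP (mod (b x u1)) (mod (b x u2)).
    exists (u1 + (- (b x u1 / b x u2)) *: u2); split.
    - rewrite bDr bZr; have [E|N] := eqVneq (b x u2) 0.
        rewrite E mulr0 addr0; apply: (modulus_eq0 (S := S)); apply/eqP.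
        by rewrite eq_le modulus_ge0 andbT; move: le; rewrite E modulus0.
      by rewrite mulNr divfK// subrr.
    - have := far _ 1 (- (b x u1 / b x u2)) (erefl _).
      rewrite scale1r modulus1 mul1r; apply: le_trans.
      by rewrite /m ge_min lexx.
    - apply: le_trans (small _ _ _ _) _ => //.
      rewrite modulusN modulusM modulusV; have [->|N] := eqVneq (b x u2) 0.
        by rewrite modulus0 invr0 mulr0.
      by rewrite ler_pdivrMr ?modulus_gt0// mul1r.
  have p0 : b x u1 != 0 by apply/eqP => E; move: lt; rewrite E modulus0 ltNge modulus_ge0.
  pose t := - (b x u2 / b x u1); exists (u2 + t *: u1).
  have t1 : mod t <= 1.
    by rewrite modulusN modulusM modulusV ler_pdivrMr ?modulus_gt0// mul1r ltW.
  split.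
  - by rewrite bDr bZr mulNr divfK// subrr.
  - have h : mod t * nrm u1 <= nrm (u2 + t *: u1).
      by apply: (far _ t 1); rewrite scale1r addrC.
    have h2 := nrm_dist S u2 (- (t *: u1)); rewrite opprK nrmN nrmZ in h2.
    by rewrite /m ge_min; apply/orP; right; move: h h2; lra.
  - by apply: le_trans (small _ _ _ t1) _; rewrite /M; lra.
have u0 : u != 0.
  by apply/eqP => E; move: um; rewrite E nrm0 leNgt m0.
have H := form_perp_bound u0 xu.
rewrite mulrAC ler_pdivlMr ?exprn_gt0//; apply: (@le_trans _ _ (mod (b x x) * nrm u ^+ 2)).
  by rewrite ler_wpM2l ?modulus_ge0// lerXn2r// nnegrE ltW// (lt_le_trans m0).
by apply: le_trans H _; rewrite ler_wpM2r ?sqr_ge0// ler_wpM2l.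
Qed.

Lemma form_bounded x0 v0 : indep2 x0 v0 ->
  exists2 C, 0 <= C & forall x v, mod (b x v) <= C * nrm x * nrm v.
Proof.
move=> /form_diag_bounded[C C0 HC]; exists C => // x v.
have [->|xn] := eqVneq x 0; first by rewrite b0l modulus0 nrm0 mulr0 mul0r.
have nx := nrm_gt0 S xn; rewrite -(ler_pM2r nx); apply: le_trans (b_support x v) _.
have -> : C * nrm x * nrm v * nrm x = C * nrm x ^+ 2 * nrm v by ring.
by rewrite ler_wpM2r ?nrm_ge0.
Qed.

End SupportForm.

(** * Hermitian symmetry of support forms *)

Definition hermitian_norm (R : realType) (K : numFieldType) (S : scalars R K)
    (X : normedModType K) := exists B : X -> X -> K,
  [/\ forall a x y z, B (a *: x + y) z = a * B x z + B y z,
      forall x y, B x y = conj S (B y x) & forall x, B x x = emb S (nrm S x ^+ 2)].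

Section SupportHermitian.
Variables (R : realType) (K : numFieldType) (S : scalars R K) (X : normedModType K).
Local Notation nrm := (nrm S).
Variable B : X -> X -> K.
Hypothesis B_lin : forall a x y z, B (a *: x + y) z = a * B x z + B y z.
Hypothesis B_herm : forall x y, B x y = conj S (B y x).
Hypothesis B_support : forall v x, modulus S (B v x) * nrm x <= modulus S (B x x) * nrm v.

Let B0 z : B 0 z = 0. Proof. exact: B0l B_lin z. Qed.

Let B_self x : B x x = emb S (re S (B x x)). Proof. by apply: conj_fixed; rewrite -B_herm. Qed.

Lemma hermitian_norm_of_support : (forall x, x != 0 -> 0 < re S (B x x)) -> hermitian_norm S X.
Proof.
move=> B_pos; have [|k kE] := norm_of_form B_lin B_herm B_pos.
  move=> v x; have [->|x0] := eqVneq x 0.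
    by rewrite nrm0 mulr0 B0 re0 mul0r.
  by apply: le_trans (B_support v x) _; rewrite B_self modulus_emb gtr0_norm ?B_pos// re_emb.
exists (fun x y => emb S k * B x y); split=> [a x y z|x y|x].
- by rewrite B_lin; ring.
- by rewrite conjM conj_emb -B_herm.
- by rewrite B_self -rmorphM -kE.
Qed.

(** Were B indefinite, a combination of orthogonal vectors of opposite sign would be
   isotropic. *)
Lemma anisotropic_positive x0 : (forall x, x != 0 -> B x x != 0) -> B x0 x0 = 1 ->
  forall x, x != 0 -> 0 < re S (B x x).
Proof.
move=> aniso Bx0 x xn; rewrite ltNge; apply/negP => q0.
pose y := (- B x x0) *: x0 + x.
have yx0 : B y x0 = 0 by rewrite B_lin Bx0 mulr1 addNr.
have x0y : B x0 y = 0 by rewrite B_herm yx0 conj0.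
have Br u a v w : B u (a *: v + w) = conj S a * B u v + B u w.
  by rewrite B_herm B_lin conjD conjM -!B_herm.
have yy : re S (B y y) <= 0.
  have -> : B y y = B x x - B x x0 * conj S (B x x0).
    by rewrite {1}/y B_lin x0y mulr0 add0r /y Br conjN; ring.
  rewrite mul_conj reB re_emb.
  by have := sqr_ge0 (modulus S (B x x0)); move: q0; lra.
pose r := Num.sqrt (- re S (B y y)).
have rr : r ^+ 2 = - re S (B y y) by rewrite sqr_sqrtr// oppr_ge0.
pose w := emb S r *: x0 + y.
have wx0 : B w x0 = emb S r by rewrite B_lin Bx0 mulr1 yx0 addr0.
have wy : B w y = B y y by rewrite B_lin x0y mulr0 add0r.
have ww : B w w = 0.
  by rewrite {2}/w Br wx0 wy conj_emb -rmorphM B_self -rmorphD -expr2 rr addNr rmorph0.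
have w0 : w = 0 by apply/eqP; apply: contrapT => /negP /aniso; rewrite ww eqxx.
have r0 : emb S r = 0 by rewrite -wx0 w0 B0.
have y0 : y = 0 by rewrite -w0 /w r0 scale0r add0r.
have xE : x = B x x0 *: x0.
  by apply/eqP; rewrite -subr_eq0 -scaleNr addrC -/y y0.
move: q0; have -> : B x x = emb S (modulus S (B x x0) ^+ 2).
  by rewrite {1}xE -[_ *: _]addr0 B_lin B0 addr0 (B_herm x0 x) mul_conj.
have c0 : B x x0 != 0 by apply/eqP => E; move: xn; rewrite xE E scale0r eqxx.
by rewrite re_emb leNgt exprn_gt0//; exact: modulus_gt0.
Qed.

End SupportHermitian.

(** A semilinear map preserving every line through 0 is a homothety, relative to A. *)
Lemma proportional_const (R : realType) (K : numFieldType) (S : scalars R K)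
    (V W : lmodType K) (A G : V -> W) :
  (forall x y, A (x + y) = A x + A y) -> (forall t x, A (t *: x) = conj S t *: A x) ->
  (forall x y, G (x + y) = G x + G y) -> (forall t x, G (t *: x) = conj S t *: G x) ->
  (forall x, A x = 0 -> x = 0) -> (forall x, x != 0 -> exists c, G x = c *: A x) ->
  exists c, forall x, G x = c *: A x.
Proof.
move=> AD AZ GD GZ A0 H.
have G0 : G 0 = 0 by rewrite -(scale0r 0) GZ conj0 scale0r.
have Az : A 0 = 0 by rewrite -(scale0r 0) AZ conj0 scale0r.
have [X0|] := pselect (exists x : V, x != 0); last first.
  move=> X0; exists 0 => x; have -> : x = 0; last by rewrite G0 Az scaler0.
  by apply/eqP; apply: contrapT => /negP xn; apply: X0; exists x.
have [x x0] := X0; have [c cE] := H x x0; exists c => y.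
have [[a ->]|N] := pselect (exists a, y = a *: x).
  by rewrite GZ AZ cE !scalerA mulrC.
have xy : indep2 x y by apply: indep2P => // a; apply/eqP => E; apply: N; exists a.
have Ai : indep2 (A x) (A y).
  move=> a b E; have := A0 (conj S a *: x + conj S b *: y).
  rewrite AD !AZ !conjK => /(_ E)/xy[a0 b0].
  by rewrite -(conjK S a) -(conjK S b) a0 b0 conj0.
have [_ y0] := indep2_neq0 xy.
have [c' c'E] := H y y0; have [|d dE] := H (x + y).
  apply/eqP => E; have [|/eqP] := xy 1 1; first by rewrite !scale1r.
  by rewrite oner_eq0.
have [E1 E2] : c = d /\ c' = d.
  by apply: (indep2_eq Ai); rewrite -cE -c'E -GD dE AD scalerDr.
by rewrite c'E E2 -E1.
Qed.

Section HermitianSupport.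
Variables (R : realType) (K : numFieldType) (S : scalars R K) (X : normedModType K).
Local Notation functional := (functional X).
Local Notation nrm := (nrm S).
Local Notation mod := (modulus S).
Local Notation inv := (@asymptotically_invariant R K S X).
Implicit Types (x y z u v w : X) (t : K).
Variables (A : X -> functional) (x0 v0 : X).
Hypothesis A_add : forall x y, A (x + y) = A x + A y.
Hypothesis A_conj : forall t x, A (t *: x) = conj S t *: A x.
Hypothesis A_neq0 : forall x, x != 0 -> A x x != 0.
Hypothesis A_support : forall x v, mod (A x v) * nrm x <= mod (A x x) * nrm v.
Hypothesis A_inv : forall x, x != 0 -> inv [:: x] (A x).
Hypothesis A_unique : forall x f, x != 0 -> inv [:: x] f -> exists c, f = c *: A x.
Hypothesis x0v0 : indep2 x0 v0.

Let ADl x y v : A (x + y) v = A x v + A y v. Proof. by rewrite A_add functionalD. Qed.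
Let AZl t x v : A (t *: x) v = conj S t * A x v. Proof. by rewrite A_conj functionalZ. Qed.
Let ADr x v w : A x (v + w) = A x v + A x w. Proof. exact: funD. Qed.
Let AZr t x v : A x (t *: v) = t * A x v. Proof. exact: funZ. Qed.

Let ABl x y v : A (x - y) v = A x v - A y v.
Proof. by rewrite ADl -scaleN1r AZl conjN conj1 mulN1r. Qed.

Let A_bounded : exists2 C, 0 <= C & forall x v, mod (A x v) <= C * nrm x * nrm v.
Proof.
exact: (form_bounded (b := fun x v => A x v) ADl AZl ADr AZr A_neq0 A_support (fun=> erefl) x0v0).
Qed.

Let A_eq0 x : A x = 0 -> x = 0.
Proof.
move=> E; apply/eqP; apply: contrapT => /negP /A_neq0.
by rewrite E functional0 eqxx.
Qed.

(** The functional A (T x) o T is as invariant as A x, so it is a multiple of A x. *)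
Lemma isometry_factor T : Isom T -> exists c, forall x y, A (T x) (T y) = c * A x y.
Proof.
move=> iT; have [C C0 HC] := A_bounded.
have [G GE] : exists G : X -> functional, forall x y, G x y = A (T x) (T y).
  have /choice[G HG] : forall x, exists g : functional, forall y, g y = A (T x) (T y).
    move=> x; apply: (@bounded_functional R K S X _ (C * nrm (T x))).
      by move=> a y z; rewrite linearP fun_linear.
    by move=> y; apply: le_trans (HC _ _) _; rewrite (Isom_nrm S y iT).
  by exists G.
have [| | |c cE] := @proportional_const R K S X _ A G A_add A_conj _ _ A_eq0.
- by move=> x y; apply: functionalP => z; rewrite functionalD !GE linearD ADl.
- by move=> t x; apply: functionalP => z; rewrite functionalZ !GE linearZ AZl.
- move=> x xn; apply: A_unique => //.
  apply: (inv_conjugate iT (f := A (T x))) => //; apply: A_inv.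
  by apply/eqP => E; move: (nrm_gt0 S xn); rewrite -(Isom_nrm S x iT) E nrm0 ltxx.
by exists c => x y; rewrite -GE cE functionalZ.
Qed.

(** Isometries that almost fix x have a factor close to 1. Hence y |-> conj (A y x) is
   asymptotically invariant, and must be a multiple of A x. *)
Lemma form_conjugate : exists c, forall x y, conj S (A y x) = c * A x y.
Proof.
have [C C0 HC] := A_bounded.
have [G GE] : exists G : X -> functional, forall x y, G x y = conj S (A y x).
  have /choice[G HG] : forall x, exists g : functional, forall y, g y = conj S (A y x).
    move=> x; apply: (@bounded_functional R K S X _ (C * nrm x)).
      by move=> a y z; rewrite ADl AZl conjD conjM conjK.
    by move=> y; rewrite modulus_conj mulrAC; exact: HC.
  by exists G.
have [| | |c cE] := @proportional_const R K S X _ A G A_add A_conj _ _ A_eq0.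
- by move=> x y; apply: functionalP => z; rewrite functionalD !GE ADr conjD.
- by move=> t x; apply: functionalP => z; rewrite functionalZ !GE AZr conjM.
- move=> x xn; apply: A_unique => // y e e0.
  have q0 : 0 < mod (A x x) by apply: modulus_gt0; exact: A_neq0.
  pose M := C * nrm y + 2 * C * nrm x / mod (A x x) * mod (A y x) + 1.
  have nx := nrm_ge0 S x; have ny := nrm_ge0 S y.
  have M0 : 0 < M.
    by rewrite ltr_wpDl// addr_ge0// ?mulr_ge0// ?invr_ge0 ?modulus_ge0.
  apply: filterS (filterI (fixing_filter_Isom S [:: x])
    (fixing_filter_near S (mem_head x [::]) (divr_gt0 e0 M0))) => T [iT /=].
  rewrite ler_pdivlMr// => Te.
  have [c cE] := isometry_factor iT.
  have c1 : mod (c - 1) * mod (A x x) <= 2 * C * nrm x * nrm (T x - x).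
    rewrite -modulusM.
    have -> : (c - 1) * A x x = A (T x - x) (T x) + A x (T x - x).
      by rewrite mulrBl mul1r -cE ABl funB; ring.
    apply: le_trans (modulusD _ _ _) _; have := HC (T x - x) (T x); have := HC x (T x - x).
    rewrite (Isom_nrm S x iT); move: (mod (A x _)) (mod (A _ (T x))) => p q; lra.
  have -> : G x (T y) - G x y = conj S (A (T y) (x - T x) + (c - 1) * A y x).
    by rewrite !GE -conjB mulrBl mul1r -cE funB; congr conj; ring.
  rewrite modulus_conj; apply: le_trans (modulusD _ _ _) _; rewrite modulusM.
  have h1 := HC (T y) (x - T x); rewrite (Isom_nrm S y iT) nrm_distC in h1.
  have h2 : mod (c - 1) * mod (A y x) <=
     2 * C * nrm x * nrm (T x - x) / mod (A x x) * mod (A y x).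
    by rewrite ler_wpM2r ?modulus_ge0// ler_pdivlMr.
  apply: le_trans (lerD h1 h2) _; apply: le_trans Te.
  have -> : C * nrm y * nrm (T x - x) +
      2 * C * nrm x * nrm (T x - x) / mod (A x x) * mod (A y x) = nrm (T x - x) * (M - 1).
    by rewrite /M; ring.
  by rewrite mulrBr mulr1 gerBl nrm_ge0.
by exists c => x y; rewrite -GE cE functionalZ.
Qed.

Theorem hermitian_support_norm : hermitian_norm S X.
Proof.
have [c cE] := form_conjugate; have [xn _] := indep2_neq0 x0v0.
have q0 := A_neq0 xn; pose q := A x0 x0.
pose B v x := A x v / q.
have qc : conj S q = c * q by exact: cE.
have c0 : c != 0.
  by apply/eqP => E; move: qc; rewrite E mul0r => /conj_eq0 /eqP; rewrite (negbTE q0).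
have Bl a x y z : B (a *: x + y) z = a * B x z + B y z.
  by rewrite /B ADr AZr mulrDl mulrA.
have Bh x y : B x y = conj S (B y x).
  have qV : conj S q^-1 = (c * q)^-1.
    apply: (mulfI (x := c * q)); first by rewrite mulf_neq0.
    by rewrite -{1}qc -conjM !mulfV ?mulf_neq0// conj1.
  rewrite /B conjM qV cE invfM; field; by rewrite q0 c0.
have Bs v x : mod (B v x) * nrm x <= mod (B x x) * nrm v.
  rewrite /B !modulusM mulrAC [leRHS]mulrAC ler_wpM2r ?modulus_ge0//; exact: A_support.
apply: (hermitian_norm_of_support Bl Bh Bs).
apply: (anisotropic_positive Bl Bh (x0 := x0)); last by rewrite /B mulfV.
by move=> x /A_neq0 Ax; rewrite mulf_neq0// invr_eq0.
Qed.

End HermitianSupport.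

(** * Dimension at least three *)

Section DimensionThree.
Variables (R : realType) (K : numFieldType) (S : scalars R K) (X : normedModType K).
Local Notation functional := (functional X).
Local Notation nrm := (nrm S).
Local Notation mod := (modulus S).
Local Notation fixed := (@asymptotically_fixed R K S X).
Implicit Types (x y z : X).
Hypotheses (sepX : separable_space X) (reflX : reflexive_space X).
Hypothesis fixed_plane : forall y z x, indep2 y z -> fixed [:: y; z] x ->
  exists a b, x = a *: y + b *: z.
Hypothesis dim3 : forall y z, exists x, forall a b, x != a *: y + b *: z.

(** A line is the intersection of two planes. *)
Lemma fixed_line_of_plane y x : y != 0 -> fixed [:: y] x -> exists a, x = a *: y.
Proof.
move=> y0 yx; have [z zN] := dim3 y y.
have yz : indep2 y z.
  by apply: indep2P => // a; have := zN a 0; rewrite scale0r addr0.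
have [w wN] := dim3 y z; have yzw := indep3P yz wN.
have plane v : indep2 y v -> exists a b, x = a *: y + b *: v.
  move=> yv; apply: fixed_plane => //; apply: fixed_sub yx => u.
  by rewrite inE => /eqP ->; apply: fixed_mem; exact: mem_head.
have [a [b xE]] := plane z yz; have [c [d xE']] := plane w (indep3_13 yzw).
have [_ b0 _] : [/\ a = c, b = 0 & 0 = d].
  by apply: (indep3_eq yzw); rewrite !scale0r !addr0 -xE -xE'.
by exists a; rewrite xE b0 scale0r addr0.
Qed.

(** The support functionals given by support_map define a collineation, hence a semilinear
   map; rescaling a support functional does not affect the support inequality. *)
Theorem hermitian_norm_dim3 : hermitian_norm S X.
Proof.
have fixed_line := fixed_line_of_plane.
have [F [F_inv F_unit F_norm]] := support_map S sepX reflX.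
have F_line y a : y != 0 -> exists c, F (a *: y) = c *: F y.
  by move=> y0; apply: (inv_line_scale sepX reflX fixed_line F_inv F_norm).
have F_plane y z a1 b1 a2 b2 a3 b3 c1 c2 c3 f : indep2 y z ->
    f = c1 *: F (a1 *: y + b1 *: z) + c2 *: F (a2 *: y + b2 *: z) +
      c3 *: F (a3 *: y + b3 *: z) -> f y = 0 -> f z = 0 -> f = 0.
  by move=> yz; apply: (inv_plane sepX reflX F_inv) => x; exact: fixed_plane.
have F0 y : y != 0 -> F y != 0.
  move=> y0; apply/eqP => E; have := F_neq0 F_norm y0.
  by rewrite E functional0 eqxx.
have F_in := F_inj F_unit F_norm F_line F_plane dim3.
have F_i2 y z : indep2 y z -> indep2 (F y) (F z).
  move=> yz; have [y0 _] := indep2_neq0 yz.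
  by apply: indep2P (F0 y y0) _ => a; apply/eqP; exact: F_in.
have F_sp y z a b : indep2 y z -> exists u v, F (a *: y + b *: z) = u *: F y + v *: F z.
  by move=> yz; apply: F_span (F_in y z yz).
have F_i3 := F_indep F_unit F_norm F_line F_plane dim3.
have [x0 x0N] := dim3 0 0.
have xn : x0 != 0 by have := x0N 0 0; rewrite !scaler0 addr0.
have [v0 v0N] := dim3 x0 x0.
have xv : indep2 x0 v0.
  by apply: indep2P => // a; have := v0N a 0; rewrite scale0r addr0.
have Fx0 := F_neq0 F_norm xn.
have hl a x y : F x0 (a *: x + y) / F x0 x0 = a * (F x0 x / F x0 x0) + F x0 y / F x0 x0.
  by rewrite fun_linear mulrDl mulrA.
have [A [s [AD AZ AF [sD sM s1]]]] :=
  projective_semilinear F0 F_line F_sp F_i2 F_i3 dim3 hl (mulfV Fx0).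
have AF' x : x != 0 -> exists2 c, c != 0 & F x = c *: A x.
  move=> x_neq0; have [c cE] := AF x x_neq0; exists c => //.
  by apply/eqP => E; move: (F0 x x_neq0); rewrite cE E scale0r eqxx.
have A_neq0 x : x != 0 -> A x x != 0.
  move=> x_neq0; have [c c0 cE] := AF' x x_neq0; have := F_neq0 F_norm x_neq0.
  by rewrite cE functionalZ mulf_eq0 negb_or => /andP[].
have A_supp x v : mod (A x v) * nrm x <= mod (A x x) * nrm v.
  have [->|x_neq0] := eqVneq x 0.
    by rewrite nrm0 mulr0 mulr_ge0 ?modulus_ge0 ?nrm_ge0.
  have [c c0 cE] := AF' x x_neq0.
  rewrite -(ler_pM2l (modulus_gt0 S c0)) !mulrA -!modulusM -!functionalZ -cE.
  rewrite F_norm modulus_emb ger0_norm ?nrm_ge0// mulrC ler_wpM2l ?nrm_ge0//.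
  exact: F_unit.
have bD x y v : A (x + y) v = A x v + A y v by rewrite AD functionalD.
have bZ t x v : A (t *: x) v = s t * A x v by rewrite AZ functionalZ.
have sc := semilinear_conj (b := fun x v => A x v) bD bZ (fun x => funD (A x))
  (fun t x => funZ (A x) t) A_neq0 A_supp sD sM s1 xv.
have AC t x : A (t *: x) = conj S t *: A x by rewrite AZ sc.
apply: (hermitian_support_norm AD AC A_neq0 A_supp _ _ xv).
  move=> x x_neq0; have [c c0 cE] := AF' x x_neq0.
  have -> : A x = c^-1 *: F x by rewrite cE scalerA mulVf// scale1r.
  exact/invZ/F_inv.
move=> x f x_neq0 fi; have [c c0 cE] := AF' x x_neq0.
have [d ->] := inv_line sepX reflX fixed_line F_inv F_norm x_neq0 fi.
by exists (d * c); rewrite cE scalerA.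
Qed.

End DimensionThree.

(** * Quadratic minorants of the norm with maximal determinant *)

Section MaximalForm.
Variables (R : realType) (K : numFieldType) (S : scalars R K) (X : normedModType K).
Local Notation nrm := (nrm S).
Local Notation mod := (modulus S).
Local Notation re := (re S).
Implicit Types (x y z v w : X) (B : X -> X -> K).

Definition hermitian_form B :=
  (forall a x y z, B (a *: x + y) z = a * B x z + B y z) /\
  (forall x y, B x y = conj S (B y x)).

(** The ellipsoid of B contains the unit ball. *)
Definition minorant B := hermitian_form B /\ forall x, 0 <= quad S B x <= nrm x ^+ 2.

(** Positivity at B x x *: v - B v x *: x. When both diagonal values vanish, positivity at
   v - B v x *: x is used instead. *)
Lemma cauchy_schwarz B v x : hermitian_form B -> (forall x, 0 <= quad S B x) ->
  mod (B v x) ^+ 2 <= quad S B v * quad S B x.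
Proof.
move=> [Bl Bh] Bp.
have key u y : 0 < quad S B y -> mod (B u y) ^+ 2 <= quad S B u * quad S B y.
  move=> y0; pose w := emb S (quad S B y) *: u + (- B u y) *: y.
  have := Bp w; have -> : quad S B w =
      quad S B y * (quad S B u * quad S B y - mod (B u y) ^+ 2).
    rewrite /quad -[RHS](re_emb S); congr (re _).
    rewrite rmorphM rmorphB /= -mul_conj rmorphM /= -!(B_quad Bh).
    rewrite /w Bl (BZl Bl) !(BDr Bl Bh) !(BZr Bl Bh) conj_emb conjN.
    rewrite -(B_quad Bh y) (Bh y u); ring.
  by rewrite pmulr_rge0// subr_ge0.
have [x0|x0] := ltrP 0 (quad S B x); first exact: key.
have [v0|v0] := ltrP 0 (quad S B v).
  by rewrite Bh modulus_conj mulrC; exact: key.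
have {}x0 : quad S B x = 0 by apply/eqP; rewrite eq_le x0 Bp.
have {}v0 : quad S B v = 0 by apply/eqP; rewrite eq_le v0 Bp.
have := Bp (v + (- B v x) *: x); rewrite /quad (BDl Bl) (BZl Bl) !(BDr Bl Bh) !(BZr Bl Bh).
rewrite !(B_quad Bh) x0 v0 !rmorph0 mulr0 addr0 add0r conjN (Bh x v) !mulNr.
rewrite [conj _ _ * _]mulrC mul_conj reB reN re_emb re0 mulr0.
by have := sqr_ge0 (mod (B v x)); lra.
Qed.

Lemma minorant_bound B v w : minorant B -> mod (B v w) <= nrm v * nrm w.
Proof.
move=> [hB qB]; have n0 := mulr_ge0 (nrm_ge0 S v) (nrm_ge0 S w).
rewrite -(@ler_pXn2r _ 2)// ?nnegrE ?modulus_ge0//.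
apply: le_trans (cauchy_schwarz _ _ hB _) _; first by move=> x; have /andP[] := qB x.
have /andP[v0 v1] := qB v; have /andP[w0 w1] := qB w.
by rewrite exprMn ler_pM.
Qed.

Definition gram B x y := re (B x x) * re (B y y) - mod (B x y) ^+ 2.

(** Among the Hermitian forms below the square of the norm, one has the largest Gram determinant:
   an ultrafilter of nearly maximal forms converges pointwise. *)
Lemma gram_max e1 e2 : exists B, minorant B /\
  forall B', minorant B' -> gram B' e1 e2 <= gram B e1 e2.
Proof.
pose G := [set gram B e1 e2 | B in [set B | minorant B]].
have i0 : minorant (fun _ _ => 0).
  split; first by split=> *; rewrite ?conj0// mulr0 addr0.
  by move=> x; rewrite /quad re0 lexx sqr_ge0.
have G0 : G !=set0 by exists (gram (fun _ _ => 0) e1 e2); exists (fun _ _ => 0).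
have Gu : has_ubound G.
  exists (nrm e1 * nrm e1 * (nrm e2 * nrm e2)) => _ [B iB <-].
  have h := sqr_ge0 (mod (B e1 e2)); have [_ qB] := iB.
  have /andP[a0 a1] := qB e1; have /andP[b0 b1] := qB e2.
  by rewrite /gram lerBlDr; apply: ler_wpDr => //; rewrite -!expr2 ler_pM.
pose near e := [set B | minorant B /\ sup G - e < gram B e1 e2].
pose F := filter_from [set e : R | 0 < e] near.
have FF : ProperFilter F.
  apply: filter_from_proper; last first.
    move=> e e0; have [_ [B iB <-] Be] := sup_adherent e0 (Logic.conj G0 Gu).
    by exists B.
  apply: filter_from_filter; first by exists 1 => /=.
  move=> i j i0' j0; exists (Num.min i j); first by rewrite /= lt_min i0' j0.
  by move=> B [iB]; rewrite ltrBlDr => H; split; split=> //; rewrite ltrBlDr;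
    apply: lt_le_trans H _; rewrite lerD2l ge_min lexx ?orbT.
have [U [UU FU]] := ultraFilterLemma FF.
have Ui : U [set B | minorant B].
  by apply: FU; exists 1 => //= B [].
have lim_ex (p : X * X) : exists z : K, (fun B => B p.1 p.2) @ U --> (z : K^o).
  apply: (ultra_bounded_cvg_scalar (S := S) UU (M := nrm p.1 * nrm p.2)).
  by apply: filterS Ui => B /= iB; exact: minorant_bound.
have [L HL] := choice lim_ex; pose B v w := L (v, w).
have BL v w : (fun B => B v w) @ U --> (B v w : K^o) by exact: (HL (v, w)).
have FU' : ProperFilter U by case: UU.
have hB : hermitian_form B.
  split=> [a x y z|x y].
    have c1 : (fun B => a * B x z + B y z) @ U --> (a * B x z + B y z : K^o).
      by apply: cvgD; [apply: cvgZl_tmp|]; exact: BL.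
    apply: (@cvg_unique K^o _ ((fun B => B (a *: x + y) z) @ U)) => //; first exact: BL.
    apply: cvg_trans c1; apply: near_eq_cvg; apply: filterS Ui => B' [[Bl _] _].
    by rewrite /= Bl.
  apply: (@cvg_unique K^o _ ((fun B => B x y) @ U)) => //; first exact: BL.
  apply/(scalar_cvgP S UU) => e e0.
  have /(scalar_cvgP S UU)/(_ e e0) H := BL y x.
  apply: filterS (filterI H Ui) => B' [/= Be [[_ Bh] _]].
  by rewrite Bh -conjB modulus_conj.
have quad_cvg x y : (fun B => re (B x y)) @ U --> re (B x y).
  by apply: re_cvg => //; exact: BL.
have im_cvg x y : (fun B => im S (B x y)) @ U --> im S (B x y).
  by apply: re_cvg => //; apply: cvgZl_tmp; exact: BL.
have gram_cvg : (fun B => gram B e1 e2) @ U --> gram B e1 e2.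
  rewrite /gram modulus2; under eq_fun do rewrite modulus2.
  by apply: cvgB; [apply: cvgM|apply: cvgD; apply: cvgM].
have iB : minorant B.
  split=> // x; apply/andP; split.
    apply: (cvgr_to_ge (quad_cvg x x)).
    by apply: filterS Ui => B' [_ /(_ x)/andP[]].
  apply: (cvgr_to_le (quad_cvg x x)).
  by apply: filterS Ui => B' [_ /(_ x)/andP[]].
exists B; split=> // B' iB'; apply: (@le_trans _ _ (sup G)).
  by apply: ub_le_sup => //; exists B'.
apply/ler_addgt0Pr => e e0.
have e2' : 0 < e / 2 by rewrite divr_gt0.
have /cvgrPdist_lt/(_ _ e2') H := gram_cvg.
have : U (near (e / 2)) by apply: FU; exists (e / 2).
move=> /(filterI H)/filter_ex[C [/= C1 [_ C2]]].
move: C1 C2; rewrite ltr_norml => /andP[]; lra.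
Qed.

End MaximalForm.

(** * Dimension two *)

Section Gram.
Variables (R : realType) (K : numFieldType) (S : scalars R K) (X : normedModType K).
Local Notation mod := (modulus S).
Local Notation re := (re S).
Local Notation gram := (gram S).
Implicit Types (x y v w : X) (B : X -> X -> K).

Lemma emb_gram B x y : hermitian_form S B ->
  emb S (gram B x y) = B x x * B y y - B x y * B y x.
Proof.
move=> [_ Bh]; rewrite /gram rmorphB rmorphM -mul_conj /= -Bh.
by rewrite -!(B_quad Bh).
Qed.

Lemma gram_comb B x y p q r t : hermitian_form S B ->
  gram B (p *: x + q *: y) (r *: x + t *: y) = mod (p * t - q * r) ^+ 2 * gram B x y.
Proof.
move=> hB; have [Bl Bh] := hB; apply: (emb_inj (S := S)).
rewrite rmorphM -mul_conj !emb_gram// !Bl !(BZl Bl) !(BDr Bl Bh) !(BZr Bl Bh).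
by rewrite conjB !conjM; ring.
Qed.

Lemma form_ext B B' x y : hermitian_form S B -> hermitian_form S B' ->
  B x x = B' x x -> B x y = B' x y -> B y y = B' y y ->
  forall p q r t, B (p *: x + q *: y) (r *: x + t *: y) = B' (p *: x + q *: y) (r *: x + t *: y).
Proof.
move=> [Bl Bh] [Bl' Bh'] xx xy yy p q r t; have yx : B y x = B' y x by rewrite Bh Bh' xy.
rewrite !(Bl, Bl') !(BZl Bl, BZl Bl') !(BDr Bl Bh, BDr Bl' Bh') !(BZr Bl Bh, BZr Bl' Bh').
by rewrite xx xy yy yx.
Qed.

(** The determinant is strictly log-concave on positive Hermitian 2 x 2 matrices. *)
Lemma gram_unique (a c a' c' b1 b2 b1' b2' D : R) : 0 <= a -> 0 <= a' -> 0 < D ->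
  a * c - (b1 ^+ 2 + b2 ^+ 2) = D -> a' * c' - (b1' ^+ 2 + b2' ^+ 2) = D ->
  (a + a') * (c + c') - ((b1 + b1') ^+ 2 + (b2 + b2') ^+ 2) <= 4 * D ->
  [/\ a = a', c = c', b1 = b1' & b2 = b2'].
Proof.
move=> a0 a0' D0 E E' H.
have pos (r s t u : R) : 0 <= r -> r * s - (t ^+ 2 + u ^+ 2) = D -> 0 < r.
  move=> r0 Er; rewrite lt_neqAle r0 andbT eq_sym; apply/eqP => r00; move: Er.
  by rewrite r00 mul0r; have := sqr_ge0 t; have := sqr_ge0 u; lra.
have {}a0 := pos _ _ _ _ a0 E; have {}a0' := pos _ _ _ _ a0' E'.
pose P := D * (a - a') ^+ 2.
pose Q1 := (a * b1' - a' * b1) ^+ 2; pose Q2 := (a * b2' - a' * b2) ^+ 2.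
have P0 : 0 <= P by rewrite mulr_ge0 ?sqr_ge0// ltW.
have Q10 : 0 <= Q1 := sqr_ge0 _; have Q20 : 0 <= Q2 := sqr_ge0 _.
have cE : c = (D + (b1 ^+ 2 + b2 ^+ 2)) / a by rewrite -E; field; rewrite gt_eqF.
have cE' : c' = (D + (b1' ^+ 2 + b2' ^+ 2)) / a' by rewrite -E'; field; rewrite gt_eqF.
have : a * a' * ((a + a') * (c + c') - ((b1 + b1') ^+ 2 + (b2 + b2') ^+ 2) - 4 * D) =
   P + Q1 + Q2.
  by rewrite /P /Q1 /Q2 cE cE'; field; rewrite !gt_eqF.
have : a * a' * ((a + a') * (c + c') - ((b1 + b1') ^+ 2 + (b2 + b2') ^+ 2) - 4 * D) <= 0.
  by apply: mulr_ge0_le0; [rewrite ltW// mulr_gt0|rewrite subr_le0].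
move=> le0 eq0; rewrite eq0 in le0.
have Pz : P = 0 by lra.
have Q1z : Q1 = 0 by lra.
have Q2z : Q2 = 0 by lra.
have aE : a = a'.
  apply/eqP; rewrite -subr_eq0; move/eqP: Pz.
  by rewrite mulf_eq0 gt_eqF//= sqrf_eq0.
have bE (d d' : R) : (a * d' - a' * d) ^+ 2 = 0 -> d = d'.
  move/eqP; rewrite sqrf_eq0 -aE -mulrBr mulf_eq0 gt_eqF//= subr_eq0.
  by move/eqP.
have b1E := bE _ _ Q1z; have b2E := bE _ _ Q2z; split=> //.
by rewrite cE cE' aE b1E b2E.
Qed.

End Gram.

Section DimensionTwo.
Variables (R : realType) (K : numFieldType) (S : scalars R K) (X : normedModType K).
Local Notation functional := (functional X).
Local Notation nrm := (nrm S).
Local Notation mod := (modulus S).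
Local Notation re := (re S).
Local Notation gram := (gram S).
Local Notation fixed := (@asymptotically_fixed R K S X).
Local Notation inv := (@asymptotically_invariant R K S X).
Implicit Types (x y z u v w : X).

Lemma minorant_Isom B T : Isom T -> minorant S B -> minorant S (fun v w => B (T v) (T w)).
Proof.
move=> iT [[Bl Bh] qB]; split; first by split=> [a x y z|x y]; rewrite ?linearP.
by move=> x; rewrite -(Isom_nrm S x iT); exact: qB.
Qed.

Lemma minorant_mean B B' : minorant S B -> minorant S B' ->
  minorant S (fun v w => emb S (1 / 2) * (B v w + B' v w)).
Proof.
move=> [[Bl Bh] qB] [[Bl' Bh'] qB']; split; first split=> [a x y z|x y].
- by rewrite Bl Bl'; ring.
- by rewrite conjM conjD -Bh -Bh' conj_emb.
- move=> x; rewrite /quad re_embM reD.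
  by have := qB x; have := qB' x; rewrite /quad; lra.
Qed.

Lemma minorant_functional (f : functional) : unit_functionals S f ->
  minorant S (fun v w => f v * conj S (f w)).
Proof.
move=> fu; split; first split=> [a x y z|x y].
- by rewrite fun_linear; ring.
- by rewrite conjM conjK mulrC.
- move=> x; rewrite /quad mul_conj re_emb sqr_ge0 lerXn2r// ?nnegrE ?modulus_ge0 ?nrm_ge0//.
Qed.

Section MaximalGram.
Variables (B : X -> X -> K) (x y : X).
Hypothesis iB : minorant S B.
Hypothesis B_max : forall B', minorant S B' -> gram B' x y <= gram B x y.
Hypothesis B_gram : 0 < gram B x y.
Hypothesis xy_span : forall v, exists a b, v = a *: x + b *: y.

(** An isometry multiplies the Gram determinants of all forms by the same factor; maximality
   for the isometry and its inverse makes this factor harmless. *)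
Lemma gram_max_Isom T : Isom T -> gram B (T x) (T y) = gram B x y.
Proof.
move=> iT; have hB := iB.1.
have le : gram B (T x) (T y) <= gram B x y := B_max (minorant_Isom iT iB).
apply/eqP; rewrite eq_le le /=.
have [T' [iT' TK T'K]] := Isom_inverse iT.
have [p [q xE]] := xy_span (T x); have [r [t yE]] := xy_span (T y).
have iB' := minorant_Isom iT' iB.
have -> : gram B x y = mod (p * t - q * r) ^+ 2 * gram (fun v w => B (T' v) (T' w)) x y.
  by rewrite -(gram_comb _ _ _ _ _ _ iB'.1) -xE -yE /gram !TK.
by rewrite xE yE gram_comb// ler_wpM2l ?sqr_ge0// B_max.
Qed.

(** The mean of B and of its transform by T is a minorant too, so gram_unique applies. *)
Lemma max_form_Isom T v w : Isom T -> B (T v) (T w) = B v w.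
Proof.
move=> iT; have [hB qB] := iB; have [Bl Bh] := hB.
have iBT := minorant_Isom iT iB.
have /andP[a0 _] := qB x; have /andP[a0' _] := iBT.2 x.
have E' := gram_max_Isom iT; have Hm := B_max (minorant_mean iB iBT).
have [] := @gram_unique R (re (B x x)) (re (B y y)) (re (B (T x) (T x))) (re (B (T y) (T y)))
  (re (B x y)) (im S (B x y)) (re (B (T x) (T y))) (im S (B (T x) (T y))) (gram B x y) => //.
- by rewrite -modulus2.
- by rewrite -modulus2.
- rewrite -(imD S (B x y)) -(reD S (B x y)) -modulus2; move: Hm; rewrite {1}/gram !re_embM modulusM modulus_emb !reD.
  rewrite ger0_norm; last by lra.
  by rewrite exprMn; lra.
move=> xx yy xy1 xy2.
have [p [q ->]] := xy_span v; have [r [t ->]] := xy_span w.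
rewrite !linearP !linearZ.
have := @form_ext R K S X (fun v w => B (T v) (T w)) B x y iBT.1 hB _ _ _ p q r t.
rewrite /= !linearD !linearZ; apply.
- by rewrite (B_quad Bh (T x)) (B_quad Bh x) /quad xx.
- by apply: (scalar_eq (S := S)); rewrite ?xy1 ?xy2.
- by rewrite (B_quad Bh (T y)) (B_quad Bh y) /quad yy.
Qed.

Lemma max_form_pos v : v != 0 -> 0 < re (B v v).
Proof.
move=> v0; have [hB qB] := iB; have [Bl Bh] := hB; have /andP[q0 _] := qB v.
rewrite lt_neqAle q0 andbT eq_sym; apply/eqP => qv.
have Bv w : B v w = 0.
  have := cauchy_schwarz v w hB (fun u => proj1 (andP (qB u))).
  rewrite /quad qv mul0r => h; apply: (modulus_eq0 (S := S)); apply/eqP.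
  by rewrite -sqrf_eq0 eq_le h sqr_ge0.
have [a [b vE]] := xy_span v; have := emb_gram x y hB.
have hx := Bv x; have hy := Bv y; rewrite vE Bl (BZl Bl) in hx; rewrite vE Bl (BZl Bl) in hy.
have D0 : emb S (gram B x y) != 0.
  by rewrite -(rmorph0 (emb S)) (inj_eq (emb_inj (S := S))) gt_eqF.
move=> E; have aD : a * emb S (gram B x y) = 0.
  rewrite E; transitivity ((a * B x x + b * B y x) * B y y - (a * B x y + b * B y y) * B y x).
    by ring.
  by rewrite hx hy !mul0r subrr.
have bD : b * emb S (gram B x y) = 0.
  rewrite E; transitivity ((a * B x y + b * B y y) * B x x - (a * B x x + b * B y x) * B x y).
    by ring.
  by rewrite hx hy !mul0r subrr.
move/eqP: aD; rewrite mulf_eq0 (negbTE D0) orbF => /eqP aE.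
move/eqP: bD; rewrite mulf_eq0 (negbTE D0) orbF => /eqP bE.
by move: v0; rewrite vE aE bE !scale0r addr0 eqxx.
Qed.

End MaximalGram.

Hypotheses (sepX : separable_space X) (reflX : reflexive_space X).
Hypothesis fixed_line : forall y x, y != 0 -> fixed [:: y] x -> exists a, x = a *: y.
Variables e1 e2 : X.
Hypothesis e12 : indep2 e1 e2.
Hypothesis e12_span : forall v, exists a b, v = a *: e1 + b *: e2.

(** The form of maximal determinant below the square of the norm (that of the Loewner ellipsoid of
   the unit ball) is unique, hence invariant under isometries. So B(., y) is invariant under the
   isometries fixing y, and therefore proportional to a support functional at y. *)
Theorem hermitian_norm_dim2 : hermitian_norm S X.
Proof.
have [F [F_inv F_unit F_norm]] := support_map S sepX reflX.
have [e10 _] := indep2_neq0 e12; have n1 := nrm_gt0 S e10.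
have F1 := F_neq0 F_norm e10.
pose c : K := F e1 e2 / F e1 e1; pose u := e2 - c *: e1.
have F1u : F e1 u = 0 by rewrite /u funB funZ divfK// subrr.
have u_span v : exists a b, v = a *: e1 + b *: u.
  have [a [b ->]] := e12_span v; exists (a + b * c), b.
  by rewrite /u scalerBr scalerDl scalerA addrACA subrr addr0.
have u0 : u != 0.
  apply/eqP => E; have [|_ /eqP] := @e12 (- c) 1.
    by rewrite scale1r scaleNr addrC.
  by rewrite oner_eq0.
have nu := nrm_gt0 S u0.
have [B [iB B_max]] := gram_max S e1 u.
(* the mean of the squares of two support functionals is a positive definite minorant *)
have B_gram : 0 < gram B e1 u.
  apply: lt_le_trans (B_max _ (minorant_mean (minorant_functional (F_unit e1))
    (minorant_functional (F_unit u)))).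
  rewrite /gram !F1u !F_norm conj0 mulr0 !add0r !re_embM reD mul_conj re_emb.
  rewrite !conj_emb re_emb mulr0 add0r !modulusM !modulus_emb.
  set p := F u e1; rewrite mul_conj re_emb -expr2.
  rewrite (ger0_norm (ltW nu)) (ger0_norm (ltW n1)) ger0_norm; last by lra.
  rewrite !exprMn.
  rewrite (_ : _ - _ = 1 / 4 * (nrm e1 ^+ 2 * nrm u ^+ 2)); last by field.
  by rewrite !mulr_gt0// exprn_gt0.
have [[Bl Bh] qB] := iB.
have B_pos := max_form_pos iB B_gram u_span.
apply: (hermitian_norm_of_support Bl Bh _ B_pos) => v y.
have [->|y0] := eqVneq y 0; first by rewrite nrm0 mulr0 mulr_ge0 ?modulus_ge0 ?nrm_ge0.
have [f fE] : exists f : functional, forall v, f v = B v y.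
  apply: (@bounded_functional R K S X _ (nrm y)) => [a x z|x]; first exact: Bl.
  by rewrite mulrC; exact: minorant_bound.
have fi : inv [:: y] f.
  move=> x e e0; have C0 : 0 < nrm x + 1 by rewrite ltr_wpDl// nrm_ge0.
  apply: filterS (filterI (fixing_filter_Isom S [:: y])
    (fixing_filter_near S (mem_head y [::]) (divr_gt0 e0 C0))) => T [iT /=].
  rewrite ler_pdivlMr// => Te; rewrite !fE -(max_form_Isom iB B_max B_gram u_span x y iT).
  have -> : B (T x) y - B (T x) (T y) = B (T x) (y - T y).
    by rewrite (BDr Bl Bh) -[in RHS]scaleN1r (BZr Bl Bh) conjN conj1 mulN1r.
  apply: le_trans (minorant_bound _ _ iB) _; rewrite (Isom_nrm S x iT) nrm_distC.
  by apply: le_trans Te; rewrite mulrC ler_wpM2l ?nrm_ge0// lerDl.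
have [k kE] := inv_line sepX reflX fixed_line F_inv F_norm y0 fi.
rewrite -!fE kE !functionalZ !modulusM F_norm modulus_emb ger0_norm ?nrm_ge0//.
rewrite -!mulrA ler_wpM2l ?modulus_ge0// mulrC ler_wpM2l ?nrm_ge0//; exact: F_unit.
Qed.

End DimensionTwo.

(** * Lines, closed planes and perpendiculars *)

Section LowDimension.
Variables (R : realType) (K : numFieldType) (S : scalars R K) (X : normedModType K).
Local Notation functional := (functional X).
Local Notation nrm := (nrm S).
Implicit Types (x y z v w : X).

Lemma hermitian_norm_line e : (forall x, exists a, x = a *: e) -> hermitian_norm S X.
Proof.
move=> H; have [f [fu fe]] := norming_functional S e.
exists (fun v w => f v * conj S (f w)); split=> [a x y z|x y|x].
- by rewrite fun_linear; ring.
- by rewrite conjM conjK mulrC.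
- have [a ->] := H x.
  by rewrite mul_conj funZ fe modulusM modulus_emb ger0_norm ?nrm_ge0// nrmZ.
Qed.

(** A plane is the fixed set of a continuous projection built from norming functionals. *)
Lemma closed_plane y z : closed [set x | exists a b, x = a *: y + b *: z].
Proof.
have emb_nrm v : v != 0 -> emb S (nrm v) != 0.
  by move=> v0; rewrite -(rmorph0 (emb S)) (inj_eq (emb_inj (S := S))) gt_eqF// nrm_gt0.
have [f0 [_ f0z]] := norming_functional S z.
pose k : K := f0 y / f0 z; pose w := y - k *: z.
have [g0 [_ g0w]] := norming_functional S w.
pose f := (f0 z)^-1 *: f0; pose g1 := g0 - (g0 z / f0 z) *: f0.
pose g := (g1 w)^-1 *: g1.
have zN : z = 0 \/ f0 z != 0.
  by have [->|z0] := eqVneq z 0; [left|right; rewrite f0z emb_nrm].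
have fz : f z *: z = z.
  by case: zN => [->|z0]; rewrite ?scaler0// functionalZ mulVf// scale1r.
have fw : f w *: z = 0.
  case: zN => [->|z0]; first by rewrite scaler0.
  by rewrite functionalZ funB funZ divfK// subrr mulr0 scale0r.
have gz : g1 z = 0.
  rewrite functionalB functionalZ; case: zN => [->|z0]; last by rewrite divfK// subrr.
  by rewrite !fun0 !mulr0 subrr.
have g1w : g1 w = g0 w.
  rewrite functionalB functionalZ; case: zN => [->|z0].
    by rewrite fun0 !mul0r subr0.
  by rewrite /w (funB f0) funZ divfK// subrr mulr0 subr0.
have gw : g w *: w = w.
  have [->|w0] := eqVneq w 0; first by rewrite scaler0.
  by rewrite functionalZ mulVf ?scale1r// g1w g0w emb_nrm.
have {}gz : g z = 0 by rewrite functionalZ gz mulr0.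
clearbody f g.
pose h v := v - (f v *: z + g v *: w).
have -> : [set x | exists a b, x = a *: y + b *: z] = h @^-1` [set 0].
  apply/seteqP; split=> [v [a [b ->]]|v /= /eqP].
    have -> : a *: y + b *: z = (b + a * k) *: z + a *: w.
      by rewrite /w scalerBr scalerDl scalerA addrAC addrA subrK addrC.
    rewrite /preimage /= /h !fun_linear !funZ gz mulr0 add0r.
    by rewrite [X in _ - (X + _)]scalerDl -!scalerA fz fw gw scaler0 addr0 subrr.
  rewrite subr_eq0 => /eqP ->; exists (g v), (f v - g v * k).
  by rewrite /w scalerBr scalerBl scalerA addrCA.
apply: preimage_closed; last exact/accessible_closed_set1/hausdorff_accessible/norm_hausdorff.
move=> v _; apply: cvgB; first exact: cvg_id.
by apply: cvgD; apply: cvgZr_tmp; exact: (functional_dual _).2.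
Qed.

End LowDimension.

Section Householder.
Variables (R : realType) (K : numFieldType) (S : scalars R K) (X : completeNormedModType K).
Local Notation nrm := (nrm S).
Local Notation mod := (modulus S).
Implicit Types (x y z v w : X).
Variable B : X -> X -> K.
Hypothesis B_lin : forall a x y z, B (a *: x + y) z = a * B x z + B y z.
Hypothesis B_herm : forall x y, B x y = conj S (B y x).
Hypothesis B_nrm : forall x, B x x = emb S (nrm x ^+ 2).

Let BB x y : B (x + y) (x + y) = B x x + B y y + (B x y + B y x).
Proof. by rewrite (BDl B_lin) !(BDr B_lin B_herm); ring. Qed.

Lemma parallelogram x y : nrm (x + y) ^+ 2 + nrm (x - y) ^+ 2 = 2 * nrm x ^+ 2 + 2 * nrm y ^+ 2.
Proof.
have E v : nrm v ^+ 2 = re S (B v v) by rewrite B_nrm re_emb.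
rewrite !E !BB -scaleN1r !(BZl B_lin) !(BZr B_lin B_herm) conjN conj1 !mulN1r opprK.
by rewrite !reD !reN; ring.
Qed.

Variable Y : set X.
Hypotheses (Y_lin : linear_subspace Y) (Y_closed : closed Y).

Let Y_mid y y' : Y y -> Y y' -> Y (emb S (1 / 2) *: (y + y')).
Proof.
move=> Yy Yy'; have := Y_lin.2 1 _ _ Yy Yy'; rewrite scale1r => H.
by have := Y_lin.2 (emb S (1 / 2)) _ _ H Y_lin.1; rewrite addr0.
Qed.

(** Nearly minimizing points form a Cauchy filter by the parallelogram identity. *)
Lemma nearest_point x : exists2 p, Y p & forall y, Y y -> nrm (x - p) <= nrm (x - y).
Proof.
pose D := [set nrm (x - y) | y in Y]; pose d := inf D.
have D_lb : has_lbound D by exists 0 => _ [y _ <-]; exact: nrm_ge0.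
have D_inf : has_inf D by split=> //; exists (nrm (x - 0)); exists 0 => //; exact: Y_lin.1.
have d_le y : Y y -> d <= nrm (x - y) by move=> Yy; apply: ge_inf => //; exists y.
have d0 : 0 <= d by apply: lb_le_inf; [exact: D_inf.1|move=> _ [y _ <-]; exact: nrm_ge0].
pose near e := [set y | Y y /\ nrm (x - y) < d + e].
pose F := filter_from [set e : R | 0 < e] near.
have FF : ProperFilter F.
  apply: filter_from_proper; last first.
    by move=> e e0; have [_ [y Yy <-] ye] := inf_adherent e0 D_inf; exists y.
  apply: filter_from_filter; first by exists 1 => /=.
  move=> i j i0 j0; exists (Num.min i j); first by rewrite /= lt_min i0 j0.
  by move=> y [Yy H]; split; split=> //; apply: lt_le_trans H _; rewrite lerD2l ge_min lexx ?orbT.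
have near_dist e y y' : 0 < e -> near e y -> near e y' -> nrm (y - y') ^+ 2 <= e * (8 * d + 4 * e).
  move=> e0 [Yy ye] [Yy' ye'].
  have := parallelogram (x - y) (x - y'); have := d_le _ (Y_mid Yy Yy').
  have -> : x - y - (x - y') = y' - y by rewrite opprB addrC addrA subrK.
  have -> : x - y + (x - y') = emb S 2 *: (x - emb S (1 / 2) *: (y + y')).
    rewrite scalerBr scalerA -rmorphM mulrC mul1r mulVf ?pnatr_eq0// rmorph1 scale1r.
    by rewrite rmorph_nat scaler_nat mulr2n addrACA opprD.
  rewrite nrmZ modulus_emb ger0_norm// (nrm_distC S y').
  set m := nrm (x - _ *: _); set a := nrm (x - y) in ye *; set b := nrm (x - y') in ye' *.
  set q := nrm (y - y'); move=> dm E.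
  have de : 0 <= d + e by rewrite addr_ge0// ltW.
  have a2 : a ^+ 2 <= (d + e) ^+ 2.
    by rewrite lerXn2r// ?nnegrE; [exact: nrm_ge0|exact: ltW].
  have b2 : b ^+ 2 <= (d + e) ^+ 2.
    by rewrite lerXn2r// ?nnegrE; [exact: nrm_ge0|exact: ltW].
  have m2 : d ^+ 2 <= m ^+ 2 by rewrite lerXn2r// nnegrE; exact: nrm_ge0.
  move: E a2 b2 m2; rewrite exprMn !expr2; lra.
have Fc : cauchy F.
  apply: cauchy_exP => eps eps0; pose r := mod eps.
  have epsE : eps = emb S r by rewrite -[LHS](gtr0_norm eps0); exact: normE.
  have r0 : 0 < r by apply: modulus_gt0; rewrite gt_eqF.
  pose e := Num.min 1 (r ^+ 2 / (8 * d + 8)).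
  have dd : 0 < 8 * d + 8 by lra.
  have e0 : 0 < e by rewrite lt_min ltr01 divr_gt0// exprn_gt0.
  have [_ [y Yy <-] ye] := inf_adherent e0 D_inf.
  exists y, e => // y' y'N; rewrite -ball_normE /= epsE -(embs_nrm S) emb_lt.
  have H := near_dist e y y' e0 (Logic.conj Yy ye) y'N.
  rewrite -(@ltr_pXn2r _ 2)// ?nnegrE ?nrm_ge0 ?ltW//; apply: le_lt_trans H _.
  have e1 : e <= 1 by rewrite ge_min lexx.
  have e2 : e * (8 * d + 8) <= r ^+ 2 by rewrite -ler_pdivlMr// ge_min lexx orbT.
  apply: lt_le_trans e2; rewrite ltr_pM2l//; lra.
have /cvg_ex[p Fp] := @cauchy_cvg X F FF Fc.
have Fnear e : 0 < e -> F [set y | nrm (y - p) < e].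
  exact: ((@nrm_cvgP R K S X X F _ id p).1 Fp e).
exists p.
  apply: Y_closed => N /Fp FN; have : F (near 1) by exists 1 => //=.
  by move=> /(filterI FN)/filter_ex[y [Ny [Yy _]]]; exists y.
move=> y /d_le; apply: le_trans; apply/ler_addgt0Pr => e e0.
have e2 : 0 < e / 2 by rewrite divr_gt0.
have : F (near (e / 2)) by exists (e / 2).
move=> /(filterI (Fnear _ e2))/filter_ex[v [/= vp [Yv xv]]].
have := nrmD S (x - v) (v - p); rewrite addrA subrK; lra.
Qed.

(** The foot p of the perpendicular from x to Y is the nearest point: moving from p in the
   direction of y would otherwise decrease the distance to first order. *)
Lemma orthogonal_part x : exists2 p, Y p & forall y, Y y -> B y (x - p) = 0.
Proof.
have [p Yp Hp] := nearest_point x; exists p => // y Yy.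
have [->|y0] := eqVneq y 0; first exact: B0l.
have ny := nrm_gt0 S y0; set w := x - p in Hp *.
(* the coefficient minimizing the norm of w - c *: y *)
pose c := B w y / emb S (nrm y ^+ 2).
have := Hp (c *: y + p) (Y_lin.2 _ _ _ Yy Yp).
have -> : x - (c *: y + p) = w + (- c) *: y by rewrite scaleNr opprD addrCA addrC addrAC.
move=> H; have : nrm w ^+ 2 <= nrm (w + (- c) *: y) ^+ 2.
  by rewrite lerXn2r ?nnegrE ?nrm_ge0.
have n2 : emb S (nrm y ^+ 2) != 0.
  by rewrite -(rmorph0 (emb S)) (inj_eq (emb_inj (S := S))) gt_eqF// exprn_gt0.
have -> : nrm (w + (- c) *: y) ^+ 2 = nrm w ^+ 2 - mod (B w y) ^+ 2 / nrm y ^+ 2.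
  apply: (emb_inj (S := S)); rewrite -B_nrm BB (BZl B_lin) !(BZr B_lin B_herm) (BZl B_lin).
  rewrite !B_nrm rmorphB fmorph_div /= -mul_conj conjN (B_herm y w) /c conjM.
  have -> : conj S (emb S (nrm y ^+ 2))^-1 = (emb S (nrm y ^+ 2))^-1.
    by rewrite -fmorphV conj_emb.
  by move: (emb S (nrm y ^+ 2)) n2 => N n2; field.
rewrite lerBrDr gerDl => H2.
have : mod (B w y) ^+ 2 <= 0.
  by move: H2; rewrite pmulr_lle0// invr_gt0 exprn_gt0.
move=> H3; have /modulus_eq0 E : mod (B w y) = 0.
  by apply/eqP; rewrite -sqrf_eq0 eq_le H3 sqr_ge0.
by rewrite B_herm E conj0.
Qed.

(** The reflection in the hyperplane orthogonal to x - p, with p the foot of the perpendicular,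
   is an isometry fixing Y and moving x. *)
Theorem hermitian_Env : Env Y = Y.
Proof.
apply/seteqP; split=> [x xE|x Yx I le T dir iT HT]; last exact: HT.
apply: contrapT => nYx; have [p Yp perp] := orthogonal_part x.
set w := x - p in perp; have w0 : w != 0.
  by apply/eqP => /eqP; rewrite subr_eq0 => /eqP E; apply: nYx; rewrite E.
have n2 : emb S (nrm w ^+ 2) != 0.
  by rewrite -(rmorph0 (emb S)) (inj_eq (emb_inj (S := S))) gt_eqF// exprn_gt0// nrm_gt0.
pose h v := v - (2 * B v w / emb S (nrm w ^+ 2)) *: w.
have h_lin a u v : h (a *: u + v) = a *: h u + h v.
  rewrite /h B_lin (scalerBr a u) scalerA [RHS]addrACA; congr (_ + _).
  by rewrite -opprD -scalerDl; congr (- (_ *: _)); ring.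
pose T : {linear X -> X} := HB.pack h (GRing.isLinear.Build _ _ _ _ h h_lin).
have h_inv v : h (h v) = v.
  rewrite {1}/h; have -> : B (h v) w = - B v w.
    by rewrite /h -scaleNr addrC B_lin B_nrm; move: (emb S (nrm w ^+ 2)) n2 => N n2; field.
  by rewrite /h mulrN mulNr scaleNr opprK subrK.
have h_nrm v : nrm (h v) = nrm v.
  apply/eqP; rewrite -(@eqrXn2 _ 2) ?nrm_ge0//; apply/eqP.
  apply: (emb_inj (S := S)); rewrite -!B_nrm /h -scaleNr BB (BZl B_lin) !(BZr B_lin B_herm).
  rewrite (BZl B_lin) (B_nrm w) conjN !conjM (B_herm w v).
  have -> : conj S (emb S (nrm w ^+ 2))^-1 = (emb S (nrm w ^+ 2))^-1.
    by rewrite -fmorphV conj_emb.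
  have -> : conj S 2 = 2 by rewrite -(rmorph_nat (emb S)) conj_emb.
  by move: (emb S (nrm w ^+ 2)) n2 => N n2; field.
have iT' : Isom T by apply: (nrm_Isom (S := S)) => // y; exists (h y); exact: h_inv.
have dir' : @directed unit (fun _ _ => True) by split=> //; exists tt.
have h_fix y : Y y -> h y = y by move=> /perp yw; rewrite /h yw mulr0 mul0r scale0r subr0.
have hx : h x != x.
  rewrite /h subr_eq addrC -subr_eq subrr eq_sym scaler_eq0 negb_or w0 andbT.
  have -> : B x w = emb S (nrm w ^+ 2).
    by rewrite -{1}(subrK p x) -/w (BDl B_lin) (perp _ Yp) addr0 B_nrm.
  by rewrite mulfK// pnatr_eq0.
have d0 : 0 < nrm (h x - x) by apply: nrm_gt0; rewrite subr_eq0.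
have Tx : (fun _ : unit => T x) @ net_tails (fun _ _ => True) --> x.
  apply: xE => // y /h_fix hy A /nbhs_singleton Ay.
  by exists tt => i _; rewrite /= hy.
have /Tx[i /(_ i Logic.I)] : nbhs x [set v | nrm (v - x) < nrm (h x - x)].
  exact: ((@nrm_cvgP R K S X X (nbhs x) _ id x).1 cvg_id _ d0).
by rewrite /= ltxx.
Qed.

End Householder.

(** * Envelopes and inner products *)

Section Planes.
Variables (R : realType) (K : numFieldType) (X : lmodType K).
Implicit Types (x y z : X) (Y : set X).

Definition span2 y z : set X := [set x | exists a b, x = a *: y + b *: z].

Lemma span2_subspace y z : linear_subspace (span2 y z).
Proof.
split; first by exists 0, 0; rewrite !scale0r addr0.
move=> a u v [b [c ->]] [b' [c' ->]]; exists (a * b + b'), (a * c + c').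
by rewrite scalerDr !scalerA addrACA -!scalerDl.
Qed.

Let sum2 (c : 'I_2 -> K) (e : 'I_2 -> X) :
  \sum_(i < 2) c i *: e i = c ord0 *: e ord0 + c ord_max *: e ord_max.
Proof. by rewrite !big_ord_recl big_ord0 addr0; congr (_ + c _ *: e _); exact: val_inj. Qed.

Lemma has_dim2P Y : has_dim 2 Y <-> exists y z, indep2 y z /\ Y = span2 y z.
Proof.
split=> [[e [ei ->]]|[y [z [yz ->]]]].
  exists (e ord0), (e ord_max); split.
    move=> a b E; pose c (i : 'I_2) := if i == ord0 then a else b.
    have ci : \sum_(i < 2) c i *: e i = 0 by rewrite sum2.
    by split; [have := ei c ci ord0|have := ei c ci ord_max].
  apply/seteqP; split=> [_ [c _ <-]|_ [a [b ->]]].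
    by exists (c ord0), (c ord_max); rewrite sum2.
  by exists (fun i : 'I_2 => if i == ord0 then a else b) => //; rewrite sum2.
exists (fun i : 'I_2 => if i == ord0 then y else z); split.
  move=> c; rewrite sum2 => /yz[c0 c1] i; have [->//|] := eqVneq i ord0.
  by move=> i0; rewrite -[RHS]c1; congr c; apply: val_inj; case: i i0 => -[|[|]].
apply/seteqP; split=> [_ [a [b ->]]|_ [c _ <-]].
  by exists (fun i : 'I_2 => if i == ord0 then a else b) => //; rewrite sum2.
by exists (c ord0), (c ord_max); rewrite sum2.
Qed.

End Planes.

Section Characterization.
Variables (R : realType) (K : numFieldType) (S : scalars R K) (X : completeNormedModType K).
Implicit Types (x y z : X).

Lemma hilbertianP : hilbertian (conj S) X <-> hermitian_norm S X.
Proof.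
split=> [[dot dotE]|[B [Bl Bh Bn]]].
  exists dot; split=> [a x y z|x y|x].
  - exact: linearPl.
  - by rewrite (hermitian_subproof x y) expr0 mul1r.
  - by rewrite dotE rmorphXn /= embs_nrm.
have B1 u' : zmod_morphism (B ^~ u').
  by move=> x y; rewrite -[x - y]addrC -scaleN1r Bl mulN1r addrC.
have B2 u : zmod_morphism (B u).
  by move=> x y; rewrite Bh -[x - y]addrC -scaleN1r Bl conjD -Bh mulN1r conjN -Bh addrC.
have B3 u' : scalable_for *%R (B ^~ u') by move=> a x; exact: BZl Bl a x u'.
have B4 u : scalable_for (conj S \; *%R) (B u) by move=> a x; exact: BZr Bl Bh a u x.
have B5 x y : B x y = (-1) ^+ false * conj S (B y x) by rewrite expr0 mul1r -Bh.
have B6 u : u != 0 -> 0 < B u u.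
  by move=> u0; rewrite Bn -(rmorph0 (emb S)) emb_lt exprn_gt0// nrm_gt0.
pose D : {dot X for conj S} := HB.pack B (isBilinear.Build K X X K *%R (conj S \; *%R) B B1 B2 B3 B4)
  (isHermitianSesquilinear.Build K X false (conj S) B B5) (isDotProduct.Build K X B B6).
by exists D => x; rewrite /= Bn rmorphXn /= embs_nrm.
Qed.

Hypotheses (sepX : separable_space X) (reflX : reflexive_space X).

Lemma fixed_span2 y z x : Env (span2 y z) = span2 y z ->
  asymptotically_fixed S [:: y; z] x -> span2 y z x.
Proof.
move=> <-; apply: asymptotically_fixed_Env => u; rewrite !inE => /orP[]/eqP ->.
  by exists 1, 0; rewrite scale1r scale0r addr0.
by exists 0, 1; rewrite scale1r scale0r add0r.
Qed.

(** A space that has no three independent vectors is a plane, which is excluded, or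
   spanned by one vector. *)
Lemma hermitian_norm_not_dim2 : ~ has_dim 2 [set: X] ->
  (forall Y : set X, has_dim 2 Y -> Env Y = Y) -> hermitian_norm S X.
Proof.
move=> n2 H; have [dim3|] := pselect (forall y z, exists x, forall a b, x != a *: y + b *: z).
  apply: hermitian_norm_dim3 => // y z x yz; apply: fixed_span2.
  by apply: H; apply/has_dim2P; exists y, z.
move=> /existsNP[y /existsNP[z N]].
have yzX x : exists a b, x = a *: y + b *: z.
  apply: contrapT => Nx; apply: N; exists x => a b; apply/eqP => E.
  by apply: Nx; exists a, b.
have [y0|y0] := eqVneq y 0.
  apply: (hermitian_norm_line S (e := z)) => x; have [a [b ->]] := yzX x.
  by exists b; rewrite y0 scaler0 add0r.
have [[c zE]|Nz] := pselect (exists c, z = c *: y).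
  apply: (hermitian_norm_line S (e := y)) => x; have [a [b ->]] := yzX x.
  by exists (a + b * c); rewrite zE scalerA scalerDl.
case: n2; apply/has_dim2P; exists y, z; split.
  by apply: indep2P => // a; apply/eqP => E; apply: Nz; exists a.
by apply/seteqP; split=> x _ //; exact: yzX.
Qed.

(** Planes are closed, so the envelope hypothesis applies to them; in dimension two it is
   used for lines, written as degenerate planes span2 y 0. *)
Theorem hermitian_norm_iff : hermitian_norm S X <->
  forall Y : set X, linear_subspace Y -> closed Y -> Env Y = Y.
Proof.
split=> [[B [Bl Bh Bn]] Y Yl Yc|H]; first exact: hermitian_Env Bl Bh Bn Y Yl Yc.
have Env2 y z : Env (span2 y z) = span2 y z.
  by apply: H; [exact: span2_subspace|exact: (@closed_plane R K S X y z)].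
have [/has_dim2P[e1 [e2 [e12 XE]]]|n2] := pselect (has_dim 2 [set: X]); last first.
  by apply: hermitian_norm_not_dim2 => // Y /has_dim2P[y [z [_ ->]]]; exact: Env2.
apply: (hermitian_norm_dim2 sepX reflX _ e12) => [y x y0 yx|v]; last first.
  by have : [set: X] v by []; rewrite XE.
have [|a [b ->]] := @fixed_span2 y 0 x (Env2 y 0).
  apply: fixed_sub yx => u; rewrite inE => /eqP ->.
  by apply: fixed_mem; exact: mem_head.
by exists a; rewrite scaler0 addr0.
Qed.

End Characterization.

(** * The real and the complex field *)

Local Open Scope complex_scope.

Section RealScalars.
Variable R : realType.

Fact real_split (x : R) : x = idfun x - 0 * idfun (idfun (0 * x)).
Proof. by rewrite mul0r subr0. Qed.

Fact real_norm (x : R) : `|x| = idfun (Num.sqrt (idfun x ^+ 2 + idfun (0 * x) ^+ 2)).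
Proof. by rewrite /= mul0r expr0n addr0 sqrtr_sqr. Qed.

Definition real_scalars : scalars R R :=
  @Scalars R R idfun idfun 0 (fun _ _ => erefl) (fun _ _ => erefl) erefl erefl
    (or_introl erefl) (or_introl erefl) real_split real_norm.

Lemma real_conj : conj real_scalars = idfun.
Proof. by apply: funext => x; rewrite /conj /= mul0r addr0. Qed.

End RealScalars.

Section ComplexScalars.
Variable R : realType.
Implicit Types z w : R[i].

Fact Re_sub z w : complex.Re (z - w) = complex.Re z - complex.Re w.
Proof. by case: z w => a b [c d]. Qed.

Fact Re_embM (r : R) z : complex.Re (r%:C * z) = r * complex.Re z.
Proof. by case: z => a b /=; rewrite mul0r subr0. Qed.

Fact sqr_i : 'i * 'i = -1 :> R[i].
Proof. by rewrite -expr2 sqr_i. Qed.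

Fact complex_sqrt z : exists w, w * w = z.
Proof. by exists (sqrtc z); rewrite -expr2 sqr_sqrtc. Qed.

Fact complex_split z : z = (complex.Re z)%:C - 'i * (complex.Re ('i * z))%:C.
Proof. by rewrite ['i * z]mulrC ReiNIm rmorphN mulrN opprK -complexE. Qed.

Fact complex_norm z : `|z| = (Num.sqrt (complex.Re z ^+ 2 + complex.Re ('i * z) ^+ 2))%:C.
Proof. by rewrite ['i * z]mulrC ReiNIm sqrrN normc_def. Qed.

Definition complex_scalars : scalars R R[i] :=
  @Scalars R R[i] (@complex.Re R) (real_complex R) 'i Re_sub Re_embM erefl erefl
    (or_intror sqr_i) (or_intror complex_sqrt) complex_split complex_norm.

Lemma complex_conj : conj complex_scalars = Num.conj.
Proof.
apply: funext => z; rewrite /conj /im /= ['i * z]mulrC ReiNIm rmorphN mulrN.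
by case: z => a b; apply/eqP; rewrite eq_complex /=; simpc.
Qed.

End ComplexScalars.

Theorem corollary2p29 (R : realType) :
  (forall X : completeNormedModType R,
     separable_space X -> reflexive_space X ->
     (hilbertian idfun X <->
        forall Y : set X, linear_subspace Y -> closed Y -> Env Y = Y) /\
     (~ has_dim 2 [set: X] ->
        (forall Y : set X, has_dim 2 Y -> Env Y = Y) -> hilbertian idfun X)) /\
  (forall X : completeNormedModType R[i],
     separable_space X -> reflexive_space X ->
     (hilbertian Num.conj X <->
        forall Y : set X, linear_subspace Y -> closed Y -> Env Y = Y) /\
     (~ has_dim 2 [set: X] ->
        (forall Y : set X, has_dim 2 Y -> Env Y = Y) -> hilbertian Num.conj X)).
Proof.
rewrite -(real_conj R) -(complex_conj R).
by split=> X sepX reflX; (split; first by rewrite hilbertianP hermitian_norm_iff);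
  move=> n2 H; apply/hilbertianP; exact: hermitian_norm_not_dim2.
Qed.
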